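(* Suppose the problem assumption and the noise assumption of the context hold, and let $\tau,\sigma>0$, $\theta\ge0$ satisfy the matrix inequality (MI) of the context for some $\rho\in(0,1)$ and $\alpha\in[0,\sigma^{-1})$. Let $(x_n,y_n)_{n\ge1}$ be the SAPD iterates initialized at an arbitrary $(x_0,y_0)\in\mathrm{dom} f\times\mathrm{dom} g$, and let $\mathcal{C}_{\tau,\sigma,\theta}$ and $\Xi^{(i)}_{\tau,\sigma,\theta}$, $i=1,2,3$, be the constants defined in the context. Then for all $n\in\mathbb{N}$ and $p\in[0,1)$, $$\mathrm{CVaR}_p\left(\mathcal{D}_{n+1}^{1/2}\right)\le\sqrt{\left(\tfrac{1+\rho}2\right)^{n/2}\left(\mathcal{C}_{\tau,\sigma,\theta}\,\mathcal{D}_{\tau,\sigma}+\Xi^{(1)}_{\tau,\sigma,\theta}\right)+\Xi^{(2)}_{\tau,\sigma,\theta}}+\sqrt{\Xi^{(3)}_{\tau,\sigma,\theta}\left(1+\log\left(\tfrac1{1-p}\right)\right)},$$ $$\mathrm{EVaR}_p\left(\mathcal{D}_{n+1}^{1/2}\right)\le\sqrt{\left(\tfrac{1+\rho}2\right)^{n/2}\left(\mathcal{C}_{\tau,\sigma,\theta}\,\mathcal{D}_{\tau,\sigma}+\Xi^{(1)}_{\tau,\sigma,\theta}\right)+\Xi^{(2)}_{\tau,\sigma,\theta}}+\sqrt{\Xi^{(3)}_{\tau,\sigma,\theta}}\left(\log\left(\tfrac1{1-p}\right)^{1/2}+\sqrt\pi\right).$$ Furthermore, for all $n\in\mathbb{N}$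 and $r>0$, the right-hand side of the second inequality with $p=1-\frac1{1+r}$ is an upper bound on $\mathcal{R}_{\chi^2,r}\left(\mathcal{D}_{n+1}^{1/2}\right)$.
   Context: Problem assumption. $\mathcal{X},\mathcal{Y}$ are finite-dimensional Euclidean spaces. Consider $\min_{x\in\mathcal{X}}\max_{y\in\mathcal{Y}}\mathcal{L}(x,y):=f(x)+\Phi(x,y)-g(y)$, where $f:\mathcal{X}\to\mathbb{R}\cup\{+\infty\}$ and $g:\mathcal{Y}\to\mathbb{R}\cup\{+\infty\}$ are closed and strongly convex with moduli $\mu_x,\mu_y>0$ respectively, $\Phi:\mathcal{X}\times\mathcal{Y}\to\mathbb{R}$ is continuously differentiable on an open set containing $\mathrm{dom} f\times\mathrm{dom} g$, $\Phi(\cdot,y)$ is convex on $\mathrm{dom} f$ for all $y\in\mathrm{dom} g$, $\Phi(x,\cdot)$ is concave on $\mathrm{dom} g$ for all $x\in\mathrm{dom} f$, and there are $L_{xx},L_{yy}\ge0$, $L_{xy},L_{yx}>0$ such that for all $(x,y),(\bar x,\bar y)\in\mathrm{dom} f\times\mathrm{dom} g$, $\|\nabla_x\Phi(x,y)-\nabla_x\Phi(\bar x,\bar y)\|\le L_{xx}\|x-\bar x\|+L_{xy}\|y-\bar y\|$ and $\|\nabla_y\Phi(x,y)-\nabla_y\Phi(\bar x,\bar y)\|\le L_{yx}\|x-\bar x\|+L_{yy}\|y-\bar y\|$. The problem then has a unique saddle point $(x^\star,y^\star)$: $\mathcal{L}(x^\star,y)\le\mathcal{L}(x^\star,y^\star)\le\mathcal{L}(x,y^\star)$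 for all $(x,y)$. SAPD algorithm. For a proper closed convex $\varphi$, $\mathrm{prox}_\varphi(x)=\arg\min_u\{\varphi(u)+\frac12\|u-x\|^2\}$. Given $\tau,\sigma>0$, $\theta\ge0$, $(x_0,y_0)$, set $\tilde q_0=0$, $x_{-1}=x_0$, $y_{-1}=y_0$, and for $k\ge0$: $\tilde s_k=\tilde\nabla_y\Phi(x_k,y_k,\omega_k^y)+\theta\tilde q_k$; $y_{k+1}=\mathrm{prox}_{\sigma g}(y_k+\sigma\tilde s_k)$; $x_{k+1}=\mathrm{prox}_{\tau f}(x_k-\tau\tilde\nabla_x\Phi(x_k,y_{k+1},\omega_k^x))$; $\tilde q_{k+1}=\tilde\nabla_y\Phi(x_{k+1},y_{k+1},\omega_{k+1}^y)-\tilde\nabla_y\Phi(x_k,y_k,\omega_k^y)$. Here $\tilde\nabla_x\Phi,\tilde\nabla_y\Phi$ are stochastic estimates of the partial gradients and the random variables are revealed in the order $\omega_0^y,\omega_0^x,\omega_1^y,\omega_1^x,\dots$; $\mathcal{F}_k^y$ (resp. $\mathcal{F}_k^x$) is the sigma-algebra generated by all of them up to and including $\omega_k^y$ (resp. $\omega_k^x$), and $\mathcal{F}_{-1}^x$ is trivial. Noise assumption. With $\Delta_k^y=\tilde\nabla_y\Phi(x_k,y_k,\omega_k^y)-\nabla_y\Phi(x_k,y_k)$ and $\Delta_k^x=\tilde\nabla_x\Phi(x_k,y_{k+1},\omega_k^x)-\nabla_x\Phi(x_k,y_{k+1})$, there are $\delta_x,\delta_y>0$ such that for all $k\ge0$,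 $t\ge0$: $\mathbb{E}[\Delta_k^y|\mathcal{F}_{k-1}^x]=0$, $\mathbb{E}[\Delta_k^x|\mathcal{F}_k^y]=0$, $\mathbb{P}[\|\Delta_k^y\|\ge t|\mathcal{F}_{k-1}^x]\le2e^{-t^2/(2\delta_y^2)}$, $\mathbb{P}[\|\Delta_k^x\|\ge t|\mathcal{F}_k^y]\le2e^{-t^2/(2\delta_x^2)}$. Matrix inequality (MI) for $(\tau,\sigma,\theta,\rho,\alpha)$: $$\begin{pmatrix}\frac1\tau+\mu_x-\frac1{\rho\tau}&0&0&0&0\\0&\frac1\sigma+\mu_y-\frac1{\rho\sigma}&(\frac\theta\rho-1)L_{yx}&(\frac\theta\rho-1)L_{yy}&0\\0&(\frac\theta\rho-1)L_{yx}&\frac1\tau-L_{xx}&0&-\frac\theta\rho L_{yx}\\0&(\frac\theta\rho-1)L_{yy}&0&\frac1\sigma-\alpha&-\frac\theta\rho L_{yy}\\0&0&-\frac\theta\rho L_{yx}&-\frac\theta\rho L_{yy}&\frac\alpha\rho\end{pmatrix}\succeq0.$$ Distances. $\mathcal{D}_n=\frac1{2\tau}\|x_n-x^\star\|^2+\frac{1-\alpha\sigma}{2\sigma}\|y_n-y^\star\|^2$; $\mathcal{D}_{\tau,\sigma}=\frac1{2\tau}\|x_0-x^\star\|^2+\frac1{2\sigma}\|y_0-y^\star\|^2$. Risk measures. $Q_p(U)=\inf\{t:\mathbb{P}[U\le t]\ge p\}$; $\mathrm{CVaR}_p(U)=\frac1{1-p}\int_p^1Q_{p'}(U)\,dp'$;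 $\mathrm{EVaR}_p(U)=\inf_{\eta>0}\{-\eta^{-1}\log(1-p)+\eta^{-1}\log\mathbb{E}[e^{\eta U}]\}$; $\mathcal{R}_{\chi^2,r}(U)=\sup\{\mathbb{E}_{\mathbb{Q}}[U]:\mathbb{Q}\ll\mathbb{P},\ \int\frac12(\frac{d\mathbb{Q}}{d\mathbb{P}}-1)^2d\mathbb{P}\le r\}$. Constants. Let $C_{\sigma,\theta}=1+\sigma(1+\theta)L_{yy}$, $s_x=\sqrt{2\rho\tau}$, $s_y=\sqrt{2\rho\sigma/(1-\alpha\sigma)}$, $S=\mathrm{Diag}(s_x,s_y,s_x,s_y)$, and $A_0=\frac1{1+\sigma\mu_y}\big(s_x\sigma(1+\theta)L_{yx},\ s_yC_{\sigma,\theta},\ s_x\sigma\theta L_{yx},\ s_y\sigma\theta L_{yy}\big)^\top$. $\hat A_1=\big(1+\tau L_{xx}+\frac{\tau\sigma(1+\theta)L_{yx}L_{xy}}{1+\sigma\mu_y},\ \frac{\tau L_{xy}C_{\sigma,\theta}}{1+\sigma\mu_y},\ \frac{\sigma\tau\theta L_{xy}L_{yx}}{1+\sigma\mu_y},\ \frac{\sigma\tau\theta L_{xy}L_{yy}}{1+\sigma\mu_y}\big)^\top$. $\hat A_2=(\sigma(1+\theta)L_{yx},\ C_{\sigma,\theta},\ \sigma\theta L_{yx},\ \sigma\theta L_{yy})^\top$. $\hat A_3$ has entries: first, $C_{\sigma,\theta}\sigma(1+\theta)(1+\tau\mu_x)L_{yx}+\sigma(1+\theta)L_{yx}\big((1+\tau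 L_{xx})(1+\sigma\mu_y)+\tau\sigma(1+\theta)L_{yx}L_{xy}\big)+\sigma\theta L_{yx}(1+\tau\mu_x)(1+\sigma\mu_y)$; second, $(1+\tau\mu_x)C_{\sigma,\theta}^2+\sigma(1+\theta)L_{yx}\tau L_{xy}C_{\sigma,\theta}+\sigma\theta L_{yy}(1+\tau\mu_x)(1+\sigma\mu_y)$; third, $\sigma\big(C_{\sigma,\theta}\theta L_{yx}(1+\tau\mu_x)+(1+\theta)\tau\sigma\theta L_{xy}L_{yx}^2\big)$; fourth, $\sigma\big(C_{\sigma,\theta}\theta L_{yy}(1+\tau\mu_x)+(1+\theta)\tau\sigma\theta L_{xy}L_{yx}L_{yy}\big)$. $A_1=\sqrt{\frac{1+\rho}\rho}\frac4{1+\tau\mu_x}S\hat A_1$, $A_2=\sqrt{\frac{1+\rho}\rho}\frac{4\sqrt2(1+\theta)}{1+\sigma\mu_y}S\hat A_2$, $A_3=\sqrt{\frac{1+\rho}\rho}\frac{4\sqrt2\,\theta\rho^{-1}}{(1+\sigma\mu_y)^2(1+\tau\mu_x)}S\hat A_3$. With $F=\frac{C_{\sigma,\theta}}{1+\sigma\mu_y}+\frac{\tau\sigma(1+\theta)L_{yx}L_{xy}}{(1+\tau\mu_x)(1+\sigma\mu_y)}$ and $G=\frac{\rho}{4\|A_0\|^2(1+\rho)}$: $B^x=\frac{4\tau}{1+\rho}+G\frac{\sigma^2(1+\theta)^2L_{yx}^2}{(1+\sigma\mu_y)^2}\frac{3\tau^2}{(1+\tau\mu_x)^2}$; $C^x=\frac\tau{1+\tau\mu_x}+\frac{\tau\sigma(1+2\theta)L_{xy}}{2(1+\tau\mu_x)(1+\sigma\mu_y)}$;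 $C^x_{-1}=\frac{\tau\sigma\theta(1+\theta)L_{yx}}{2\rho(1+\sigma\mu_y)(1+\tau\mu_x)}$; $B^y=\frac{4(1+\theta)^2\sigma}{(1+\rho)(1-\alpha\sigma)}+\frac{3\|A_0\|^2(1+\rho)\theta^2}{\rho^3}+G\frac{C_{\sigma,\theta}^2}{(1+\sigma\mu_y)^2}\frac{2\sigma^2(1+\theta)^2}{(1+\sigma\mu_y)^2}+G\frac{\sigma^2(1+\theta)^2L_{yx}^2}{(1+\sigma\mu_y)^2}\frac{3\tau^2\sigma^2(1+\theta)^2L_{xy}^2}{(1+\tau\mu_x)^2(1+\sigma\mu_y)^2}$; $B^y_{-1}=\frac{4\sigma\theta^2}{\rho(1+\rho)(1-\alpha\sigma)}+G\frac{C_{\sigma,\theta}^2}{(1+\sigma\mu_y)^2}\frac{2\sigma^2\theta^2\rho^{-1}}{(1+\sigma\mu_y)^2}+G\frac{\sigma^2(1+\theta)^2L_{yx}^2}{(1+\sigma\mu_y)^2}\frac{3\tau^2\sigma^2\theta^2\rho^{-1}L_{xy}^2}{(1+\tau\mu_x)^2(1+\sigma\mu_y)^2}$; $C^y=\frac{\sigma(1+2\theta)(1+\theta)}{1+\sigma\mu_y}+\frac{\tau\sigma(1+\theta)L_{xy}}{2(1+\tau\mu_x)(1+\sigma\mu_y)}$; $C^y_{-1}=\frac{\sigma\theta}{\rho(1+\sigma\mu_y)}\Big(1+2\theta+\frac{\tau((1+\theta)L_{yx}+L_{xy})}{2(1+\tau\mu_x)}+(1+\frac{3\theta}2)F\Big)$;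 $C^y_{-2}=\frac{\sigma\theta^2}{2\rho^2(1+\sigma\mu_y)}F$; $\mathcal{Q}_x=B^x+C^x+C^x_{-1}$, $\mathcal{Q}_y=B^y+B^y_{-1}+C^y+C^y_{-1}+C^y_{-2}$; $\gamma_x=\frac{2(1-\rho)}{\mu_x}+16\mathcal{Q}_x+4\|A_1\|^2$, $\gamma_y=\frac{4(1-\rho)}{\mu_y}+16\mathcal{Q}_y+4(\|A_2\|^2+\|A_3\|^2)$. Finally $\mathcal{C}_{\tau,\sigma,\theta}=4+\frac1{4(1-\rho)}\big(\mu_x\|A_1\|^2+\frac{\mu_y}2(\|A_2\|^2+\|A_3\|^2)\big)$ and $\Xi^{(1)}_{\tau,\sigma,\theta}=\big(\frac{16(1-\rho)}{\mu_x}+32\mathcal{Q}_x\big)\delta_x^2+\big(\frac{32(1-\rho)}{\mu_y}+32\mathcal{Q}_y\big)\delta_y^2$, $\Xi^{(2)}_{\tau,\sigma,\theta}=\frac{64}{1-\rho}(\mathcal{Q}_x\delta_x^2+\mathcal{Q}_y\delta_y^2)$, $\Xi^{(3)}_{\tau,\sigma,\theta}=\frac4{1-\rho}(\gamma_x\delta_x^2+\gamma_y\delta_y^2)$. *)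

(* Defs.v *)
From HB Require Import structures.
From mathcomp Require Import all_boot all_order all_algebra.
From mathcomp Require Import all_classical all_reals all_analysis.

Set Implicit Arguments.
Unset Strict Implicit.
Unset Printing Implicit Defensive.

Import Order.TTheory GRing.Theory Num.Theory.
Import numFieldNormedType.Exports.

Local Open Scope classical_set_scope.
Local Open Scope ring_scope.

Section Euclidean.
Context {R : realType}.

(* The library norm of a matrix is the maximum norm; it induces the same
   topology as the Euclidean norm. *)
Definition enorm k (v : 'rV[R]_k) : R := Num.sqrt (\sum_(i < k) v 0 i ^+ 2).

Definition grad k (h : 'rV[R]_k -> R) (a : 'rV[R]_k) : 'rV[R]_k :=
  \row_(i < k) derive (h : 'rV[R]_k -> R^o) a (delta_mx 0 i).

Definition psd k (M : 'M[R]_k) : Prop :=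
  M^T = M /\ forall v : 'rV[R]_k, 0 <= (v *m M *m v^T) 0 0.

Definition mx_of_rows k (s : seq (seq R)) : 'M[R]_k :=
  \matrix_(i < k, j < k) nth 0 (nth [::] s i) j.

Definition row_of k (s : seq R) : 'rV[R]_k := \row_(i < k) nth 0 s i.

Definition dom k (f : 'rV[R]_k -> \bar R) : set 'rV[R]_k :=
  [set x | (f x < +oo)%E].

Definition closed_fun k (f : 'rV[R]_k -> \bar R) : Prop :=
  closed [set z : 'rV[R]_k * R^o | (f z.1 <= (z.2 : R)%:E)%E].

Definition strongly_convex k (mu : R) (f : 'rV[R]_k -> \bar R) : Prop :=
  forall (a b : 'rV[R]_k) (t : R), 0 < t < 1 ->
    (f (t *: a + (1 - t) *: b)%R + (mu / 2 * (t * (1 - t)) * enorm (a - b) ^+ 2)%:E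
     <= t%:E * f a + (1 - t)%:E * f b)%E.

Definition argmin (T : Type) (h : T -> \bar R) : set T :=
  [set u | forall v, (h u <= h v)%E].

Definition prox k (phi : 'rV[R]_k -> \bar R) (x : 'rV[R]_k) : set 'rV[R]_k :=
  argmin (fun u => (phi u + (2^-1 * enorm (u - x) ^+ 2)%:E)%E).

(* In finite dimension, continuity of the differential is continuity of each
   directional derivative. *)
Definition C1_on (V : normedModType R) (U : set V) (F : V -> R^o) : Prop :=
  forall z, U z ->
    differentiable F z /\ forall v, {for z, continuous (fun z' => derive F z' v)}.

End Euclidean.

Section Probability.
Context d (Omega : measurableType d) {R : realType} (P : probability Omega R).

Definition sub_measurable (F : set (set Omega)) (Z : Omega -> R) : Prop :=
  forall B : set R, measurable B -> F (Z @^-1` B).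

(* Z is a version of E[X | F], for F a sub-sigma-algebra. *)
Definition is_cond_exp (F : set (set Omega)) (X Z : Omega -> R) : Prop :=
  [/\ P.-integrable setT (EFin \o X),
      P.-integrable setT (EFin \o Z),
      sub_measurable F Z
    & forall A, F A ->
        (\int[P]_(w in A) (Z w)%:E = \int[P]_(w in A) (X w)%:E)%E].

(* P[A | F] <= b almost surely; versions agree almost surely, so it does not
   matter which one is taken. *)
Definition cond_prob_le (F : set (set Omega)) (A : set Omega) (b : R) : Prop :=
  exists2 Z : Omega -> R,
    is_cond_exp F (\1_A) Z & {ae P, forall w, Z w <= b}.

(* Values in \bar R: the infimum may be -oo at p = 0 and +oo at p = 1. *)
Definition quantile (U : Omega -> R) (p : R) : \bar R :=
  ereal_inf [set t%:E | t in [set t : R | (p%:E <= P [set w | (U w <= t)%R])%E]].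

Definition CVaR (U : Omega -> R) (p : R) : \bar R :=
  (((1 - p)^-1)%:E * \int[lebesgue_measure]_(q in `[p, 1%R]) quantile U q)%E.

Definition EVaR (U : Omega -> R) (p : R) : \bar R :=
  ereal_inf [set ((- (eta^-1 * ln (1 - p)))%:E
                  + (eta^-1)%:E * lne (mmt_gen_fun P U eta))%E
            | eta in [set eta : R | 0 < eta]].

Definition chi2_div (Q : probability Omega R) : \bar R :=
  (\int[P]_w ((2^-1)%:E *
     (Radon_Nikodym (charge_of_finite_measure Q) P w - 1) ^+ 2))%E.

Definition chi2_risk (U : Omega -> R) (r : R) : \bar R :=
  ereal_sup [set expectation Q U
            | Q in [set Q : probability Omega R |
                     Q `<< P /\ (chi2_div Q <= r%:E)%E]].

End Probability.

Record params (R : realType) := Params {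
  p_tau : R; p_sigma : R; p_theta : R; p_rho : R; p_alpha : R;
  p_mux : R; p_muy : R;
  p_Lxx : R; p_Lxy : R; p_Lyx : R; p_Lyy : R;
  p_deltax : R; p_deltay : R
}.

Section Constants.
Context {R : realType} (c : params R).

Local Notation tau := (p_tau c).
Local Notation sigma := (p_sigma c).
Local Notation theta := (p_theta c).
Local Notation rho := (p_rho c).
Local Notation alpha := (p_alpha c).
Local Notation mux := (p_mux c).
Local Notation muy := (p_muy c).
Local Notation Lxx := (p_Lxx c).
Local Notation Lxy := (p_Lxy c).
Local Notation Lyx := (p_Lyx c).
Local Notation Lyy := (p_Lyy c).
Local Notation deltax := (p_deltax c).
Local Notation deltay := (p_deltay c).

Definition MI_matrix : 'M[R]_5 :=
  let a := theta / rho - 1 in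
  let b := theta / rho in
  mx_of_rows 5
  [:: [:: tau^-1 + mux - (rho * tau)^-1; 0; 0; 0; 0];
      [:: 0; sigma^-1 + muy - (rho * sigma)^-1; a * Lyx; a * Lyy; 0];
      [:: 0; a * Lyx; tau^-1 - Lxx; 0; - b * Lyx];
      [:: 0; a * Lyy; 0; sigma^-1 - alpha; - b * Lyy];
      [:: 0; 0; - b * Lyx; - b * Lyy; alpha / rho]].

Definition MI : Prop := psd MI_matrix.

Local Notation dx := (1 + tau * mux).
Local Notation dy := (1 + sigma * muy).

Definition C_st : R := 1 + sigma * (1 + theta) * Lyy.
Definition s_x : R := Num.sqrt (2 * rho * tau).
Definition s_y : R := Num.sqrt (2 * rho * sigma / (1 - alpha * sigma)).

(* The vectors are written as rows, so that S v becomes v *m S. *)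
Definition S_mx : 'M[R]_4 := diag_mx (row_of 4 [:: s_x; s_y; s_x; s_y]).

Definition A0 : 'rV[R]_4 :=
  dy^-1 *: row_of 4
    [:: s_x * sigma * (1 + theta) * Lyx;
        s_y * C_st;
        s_x * sigma * theta * Lyx;
        s_y * sigma * theta * Lyy].

Definition hatA1 : 'rV[R]_4 := row_of 4
  [:: 1 + tau * Lxx + tau * sigma * (1 + theta) * Lyx * Lxy / dy;
      tau * Lxy * C_st / dy;
      sigma * tau * theta * Lxy * Lyx / dy;
      sigma * tau * theta * Lxy * Lyy / dy].

Definition hatA2 : 'rV[R]_4 := row_of 4
  [:: sigma * (1 + theta) * Lyx;
      C_st;
      sigma * theta * Lyx;
      sigma * theta * Lyy].

Definition hatA3 : 'rV[R]_4 := row_of 4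
  [:: C_st * sigma * (1 + theta) * dx * Lyx
      + sigma * (1 + theta) * Lyx
        * ((1 + tau * Lxx) * dy + tau * sigma * (1 + theta) * Lyx * Lxy)
      + sigma * theta * Lyx * dx * dy;
      dx * C_st ^+ 2
      + sigma * (1 + theta) * Lyx * tau * Lxy * C_st
      + sigma * theta * Lyy * dx * dy;
      sigma * (C_st * theta * Lyx * dx
               + (1 + theta) * tau * sigma * theta * Lxy * Lyx ^+ 2);
      sigma * (C_st * theta * Lyy * dx
               + (1 + theta) * tau * sigma * theta * Lxy * Lyx * Lyy)].

Definition A1 : 'rV[R]_4 :=
  (Num.sqrt ((1 + rho) / rho) * (4 / dx)) *: (hatA1 *m S_mx).

Definition A2 : 'rV[R]_4 :=
  (Num.sqrt ((1 + rho) / rho) * (4 * Num.sqrt 2 * (1 + theta) / dy))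
    *: (hatA2 *m S_mx).

Definition A3 : 'rV[R]_4 :=
  (Num.sqrt ((1 + rho) / rho)
    * (4 * Num.sqrt 2 * theta * rho^-1 / (dy ^+ 2 * dx)))
    *: (hatA3 *m S_mx).

Definition F_cst : R :=
  C_st / dy + tau * sigma * (1 + theta) * Lyx * Lxy / (dx * dy).

Definition G_cst : R := rho / (4 * enorm A0 ^+ 2 * (1 + rho)).

Definition B_x : R :=
  4 * tau / (1 + rho)
  + G_cst * (sigma ^+ 2 * (1 + theta) ^+ 2 * Lyx ^+ 2 / dy ^+ 2)
    * (3 * tau ^+ 2 / dx ^+ 2).

Definition C_x : R :=
  tau / dx + tau * sigma * (1 + 2 * theta) * Lxy / (2 * dx * dy).

Definition C_x1 : R :=
  tau * sigma * theta * (1 + theta) * Lyx / (2 * rho * dy * dx).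

Definition B_y : R :=
  4 * (1 + theta) ^+ 2 * sigma / ((1 + rho) * (1 - alpha * sigma))
  + 3 * enorm A0 ^+ 2 * (1 + rho) * theta ^+ 2 / rho ^+ 3
  + G_cst * (C_st ^+ 2 / dy ^+ 2)
    * (2 * sigma ^+ 2 * (1 + theta) ^+ 2 / dy ^+ 2)
  + G_cst * (sigma ^+ 2 * (1 + theta) ^+ 2 * Lyx ^+ 2 / dy ^+ 2)
    * (3 * tau ^+ 2 * sigma ^+ 2 * (1 + theta) ^+ 2 * Lxy ^+ 2
       / (dx ^+ 2 * dy ^+ 2)).

Definition B_y1 : R :=
  4 * sigma * theta ^+ 2 / (rho * (1 + rho) * (1 - alpha * sigma))
  + G_cst * (C_st ^+ 2 / dy ^+ 2)
    * (2 * sigma ^+ 2 * theta ^+ 2 * rho^-1 / dy ^+ 2)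
  + G_cst * (sigma ^+ 2 * (1 + theta) ^+ 2 * Lyx ^+ 2 / dy ^+ 2)
    * (3 * tau ^+ 2 * sigma ^+ 2 * theta ^+ 2 * rho^-1 * Lxy ^+ 2
       / (dx ^+ 2 * dy ^+ 2)).

Definition C_y : R :=
  sigma * (1 + 2 * theta) * (1 + theta) / dy
  + tau * sigma * (1 + theta) * Lxy / (2 * dx * dy).

Definition C_y1 : R :=
  sigma * theta / (rho * dy)
  * (1 + 2 * theta + tau * ((1 + theta) * Lyx + Lxy) / (2 * dx)
     + (1 + 3 * theta / 2) * F_cst).

Definition C_y2 : R := sigma * theta ^+ 2 / (2 * rho ^+ 2 * dy) * F_cst.

Definition Q_x : R := B_x + C_x + C_x1.
Definition Q_y : R := B_y + B_y1 + C_y + C_y1 + C_y2.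

Definition gamma_x : R :=
  2 * (1 - rho) / mux + 16 * Q_x + 4 * enorm A1 ^+ 2.
Definition gamma_y : R :=
  4 * (1 - rho) / muy + 16 * Q_y + 4 * (enorm A2 ^+ 2 + enorm A3 ^+ 2).

Definition C_tst : R :=
  4 + (4 * (1 - rho))^-1
      * (mux * enorm A1 ^+ 2 + muy / 2 * (enorm A2 ^+ 2 + enorm A3 ^+ 2)).

Definition Xi1 : R :=
  (16 * (1 - rho) / mux + 32 * Q_x) * deltax ^+ 2
  + (32 * (1 - rho) / muy + 32 * Q_y) * deltay ^+ 2.

Definition Xi2 : R :=
  64 / (1 - rho) * (Q_x * deltax ^+ 2 + Q_y * deltay ^+ 2).

Definition Xi3 : R :=
  4 / (1 - rho) * (gamma_x * deltax ^+ 2 + gamma_y * deltay ^+ 2).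

(* D0 stands for the initial distance D_{tau,sigma}. *)
Definition bias_term (D0 : R) (n : nat) : R :=
  Num.sqrt (((1 + rho) / 2) `^ (n%:R / 2) * (C_tst * D0 + Xi1) + Xi2).

Definition CVaR_bound (D0 : R) (n : nat) (p : R) : R :=
  bias_term D0 n + Num.sqrt (Xi3 * (1 + ln (1 / (1 - p)))).

Definition EVaR_bound (D0 : R) (n : nat) (p : R) : R :=
  bias_term D0 n + Num.sqrt Xi3 * (Num.sqrt (ln (1 / (1 - p))) + Num.sqrt pi).

End Constants.

Section Problem.
Context {R : realType} {m n : nat} (c : params R).
Context (f : 'rV[R]_m -> \bar R) (g : 'rV[R]_n -> \bar R).
Context (Phi : 'rV[R]_m -> 'rV[R]_n -> R).

Local Notation tau := (p_tau c).
Local Notation sigma := (p_sigma c).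

Definition grad_x (x : 'rV[R]_m) (y : 'rV[R]_n) : 'rV[R]_m :=
  grad (fun u => Phi u y) x.
Definition grad_y (x : 'rV[R]_m) (y : 'rV[R]_n) : 'rV[R]_n :=
  grad (fun v => Phi x v) y.

Record problem_assumption : Prop := {
  pa_mux : 0 < p_mux c;
  pa_muy : 0 < p_muy c;
  pa_f_ninfty : forall x, f x != -oo%E;
  pa_g_ninfty : forall y, g y != -oo%E;
  pa_f_closed : closed_fun f;
  pa_g_closed : closed_fun g;
  pa_f_sconvex : strongly_convex (p_mux c) f;
  pa_g_sconvex : strongly_convex (p_muy c) g;
  pa_Phi_C1 : exists U : set ('rV[R]_m * 'rV[R]_n),
    [/\ open U, dom f `*` dom g `<=` U & C1_on U (fun z => Phi z.1 z.2)];
  pa_Phi_convex : forall y, dom g y ->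
    convex_function (dom f) (fun x => Phi x y);
  pa_Phi_concave : forall x, dom f x ->
    convex_function (dom g) (fun y => - Phi x y);
  pa_Lxx : 0 <= p_Lxx c;
  pa_Lyy : 0 <= p_Lyy c;
  pa_Lxy : 0 < p_Lxy c;
  pa_Lyx : 0 < p_Lyx c;
  pa_lip_x : forall x y x' y', dom f x -> dom g y -> dom f x' -> dom g y' ->
    enorm (grad_x x y - grad_x x' y')
      <= p_Lxx c * enorm (x - x') + p_Lxy c * enorm (y - y');
  pa_lip_y : forall x y x' y', dom f x -> dom g y -> dom f x' -> dom g y' ->
    enorm (grad_y x y - grad_y x' y')
      <= p_Lyx c * enorm (x - x') + p_Lyy c * enorm (y - y')
}.

Definition lagrangian (x : 'rV[R]_m) (y : 'rV[R]_n) : \bar R :=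
  (f x + (Phi x y)%:E - g y)%E.

(* When dom f and dom g are nonempty this forces xs \in dom f and
   ys \in dom g, whatever value +oo - +oo is given. *)
Definition saddle_point (xs : 'rV[R]_m) (ys : 'rV[R]_n) : Prop :=
  forall x y, (lagrangian xs y <= lagrangian xs ys)%E /\
              (lagrangian xs ys <= lagrangian x ys)%E.

Definition D_init (xs : 'rV[R]_m) (ys : 'rV[R]_n) x0 y0 : R :=
  (2 * tau)^-1 * enorm (x0 - xs) ^+ 2 + (2 * sigma)^-1 * enorm (y0 - ys) ^+ 2.

Section Algorithm.
Context (d dx dy : measure_display) (Omega : measurableType d).
Context (Sx : measurableType dx) (Sy : measurableType dy).
Context (P : probability Omega R).
Context (wx : nat -> Omega -> Sx) (wy : nat -> Omega -> Sy).
Context (ox : 'rV[R]_m -> 'rV[R]_n -> Sx -> 'rV[R]_m).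
Context (oy : 'rV[R]_m -> 'rV[R]_n -> Sy -> 'rV[R]_n).
Context (x : nat -> Omega -> 'rV[R]_m) (y : nat -> Omega -> 'rV[R]_n).

Definition Gy (k : nat) (w : Omega) : 'rV[R]_n := oy (x k w) (y k w) (wy k w).
Definition Gx (k : nat) (w : Omega) : 'rV[R]_m :=
  ox (x k w) (y k.+1 w) (wx k w).

Definition q_til (k : nat) (w : Omega) : 'rV[R]_n :=
  if k is j.+1 then Gy j.+1 w - Gy j w else 0.

Definition s_til (k : nat) (w : Omega) : 'rV[R]_n :=
  Gy k w + p_theta c *: q_til k w.

Record SAPD (x0 : 'rV[R]_m) (y0 : 'rV[R]_n) : Prop := {
  sapd_x0 : forall w, x 0 w = x0;
  sapd_y0 : forall w, y 0 w = y0;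
  sapd_y : forall k w,
    prox (fun v => (sigma%:E * g v)%E) (y k w + sigma *: s_til k w) (y k.+1 w);
  sapd_x : forall k w,
    prox (fun u => (tau%:E * f u)%E) (x k w - tau *: Gx k w) (x k.+1 w)
}.

(* The sigma-algebra generated by the first b of the wy and the first a of the
   wx.  Thus F_k^y = history k.+1 k, F_k^x = history k.+1 k.+1 and
   F_{k-1}^x = history k k, which is trivial for k = 0. *)
Definition history (b a : nat) : set (set Omega) :=
  <<s [set A | (exists2 j, (j < b)%N &
                  exists2 B : set Sy, measurable B & A = wy j @^-1` B) \/
               (exists2 j, (j < a)%N &
                  exists2 B : set Sx, measurable B & A = wx j @^-1` B)] >>.

Definition Delta_y (k : nat) (w : Omega) : 'rV[R]_n :=
  Gy k w - grad_y (x k w) (y k w).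
Definition Delta_x (k : nat) (w : Omega) : 'rV[R]_m :=
  Gx k w - grad_x (x k w) (y k.+1 w).

(* na_Gy_adapted and na_Gx_adapted are the only measurability required of
   the oracles; they hold as soon as ox and oy are jointly Borel. *)
Record noise_assumption : Prop := {
  na_wx : forall k, measurable_fun setT (wx k);
  na_wy : forall k, measurable_fun setT (wy k);
  na_Gy_adapted : forall k i,
    sub_measurable (history k.+1 k) (fun w => Gy k w 0 i);
  na_Gx_adapted : forall k i,
    sub_measurable (history k.+1 k.+1) (fun w => Gx k w 0 i);
  na_deltax : 0 < p_deltax c;
  na_deltay : 0 < p_deltay c;
  na_mean_y : forall k i,
    is_cond_exp P (history k k) (fun w => Delta_y k w 0 i) (cst 0);
  na_mean_x : forall k i,
    is_cond_exp P (history k.+1 k) (fun w => Delta_x k w 0 i) (cst 0);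
  na_tail_y : forall k t, 0 <= t ->
    cond_prob_le P (history k k) [set w | t <= enorm (Delta_y k w)]
      (2 * expR (- (t ^+ 2 / (2 * p_deltay c ^+ 2))));
  na_tail_x : forall k t, 0 <= t ->
    cond_prob_le P (history k.+1 k) [set w | t <= enorm (Delta_x k w)]
      (2 * expR (- (t ^+ 2 / (2 * p_deltax c ^+ 2))))
}.

Definition D_dist (xs : 'rV[R]_m) (ys : 'rV[R]_n) (k : nat) (w : Omega) : R :=
  (2 * tau)^-1 * enorm (x k w - xs) ^+ 2
  + (1 - p_alpha c * sigma) / (2 * sigma) * enorm (y k w - ys) ^+ 2.

End Algorithm.
End Problem.

(* Main.v *)
Require Import Defs.
From HB Require Import structures.
From mathcomp Require Import all_boot all_order all_algebra.
From mathcomp Require Import all_classical all_reals all_analysis.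
From mathcomp Require Import measurable_realfun.
From mathcomp Require Import ring lra.

Set Implicit Arguments.
Unset Strict Implicit.
Unset Printing Implicit Defensive.

Import Order.TTheory GRing.Theory Num.Theory.
Import numFieldNormedType.Exports.

Local Open Scope classical_set_scope.
Local Open Scope ring_scope.

(** The proof shows that the squared distance to the saddle point, divided by
    [Xi3], has an exponential moment of the right size, and then reads every
    risk measure off that single bound.

    Deterministic part.  Strong convexity of the two proximal problems, the
    descent inequality for [Phi] and the saddle inequalities add up to
    [one_step].  The matrix inequality then says ([MI_potential]) that the
    potential made of the two squared distances, the momentum term
    [theta * dot q (y - ys + z)] and [- alpha / 2 * enorm z ^+ 2] is multiplied
    by at most [rho] in one step, up to noise.  The vector [z] is free: the next
    step needs [z] equal to the coming displacement of [y], while [z = ys - y]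
    turns the potential into [D_dist].

    Noise terms.  The noise is paired with the points [x k.+1] and [y k.+1],
    which depend on it.  Replacing them by the points [xh], [yh] and [yhh] that
    would be reached without the newest noise makes the inner products
    conditionally centred; as the proximal maps contract, the replacement costs
    only squares of noise norms ([noise_le]), which the constants [C_x], ...,
    [C_y2] account for.  Because of the momentum, the noise at time [k] is also
    paired with a point that is a function of the past at time [k] but enters
    the recursion one step later; this term is carried along as [pending].  The
    outcome is an explicit process [Wr] above [D_dist] ([D_le_W]).

    Probabilistic part.  Conditional mean zero and the Gaussian tail bound give
    a bound on the conditional moment generating function of a linear plus a
    small quadratic function of the noise ([cond_mgf]).  The noise is integrated
    out from the last step to the first ([mgf_backward]).  A linear noise term
    costs a multiple of [D k + D k.-1]; since the exponent is divided by [Xi3],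
    this cost only worsens the rate from [rho] to [(1 + rho) / 2].

    Risk measures.  Let [E exp (D / s) <= exp (b / s)].  For every [c > 0] the
    root of [D] is at most [D / (2 * c) + c / 2], so a bound on a risk functional
    of [D] that is linear in [D] gives, after optimising [c], a bound
    [sqrt (b + s * l)] for the root.  Here [l] is [1 + ln (1 / (1 - p))] for the
    conditional value at risk ([CVaR_sqrt_le]), [ln (1 / (1 - p))] for the
    entropic one ([EVaR_sqrt_le]) and [ln (1 + 2 * r)] for the chi-square ball
    ([chi2_risk_sqrt_le]); the last one is at most [ln (1 + r) + pi]. *)

(** * Euclidean geometry of row vectors *)

Lemma le_of_eq d (T : porderType d) (x y : T) : x = y -> (x <= y)%O.
Proof. by move=> ->. Qed.

Section Geometry.
Context {R : realType} {k : nat}.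
Implicit Types u v w : 'rV[R]_k.

Definition dot u v : R := \sum_(i < k) u 0 i * v 0 i.

Lemma dotC u v : dot u v = dot v u.
Proof. by apply: eq_bigr => i _; rewrite mulrC. Qed.

Lemma dotDl u v w : dot (u + v) w = dot u w + dot v w.
Proof. by rewrite /dot -big_split; apply: eq_bigr => i _; rewrite mxE mulrDl. Qed.

Lemma dotZl a u v : dot (a *: u) v = a * dot u v.
Proof. by rewrite /dot mulr_sumr; apply: eq_bigr => i _; rewrite mxE mulrA. Qed.

Lemma dotNl u v : dot (- u) v = - dot u v.
Proof. by rewrite -scaleN1r dotZl mulN1r. Qed.

Lemma dotBl u v w : dot (u - v) w = dot u w - dot v w.
Proof. by rewrite dotDl dotNl. Qed.

Lemma dotDr u v w : dot w (u + v) = dot w u + dot w v.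
Proof. by rewrite dotC dotDl !(dotC w). Qed.

Lemma dotZr a u v : dot u (a *: v) = a * dot u v.
Proof. by rewrite dotC dotZl dotC. Qed.

Lemma dotNr u v : dot u (- v) = - dot u v.
Proof. by rewrite dotC dotNl dotC. Qed.

Lemma dotBr u v w : dot w (u - v) = dot w u - dot w v.
Proof. by rewrite dotDr dotNr. Qed.

Lemma dot0l u : dot 0 u = 0.
Proof. by rewrite -(scale0r 0) dotZl mul0r. Qed.

Definition dotE := (dotDl, dotDr, dotBl, dotBr, dotNl, dotNr, dotZl, dotZr).

Lemma enorm_ge0 u : 0 <= enorm u.
Proof. exact: sqrtr_ge0. Qed.

Lemma enorm_sqr u : enorm u ^+ 2 = dot u u.
Proof.
rewrite /enorm sqr_sqrtr; first by apply: eq_bigr => i _; rewrite expr2.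
by apply: sumr_ge0 => i _; exact: sqr_ge0.
Qed.

Lemma enormZ a u : enorm (a *: u) = `|a| * enorm u.
Proof.
apply/eqP; rewrite -(eqrXn2 (n := 2))// ?mulr_ge0 ?enorm_ge0//.
by rewrite exprMn !enorm_sqr dotZl dotZr real_normK ?num_real// mulrA expr2.
Qed.

Lemma enormN u : enorm (- u) = enorm u.
Proof. by rewrite -scaleN1r enormZ normrN1 mul1r. Qed.

Lemma enormC u v : enorm (u - v) = enorm (v - u).
Proof. by rewrite -enormN opprB. Qed.

Lemma enorm_coord u i : `|u 0 i| <= enorm u.
Proof.
rewrite -(ler_pXn2r (n := 2)) ?nnegrE ?enorm_ge0//.
rewrite enorm_sqr real_normK ?num_real// /dot (bigD1 i)//= -expr2 lerDl.
by apply: sumr_ge0 => j _; rewrite -expr2 sqr_ge0.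
Qed.

Lemma enorm0_eq0 u : enorm u = 0 -> u = 0.
Proof.
move=> u0; apply/rowP => i; rewrite mxE; apply/eqP.
by rewrite -normr_le0 -u0 enorm_coord.
Qed.

Lemma enorm0 : enorm (0 : 'rV[R]_k) = 0.
Proof. by rewrite -(scale0r 0) enormZ normr0 mul0r. Qed.

Lemma dot_le_enorm u v : dot u v <= enorm u * enorm v.
Proof.
have [u0|u0] := eqVneq (enorm u) 0.
  by rewrite (enorm0_eq0 u0) dot0l enorm0 mul0r.
have [v0|v0] := eqVneq (enorm v) 0.
  by rewrite (enorm0_eq0 v0) dotC dot0l enorm0 mulr0.
have uv : 0 < enorm u * enorm v.
  by rewrite mulr_gt0// lt_neqAle eq_sym ?u0 ?v0 enorm_ge0.
have := sqr_ge0 (enorm (enorm v *: u - enorm u *: v)).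
rewrite enorm_sqr !dotE (dotC v u) -!enorm_sqr.
move=> h; have : 0 <= (2 * (enorm u * enorm v)) * (enorm u * enorm v - dot u v).
  by apply: (le_trans h); apply: le_of_eq; ring.
by rewrite pmulr_rge0 ?subr_ge0// mulr_gt0.
Qed.

Lemma normr_dot_le u v : `|dot u v| <= enorm u * enorm v.
Proof.
by rewrite ler_norml dot_le_enorm andbT lerNl -dotNl -(enormN u) dot_le_enorm.
Qed.

Lemma enormD u v : enorm (u + v) <= enorm u + enorm v.
Proof.
rewrite -(ler_pXn2r (n := 2)) ?nnegrE ?addr_ge0 ?enorm_ge0//.
rewrite sqrrD !enorm_sqr !dotE (dotC v u).
by have := dot_le_enorm u v; lra.
Qed.

Lemma enormB u v : enorm (u - v) <= enorm u + enorm v.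
Proof. by rewrite -(enormN v) enormD. Qed.

Lemma enorm_triangle w u v : enorm (u - v) <= enorm (u - w) + enorm (w - v).
Proof. by apply: le_trans (enormD _ _); rewrite addrA subrK. Qed.

Lemma enorm_le_sum u : enorm u <= \sum_(i < k) `|u 0 i|.
Proof.
rewrite -(ler_pXn2r (n := 2)) ?nnegrE ?enorm_ge0 ?sumr_ge0//.
rewrite enorm_sqr expr2 /dot mulr_suml; apply: ler_sum => i _.
rewrite (le_trans (ler_norm _))// normrM ler_wpM2l//.
by rewrite (bigD1 i)//= lerDl sumr_ge0.
Qed.

End Geometry.

(** * Functions measurable for a generated sigma-algebra *)

Section SubSigma.
Context d (Omega : measurableType d) {R : realType}.
Variable G : set (set Omega).

(** Closure properties of measurable functions become available for [sub_measurable]. *)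
Lemma sub_measurableP (xi : Omega -> R) :
  sub_measurable <<s G >> xi <->
  measurable_fun setT (xi : g_sigma_algebraType G -> R).
Proof.
split => [h _ B mB|h B mB].
  by rewrite setTI; exact: h.
by rewrite -[X in <<s G >> X]setTI; exact: (h measurableT).
Qed.

Lemma sub_measurable_cst (a : R) : sub_measurable <<s G >> (fun _ => a).
Proof. by apply/sub_measurableP. Qed.

Lemma sub_measurable_comp (h : R -> R) (u : Omega -> R) :
  measurable_fun setT h -> sub_measurable <<s G >> u ->
  sub_measurable <<s G >> (fun w => h (u w)).
Proof.
move=> mh /sub_measurableP mu; apply/sub_measurableP.
exact: (measurableT_comp mh mu).
Qed.

Lemma sub_measurableD (u v : Omega -> R) : sub_measurable <<s G >> u ->
  sub_measurable <<s G >> v -> sub_measurable <<s G >> (fun w => u w + v w).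
Proof.
move=> /sub_measurableP mu /sub_measurableP mv; apply/sub_measurableP.
exact: (measurable_funD mu mv).
Qed.

Lemma sub_measurableM (u v : Omega -> R) : sub_measurable <<s G >> u ->
  sub_measurable <<s G >> v -> sub_measurable <<s G >> (fun w => u w * v w).
Proof.
move=> /sub_measurableP mu /sub_measurableP mv; apply/sub_measurableP.
exact: (measurable_funM mu mv).
Qed.

Lemma sub_measurableZ (a : R) (u : Omega -> R) : sub_measurable <<s G >> u ->
  sub_measurable <<s G >> (fun w => a * u w).
Proof. by move=> mu; apply: sub_measurableM => //; exact: sub_measurable_cst. Qed.

Lemma sub_measurableN (u : Omega -> R) : sub_measurable <<s G >> u ->
  sub_measurable <<s G >> (fun w => - u w).
Proof.
move=> mu; rewrite (_ : (fun w => _) = fun w => -1 * u w).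
  exact: sub_measurableZ.
by apply/funext => w; rewrite mulN1r.
Qed.

Lemma sub_measurableB (u v : Omega -> R) : sub_measurable <<s G >> u ->
  sub_measurable <<s G >> v -> sub_measurable <<s G >> (fun w => u w - v w).
Proof. by move=> mu mv; apply: sub_measurableD => //; exact: sub_measurableN. Qed.

Lemma sub_measurable_expR (u : Omega -> R) : sub_measurable <<s G >> u ->
  sub_measurable <<s G >> (fun w => expR (u w)).
Proof. by apply: sub_measurable_comp; exact: measurable_expR. Qed.

Lemma sub_measurable_sum I (r : seq I) (u : I -> Omega -> R) :
  (forall i, sub_measurable <<s G >> (u i)) ->
  sub_measurable <<s G >> (fun w => \sum_(i <- r) u i w).
Proof.
move=> mu; elim: r => [|i r IH].
  rewrite (_ : (fun w => _) = fun _ => 0); first exact: sub_measurable_cst.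
  by apply/funext => w; rewrite big_nil.
rewrite (_ : (fun w => _) = fun w => u i w + \sum_(i <- r) u i w).
  exact: sub_measurableD.
by apply/funext => w; rewrite big_cons.
Qed.

Lemma sub_measurable_indic A : <<s G >> A ->
  sub_measurable <<s G >> (\1_A : Omega -> R).
Proof.
move=> FA; apply/sub_measurableP.
exact: (@measurable_indic _ (g_sigma_algebraType G)).
Qed.

Lemma sub_measurable_le (u : Omega -> R) (a : R) : sub_measurable <<s G >> u ->
  <<s G >> [set w | u w <= a].
Proof.
move=> mu; rewrite (_ : [set w | _] = u @^-1` `]-oo, a]); first exact: mu.
by apply/seteqP; split => w /=; rewrite in_itv.
Qed.

Lemma sub_sigmaI A B : <<s G >> A -> <<s G >> B -> <<s G >> (A `&` B).
Proof. exact: (@measurableI _ (g_sigma_algebraType G)). Qed.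

Hypothesis GM : G `<=` @measurable _ Omega.

Lemma sub_measurable_set A : <<s G >> A -> measurable A.
Proof. exact: (smallest_sub (@sigma_algebra_measurable _ Omega) GM). Qed.

Lemma sub_measurable_fun (xi : Omega -> R) :
  sub_measurable <<s G >> xi -> measurable_fun setT xi.
Proof.
by move=> h _ B mB; rewrite setTI; apply: sub_measurable_set; exact: h.
Qed.

Import HBNNSimple.

(** The inequality passes from indicators to simple weights by linearity, and to
    general weights by monotone convergence.  This is how conditional means and
    probabilities, known through sets only, reach the weights used below. *)
Lemma le_integral_weight (mu : {measure set Omega -> \bar R})
    (Y1 Y2 xi : Omega -> R) :
  measurable_fun setT Y1 -> measurable_fun setT Y2 ->
  (forall w, 0 <= Y1 w) -> (forall w, 0 <= Y2 w) ->
  (forall A, <<s G >> A ->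
     (\int[mu]_(w in A) (Y1 w)%:E <= \int[mu]_(w in A) (Y2 w)%:E)%E) ->
  sub_measurable <<s G >> xi -> (forall w, 0 <= xi w) ->
  (\int[mu]_w (xi w * Y1 w)%:E <= \int[mu]_w (xi w * Y2 w)%:E)%E.
Proof.
move=> mY1 mY2 Y10 Y20 le12 mxi xi0.
have mxi' : measurable_fun setT (EFin \o xi : g_sigma_algebraType G -> \bar R).
  by apply/measurable_EFinP; apply: (proj1 (sub_measurableP _)).
pose h := nnsfun_approx measurableT mxi'.
have nd_h n m w : (n <= m)%N -> h n w <= h m w.
  by move=> nm; have /lefP := @nd_nnsfun_approx _ _ _ _ measurableT _ mxi' n m nm; exact.
have mh n : measurable_fun setT (h n : Omega -> R).
  by apply: sub_measurable_fun; apply/sub_measurableP; exact: measurable_funP.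
have simple n (Y : Omega -> R) : measurable_fun setT Y -> (forall w, 0 <= Y w) ->
    (\int[mu]_w (h n w * Y w)%:E
     = \sum_(r \in range (h n)) r%:E
         * \int[mu]_(w in h n @^-1` [set r]) (Y w)%:E)%E.
  move=> mY Y0.
  have ms r : <<s G >> (h n @^-1` [set r] : set Omega).
    by apply: (measurable_sfunP (h n)).
  transitivity (\int[mu]_w (\sum_(r \in range (h n))
      (r * (\1_(h n @^-1` [set r] : set Omega) w * Y w))%:E))%E.
    apply: eq_integral => w _; rewrite [in LHS](fimfunE (h n) w).
    rewrite fsbig_finite//= [in RHS]fsbig_finite//= mulr_suml sumEFin.
    by congr (_%:E); apply: eq_bigr => r _; rewrite mulrA.
  rewrite (_ : (fun w => _) = (fun w => \sum_(r \in range (h n))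
      (`|r| * (\1_(h n @^-1` [set r] : set Omega) w * Y w))%:E)%E); last first.
    apply/funext => w; apply: eq_fsbigr => r; rewrite inE => -[w' _ <-].
    by rewrite ger0_norm.
  rewrite ge0_integral_fsum//.
  - apply: eq_fsbigr => r; rewrite inE => -[w' _ <-].
    rewrite ger0_norm//.
    under eq_integral do rewrite EFinM.
    rewrite ge0_integralZl_EFin//; last 2 first.
    + by move=> w _; rewrite lee_fin mulr_ge0.
    + apply/measurable_EFinP; apply: measurable_funM => //.
      by apply: measurable_indic; exact: sub_measurable_set.
    rewrite [in RHS]integral_mkcond; congr (_ * _)%E; apply: eq_integral => w _.
    rewrite indicE patchE; case: ifP => wi; last by rewrite mul0r.
    by rewrite mul1r.
  - move=> r; apply/measurable_EFinP; apply: measurable_funM => //.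
    apply: measurable_funM => //.
    by apply: measurable_indic; exact: sub_measurable_set.
  - by move=> r w _; rewrite lee_fin !mulr_ge0.
have limE (Y : Omega -> R) : measurable_fun setT Y -> (forall w, 0 <= Y w) ->
    (\int[mu]_w (xi w * Y w)%:E
      = limn (fun n => \int[mu]_w (h n w * Y w)%:E))%E.
  move=> mY Y0; rewrite -monotone_convergence//.
  - apply: eq_integral => w _; apply/esym/cvg_lim => //.
    apply: cvg_EFin; first exact: nearW.
    apply: cvgMl.
    by have /fine_cvgP[_ +] := @cvg_nnsfun_approx _ _ _ _ measurableT _ mxi'
      (fun w _ => xi0 w) w I; exact.
  - by move=> n; apply/measurable_EFinP; apply: measurable_funM.
  - by move=> n w _; rewrite lee_fin mulr_ge0.
  - move=> w _ n m nm; rewrite lee_fin ler_wpM2r//.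
    exact: nd_h.
rewrite (limE Y1)// (limE Y2)//; apply: lee_lim.
- apply: ereal_nondecreasing_is_cvgn => n m nm; apply: ge0_le_integral => //.
  + by move=> w _; rewrite lee_fin mulr_ge0.
  + by apply/measurable_EFinP; apply: measurable_funM.
  + by apply/measurable_EFinP; apply: measurable_funM.
  + by move=> w _; rewrite lee_fin ler_wpM2r//; exact: nd_h.
- apply: ereal_nondecreasing_is_cvgn => n m nm; apply: ge0_le_integral => //.
  + by move=> w _; rewrite lee_fin mulr_ge0.
  + by apply/measurable_EFinP; apply: measurable_funM.
  + by apply/measurable_EFinP; apply: measurable_funM.
  + by move=> w _; rewrite lee_fin ler_wpM2r//; exact: nd_h.
apply: nearW => n; rewrite !simple//.
rewrite !fsbig_finite//=; apply: lee_sum => r _.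
have [r0|r0] := leP 0 r; first last.
  rewrite (_ : h n @^-1` [set r] = set0) ?integral_set0 ?mule0//.
  apply/seteqP; split => w //= hr; move: r0; rewrite -hr ltNge.
  by have -> : 0 <= h n w by [].
rewrite lee_wpmul2l ?lee_fin//; apply: le12.
exact: (measurable_sfunP (h n)).
Qed.

End SubSigma.

(** * Conditional sub-Gaussian tails *)

Section Dyadic.
Context d (T : measurableType d) {R : realType} (mu : {measure set T -> \bar R}).

(** A nonnegative number is at most 2 plus the sum of the powers [2 ^+ j], with
    [j > 0], that it reaches, and their tail bounds decrease like [4^-1 ^+ j]. *)
Lemma integral_dyadic_le (A : set T) (Y : T -> R) (a : R) :
  measurable A -> mu A = a%:E -> measurable_fun setT Y ->
  (forall w, 0 <= Y w) ->
  (forall j, (mu (A `&` [set w | (2 ^+ j.+1 <= Y w)%R])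
      <= (2 * 4^-1 ^+ j.+1 * a)%:E)%E) ->
  (\int[mu]_(w in A) (Y w)%:E <= (4 * a)%:E)%E.
Proof.
move=> mA muA mY Y0 tail.
have mtail j : measurable [set w | (2 ^+ j.+1 <= Y w)%R].
  rewrite -[X in measurable X]setTI (_ : [set w | _] = Y @^-1` `[2 ^+ j.+1, +oo[).
    exact: mY.
  by apply/seteqP; split => w /=; rewrite in_itv/= andbT.
pose u (j : nat) w : \bar R := (2 ^+ j.+1 * \1_[set w | (2 ^+ j.+1 <= Y w)%R] w)%:E.
have mu_ j : measurable_fun A (u j).
  by apply/measurable_EFinP/measurable_funTS; apply: measurable_funM => //;
    exact: measurable_indic.
have u0 j w : (0 <= u j w)%E by rewrite lee_fin mulr_ge0// exprn_ge0.
have ptw w : ((Y w)%:E <= 2%:E + \sum_(j <oo) u j w)%E.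
  have [Y2|Y2] := ltP (Y w) 2.
    rewrite (@le_trans _ _ 2%:E)//; first by rewrite lee_fin ltW.
    by rewrite leeDl// nneseries_ge0.
  have [N hN] : exists N, (2 ^+ N.+1 <= Y w < 2 ^+ N.+2).
    have ex : exists n, Y w < 2 ^+ n.
      exists (Num.truncn (Y w)).+1; apply: lt_le_trans (truncnS_gt _) _.
      by rewrite -natrX ler_nat ltnW// ltn_expl.
    case: (ex_minnP ex) => -[|[|N]] YN minN.
    - by move: YN; rewrite expr0 ltNge (le_trans _ Y2)// ler1n.
    - by move: YN; rewrite expr1 ltNge Y2.
    - exists N; rewrite YN andbT leNgt; apply/negP => /minN.
      by rewrite ltnn.
  have sumN M : 2 + \sum_(0 <= j < M) 2 ^+ j.+1 = 2 ^+ M.+1 :> R.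
    elim: M => [|M IH]; first by rewrite big_nil addr0 expr1.
    by rewrite big_nat_recr//= addrA IH (exprS _ M.+1); lra.
  apply: (@le_trans _ _ (2%:E + \sum_(0 <= j < N.+1) u j w)%E); last first.
    by apply: leeD => //; apply: nneseries_lim_ge => j _ _; exact: u0.
  rewrite (_ : (\sum_(0 <= j < N.+1) u j w)%E = (\sum_(0 <= j < N.+1) 2 ^+ j.+1)%:E).
    by rewrite -EFinD sumN lee_fin ltW//; case/andP: hN.
  rewrite -sumEFin; apply: eq_big_nat => j /andP[_ jN].
  rewrite /u indicE mem_set ?mulr1//=; case/andP: hN => hN _.
  by apply: le_trans hN; rewrite ler_eXn2l// ltr1n.
have mS : measurable_fun A (fun w => (\sum_(j <oo) u j w)%E).
  by apply: ge0_emeasurable_sum => // j w _ _; exact: u0.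
apply: (@le_trans _ _ (\int[mu]_(w in A) (2%:E + \sum_(j <oo) u j w))%E).
  apply: ge0_le_integral => //.
  - by move=> w _; rewrite lee_fin.
  - by apply/measurable_EFinP/measurable_funTS.
  - by apply: emeasurable_funD.
rewrite ge0_integralD//; last by move=> w _; apply: nneseries_ge0.
rewrite integral_cst// muA integral_nneseries//.
rewrite (_ : 4 * a = 2 * a + 2 * a); last by ring.
rewrite [in leRHS]EFinD; apply: leeD; first by rewrite EFinM.
have a0 : 0 <= a by rewrite -lee_fin -muA.
apply: (@le_trans _ _ (\sum_(j <oo) ((2 * a) / (2 ^ (j + 1))%:R)%:E)%E).
  apply: lee_nneseries => [j _ _|j _]; first exact: integral_ge0.
  rewrite /u; under eq_integral do rewrite EFinM.
  rewrite ge0_integralZl_EFin ?exprn_ge0//; last first.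
    by apply/measurable_EFinP/measurable_indic.
  rewrite integral_indic// setIC.
  apply: (@le_trans _ _ ((2 ^+ j.+1)%:E * (2 * 4^-1 ^+ j.+1 * a)%:E)%E).
    by rewrite lee_wpmul2l// lee_fin exprn_ge0.
  rewrite -EFinM lee_fin addn1 natrX; apply: le_of_eq.
  have -> : 4^-1 ^+ j.+1 = (2 ^+ j.+1)^-1 * (2 ^+ j.+1)^-1 :> R.
    by rewrite -exprVn -exprMn; congr (_ ^+ _); field.
  by field.
apply: le_of_eq; apply/cvg_lim => //.
by have := @cvg_geometric_eseries_half R (2 * a) 0; rewrite expr0 divr1; exact.
Qed.

End Dyadic.

Section CondTail.
Context d (Omega : measurableType d) {R : realType} (P : probability Omega R).
Variable G : set (set Omega).
Hypothesis GM : G `<=` @measurable _ Omega.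

(** The measurability of [A] is a consequence: [is_cond_exp] makes the indicator
    of [A] integrable. *)
Lemma cond_prob_le_setI (A B : set Omega) (b : R) :
  cond_prob_le P <<s G >> A b -> <<s G >> B ->
  measurable A /\ (P (B `&` A) <= b%:E * P B)%E.
Proof.
move=> [Z [iA iZ _ EZ] Zb] FB.
have mB := sub_measurable_set GM FB.
have mA : measurable A.
  have /integrableP[/measurable_EFinP mA _] := iA.
  have := mA measurableT [set 1] (measurable_set1 1); rewrite setTI.
  congr (measurable _); apply/seteqP; split => w /=; rewrite indicE.
    by case: (boolP (w \in A)) => [/set_mem//|_ /eqP]; rewrite eq_sym oner_eq0.
  by move=> Aw; rewrite mem_set.
split => //.
have mZ : measurable_fun setT Z.
  by have /integrableP[/measurable_EFinP] := iZ.
have := EZ _ FB; rewrite integral_indic// setIC => <-.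
have mZb : measurable_fun setT (fun w => Num.min (Z w) b).
  by apply: measurable_minr.
rewrite (@ae_eq_integral _ _ _ P B (fun w => (Num.min (Z w) b)%:E))//; last 3 first.
- by apply/measurable_EFinP/measurable_funTS.
- by apply/measurable_EFinP/measurable_funTS.
- by apply: filterS Zb => w Zw _; rewrite min_l.
rewrite -(integral_cst P mB b%:E); apply: le_integral => //.
- apply: (@le_integrable _ _ _ P B mB _ (fun w => (`|Z w| + `|b|)%:E)) => //.
  + by apply/measurable_EFinP/measurable_funTS.
  + move=> w _; rewrite !lee_fin (@ger0_norm _ (_ + _)) ?addr_ge0//.
    by rewrite minEle; case: ifP => _; rewrite ?lerDl ?lerDr.
  + apply: (@integrableS _ _ _ P setT) => //.
    rewrite (_ : (fun w => _) = (fun w => `|Z w|%:E + (cst `|b|%:E) w)%E)//.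
    apply: integrableD => //; first exact: (integrable_abse iZ).
    exact: finite_measure_integrable_cst.
- apply: (@integrableS _ _ _ P setT) => //; exact: finite_measure_integrable_cst.
- by move=> w _; rewrite lee_fin ge_min lexx orbT.
Qed.

Context k (Delta : Omega -> 'rV[R]_k) (delta : R).
Hypothesis delta0 : 0 < delta.
Hypothesis Hmean : forall i,
  is_cond_exp P <<s G >> (fun w => Delta w 0 i) (cst 0).
Hypothesis Htail : forall t, 0 <= t ->
  cond_prob_le P <<s G >> [set w | t <= enorm (Delta w)]
    (2 * expR (- (t ^+ 2 / (2 * delta ^+ 2)))).

Let E w := expR (enorm (Delta w) ^+ 2 / (4 * delta ^+ 2)).

Lemma measurable_coord i : measurable_fun setT (fun w => Delta w 0 i).
Proof. by have [/integrableP[/measurable_EFinP]] := Hmean i. Qed.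

Lemma measurable_dot (u v : Omega -> 'rV[R]_k) :
  (forall i, measurable_fun setT (fun w => u w 0 i)) ->
  (forall i, measurable_fun setT (fun w => v w 0 i)) ->
  measurable_fun setT (fun w => dot (u w) (v w)).
Proof.
move=> mu mv; rewrite /dot; apply: measurable_sum => i.
exact: measurable_funM.
Qed.

Lemma measurable_normsq : measurable_fun setT (fun w => enorm (Delta w) ^+ 2).
Proof.
under eq_fun do rewrite enorm_sqr.
by apply: measurable_dot => //; exact: measurable_coord.
Qed.

(** The Gaussian tail at the radius where [E] reaches [2 ^+ j] is exactly
    [2 * 4^-1 ^+ j], so that the conditional mean of [E] is at most 4. *)
Lemma integral_expR_normsq A : <<s G >> A ->
  (\int[P]_(w in A) (E w)%:E <= \int[P]_(w in A) (4:R)%:E)%E.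
Proof.
move=> FA; have mA := sub_measurable_set GM FA.
have [a PA] : exists a, P A = a%:E.
  by exists (fine (P A)); rewrite fineK// fin_num_measure.
have a0 : 0 <= a by rewrite -lee_fin -PA.
have PmA : (P : {measure set Omega -> \bar R}) A = a%:E by [].
rewrite (integral_cst P mA 4%:E) PmA -EFinM.
apply: integral_dyadic_le => //.
- apply: measurableT_comp => //; apply: measurable_funM => //.
  exact: measurable_normsq.
- by move=> w; rewrite expR_ge0.
move=> j.
(* the radius where [E] equals [2 ^+ j.+1] *)
pose t := Num.sqrt (4 * delta ^+ 2 * (j.+1%:R * ln 2)).
have l2 : 0 < ln (2:R) by rewrite ln_gt0// ltr1n.
have t2 : t ^+ 2 = 4 * delta ^+ 2 * (j.+1%:R * ln 2).
  by rewrite sqr_sqrtr// !mulr_ge0// ?sqr_ge0// ltW.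
have d2 : 0 < 4 * delta ^+ 2 by rewrite mulr_gt0// exprn_gt0.
have [_] := cond_prob_le_setI (Htail (sqrtr_ge0 _ : 0 <= t)) FA.
rewrite ?PA ?PmA -EFinM.
have key w : (t <= enorm (Delta w)) = (2 ^+ j.+1 <= E w).
  rewrite -[LHS](ler_pXn2r (n := 2)) ?nnegrE ?enorm_ge0 ?sqrtr_ge0// t2 /E.
  rewrite -[X in X ^+ j.+1](@lnK _ (2:R)) ?posrE// -expRM_natl ler_expR.
  by rewrite ler_pdivlMr// mulrC.
have -> : [set w | t <= enorm (Delta w)] = [set w | 2 ^+ j.+1 <= E w].
  by apply/seteqP; split => w /=; rewrite key.
move=> /le_trans; apply; rewrite lee_fin ler_wpM2r//.
rewrite ler_wpM2l// t2.
rewrite (_ : _ / _ = j.+1%:R * (2 * ln 2)); last first.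
  by field; rewrite gt_eqF.
rewrite -mulrN expRM_natl lerXn2r// ?nnegrE ?expR_ge0//.
have -> : - (2 * ln 2) = 2%:R * - ln (2:R) by rewrite mulrN.
by rewrite expRM_natl expRN lnK ?posrE// expr2; lra.
Qed.

(** [le_integral_weight] needs nonnegative functions: a coordinate is split into
    its positive and negative parts, and [u] is shifted by its bound. *)
Lemma integral_weight_mean (u : Omega -> R) (N : R) i :
  sub_measurable <<s G >> u -> (forall w, `|u w| <= N) ->
  P.-integrable setT (fun w => (u w * Delta w 0 i)%:E) /\
  (\int[P]_w (u w * Delta w 0 i)%:E = 0)%E.
Proof.
have [iD _ _ ED] := Hmean i.
have mD := measurable_coord i.
have int (v : Omega -> R) (M : R) : sub_measurable <<s G >> v ->
    (forall w, `|v w| <= M) -> P.-integrable setT (fun w => (v w * Delta w 0 i)%:E).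
  move=> mv vM; apply: (@le_integrable _ _ _ P setT measurableT _
      (fun w => (M%:E * (Delta w 0 i)%:E)%E)).
  - by apply/measurable_EFinP/measurable_funM => //; exact: (sub_measurable_fun GM).
  - move=> w _; rewrite -EFinM !lee_fin !normrM ler_wpM2r//.
    by rewrite (le_trans (vM w))// ler_norm.
  - exact: integrableZl.
pose Dp w := Num.max (Delta w 0 i) 0.
pose Dn w := Num.max (- Delta w 0 i) 0.
have Dp0 w : 0 <= Dp w by rewrite le_max lexx orbT.
have Dn0 w : 0 <= Dn w by rewrite le_max lexx orbT.
have DE w : Delta w 0 i = Dp w - Dn w.
  rewrite /Dp /Dn; have [h|h] := leP 0 (Delta w 0 i).
    by rewrite max_r ?oppr_le0// subr0.
  by rewrite max_l ?oppr_ge0 ?ltW// sub0r opprK.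
have Dpn w : Dp w <= `|Delta w 0 i| by rewrite ge_max ler_norm normr_ge0.
have Dnn w : Dn w <= `|Delta w 0 i|.
  by rewrite ge_max normr_ge0 andbT -normrN ler_norm.
have mDp : measurable_fun setT Dp by exact: measurable_maxr.
have mDn : measurable_fun setT Dn.
  by apply: measurable_maxr => //; exact: measurableT_comp.
have intp (v f : Omega -> R) (M : R) : sub_measurable <<s G >> v ->
    (forall w, `|v w| <= M) -> measurable_fun setT f ->
    (forall w, 0 <= f w <= `|Delta w 0 i|) ->
    P.-integrable setT (fun w => (v w * f w)%:E).
  move=> mv vM mf fD; apply: (@le_integrable _ _ _ P setT measurableT _
      (fun w => (v w * Delta w 0 i)%:E)).
  - by apply/measurable_EFinP/measurable_funM => //; exact: (sub_measurable_fun GM).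
  - move=> w _; rewrite !lee_fin !normrM ler_wpM2l//.
    by case/andP: (fD w) => f0 ?; rewrite ger0_norm.
  - exact: int.
have intD (f : Omega -> R) : measurable_fun setT f ->
    (forall w, 0 <= f w <= `|Delta w 0 i|) -> P.-integrable setT (EFin \o f).
  move=> mf fD.
  apply: (@le_integrable _ _ _ P setT measurableT _
      (EFin \o fun w => Delta w 0 i)) => //; first exact/measurable_EFinP.
  by move=> w _; rewrite !lee_fin; case/andP: (fD w) => f0 ?; rewrite ger0_norm.
have iDp : P.-integrable setT (EFin \o Dp).
  by apply: intD => // w; rewrite Dp0 Dpn.
have iDn : P.-integrable setT (EFin \o Dn).
  by apply: intD => // w; rewrite Dn0 Dnn.
have eqA A : <<s G >> A ->
    (\int[P]_(w in A) (Dp w)%:E = \int[P]_(w in A) (Dn w)%:E)%E.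
  move=> FA; have mA := sub_measurable_set GM FA.
  have iDpA : P.-integrable A (EFin \o Dp) by exact: (integrableS measurableT).
  have iDnA : P.-integrable A (EFin \o Dn) by exact: (integrableS measurableT).
  have := ED _ FA; rewrite integral0.
  under eq_integral do rewrite DE EFinB.
  rewrite integralB_EFin// => /esym/eqP.
  rewrite sube_eq ?add0e; first by move/eqP.
  - exact: integrable_fin_num.
  - by rewrite fin_num_adde_defl//; exact: integrable_fin_num.
have pos (v : Omega -> R) (M : R) : sub_measurable <<s G >> v ->
    (forall w, 0 <= v w <= M) -> (\int[P]_w (v w * Delta w 0 i)%:E = 0)%E.
  move=> mv vM.
  have v0 w : 0 <= v w by case/andP: (vM w).
  have vM' w : `|v w| <= M by rewrite ger0_norm//; case/andP: (vM w).
  under eq_integral do rewrite DE mulrBr EFinB.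
  have i1 : P.-integrable setT (fun w => (v w * Dp w)%:E).
    by apply: (intp _ _ M) => // w; rewrite Dp0 Dpn.
  have i2 : P.-integrable setT (fun w => (v w * Dn w)%:E).
    by apply: (intp _ _ M) => // w; rewrite Dn0 Dnn.
  rewrite integralB_EFin//.
  have -> : (\int[P]_w (v w * Dp w)%:E = \int[P]_w (v w * Dn w)%:E)%E.
    apply/eqP; rewrite eq_le; apply/andP; split;
      by apply: (le_integral_weight GM) => // A FA; rewrite eqA.
  by rewrite subee//; exact: integrable_fin_num.
move=> mu uN; split; first exact: (int _ N).
have N0 : 0 <= N by apply: le_trans (uN point).
have mN : sub_measurable <<s G >> (fun _ : Omega => N) by exact: sub_measurable_cst.
rewrite (_ : (fun w => _) = (fun w => ((u w + N) * Delta w 0 i)%:E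
    - (N * Delta w 0 i)%:E)%E); last first.
  by apply/funext => w; rewrite -EFinB; congr (_%:E); ring.
rewrite integralB_EFin//; last 2 first.
- apply: (int _ (N + N)); first exact: sub_measurableD.
  by move=> w; rewrite (le_trans (ler_normD _ _))// (ger0_norm N0) lerD2r.
- by apply: (int _ N) => // w; rewrite ger0_norm.
rewrite (pos _ (N + N)); last 2 first.
- exact: sub_measurableD.
- move=> w; have := uN w; rewrite ler_norml => /andP[h1 h2].
  by apply/andP; split; lra.
by rewrite (pos _ N) ?sube0// => w; rewrite N0 lexx.
Qed.

End CondTail.

(** * Conditional moment generating functions *)

Section ExpBounds.
Context {R : realType}.

Lemma expR_le_inv (x : R) : x < 1 -> expR x <= (1 - x)^-1.
Proof.
move=> x1; rewrite -[x in leLHS]opprK expRN lef_pV2 ?posrE ?expR_gt0 ?subr_gt0//.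
exact: expR_ge1Dx.
Qed.

(** Isolates a linear term, which a zero mean removes, from a Gaussian one. *)
Lemma expR_le_linear_gauss (x : R) : expR x <= x + expR (2 * x ^+ 2).
Proof.
have [x2|x2] := leP x 2^-1.
  apply: (@le_trans _ _ (x + (1 + 2 * x ^+ 2))); last first.
    by rewrite lerD2l expR_ge1Dx.
  apply: le_trans (expR_le_inv _) _; first by lra.
  rewrite -[leLHS]mul1r ler_pdivrMr; last by lra.
  rewrite -subr_ge0 (_ : _ - _ = x ^+ 2 * (1 - 2 * x)); last by ring.
  by rewrite mulr_ge0 ?sqr_ge0//; lra.
apply: (@le_trans _ _ (expR (2 * x ^+ 2))); last by rewrite lerDr; lra.
by rewrite ler_expR; nra.
Qed.

(** Convexity of the exponential between [0] and [y]. *)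
Lemma expR_convex01 (s y : R) : 0 <= s <= 1 ->
  expR (s * y) <= 1 + s * (expR y - 1).
Proof.
move=> /andP[s0 s1].
have h1 : expR (s * y) * (1 + (1 - s) * y) <= expR y.
  rewrite [in leRHS](_ : y = s * y + (1 - s) * y); last by ring.
  by rewrite expRD ler_wpM2l ?expR_ge0// expR_ge1Dx.
have h2 : expR (s * y) * (1 + - (s * y)) <= 1.
  by rewrite -[leRHS](@expR0 R) -(subrr (s * y)) expRD ler_wpM2l ?expR_ge0// expR_ge1Dx.
have := lerD (ler_wpM2l s0 h1) (ler_wpM2l (_ : 0 <= 1 - s) h2).
rewrite subr_ge0 s1 => /(_ isT) h3.
rewrite (_ : expR (s * y) = s * (expR (s * y) * (1 + (1 - s) * y)) +
  (1 - s) * (expR (s * y) * (1 + - (s * y)))); last by ring.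
by apply: le_trans h3 _; lra.
Qed.

(** Absorbs the constant 4 of [integral_expR_normsq] into the exponent when the
    exponent is bounded away from 0. *)
Lemma four_le_expR (u : R) : 8^-1 <= u -> 4 * expR u <= expR (24 * u).
Proof.
move=> u8; rewrite (_ : 24 * u = 23 * u + u) ?expRD; last by ring.
rewrite ler_wpM2r ?expR_ge0//.
apply: (@le_trans _ _ (expR (2%:R * (23/16)))); last by rewrite ler_expR; lra.
rewrite expRM_natl; have := expR_ge1Dx (23/16 : R); nra.
Qed.

End ExpBounds.

Section CondMGF.
Context d (Omega : measurableType d) {R : realType} (P : probability Omega R).
Variable G : set (set Omega).
Hypothesis GM : G `<=` @measurable _ Omega.

Lemma le_integral_ge0 (f g : Omega -> R) :
  measurable_fun setT f -> measurable_fun setT g ->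
  (forall w, 0 <= f w <= g w) ->
  (\int[P]_w (f w)%:E <= \int[P]_w (g w)%:E)%E.
Proof.
move=> mf mg fg; apply: ge0_le_integral => //.
- by move=> w _; rewrite lee_fin; case/andP: (fg w).
- exact/measurable_EFinP.
- exact/measurable_EFinP.
- by move=> w _; rewrite lee_fin; case/andP: (fg w).
Qed.

Lemma integral_ge0D (f g : Omega -> R) :
  measurable_fun setT f -> measurable_fun setT g ->
  (forall w, 0 <= f w) -> (forall w, 0 <= g w) ->
  (\int[P]_w (f w + g w)%:E = \int[P]_w (f w)%:E + \int[P]_w (g w)%:E)%E.
Proof.
move=> mf mg f0 g0; under eq_integral do rewrite EFinD.
by rewrite ge0_integralD// => [w _||w _|]; rewrite ?lee_fin//; exact/measurable_EFinP.
Qed.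

(** There is nothing to prove when [h] has infinite integral; otherwise all three
    functions are integrable and the integral is additive. *)
Lemma le_integral_mean0 (f g h : Omega -> R) :
  measurable_fun setT f -> measurable_fun setT h ->
  (forall w, 0 <= f w) -> (forall w, 0 <= h w) ->
  P.-integrable setT (EFin \o g) -> (\int[P]_w (g w)%:E = 0)%E ->
  (forall w, f w <= g w + h w) ->
  (\int[P]_w (f w)%:E <= \int[P]_w (h w)%:E)%E.
Proof.
move=> mf mh f0 h0 ig g0 fgh.
have [hoo|hoo] := eqVneq (\int[P]_w (h w)%:E)%E +oo%E; first by rewrite hoo leey.
have mg : measurable_fun setT g by case/integrableP: ig => /measurable_EFinP.
have ih : P.-integrable setT (EFin \o h).
  apply/integrableP; split; first exact/measurable_EFinP.
  under eq_integral do rewrite /= ger0_norm//.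
  by rewrite ltey.
apply: (@le_trans _ _ (\int[P]_w (g w + h w)%:E)%E).
  apply: le_integral_ge0 => //; first exact: measurable_funD.
  by move=> w; rewrite f0 fgh.
under eq_integral do rewrite EFinD.
by rewrite integralD_EFin// g0 add0e.
Qed.

Context k (Delta : Omega -> 'rV[R]_k) (delta : R).
Hypothesis delta0 : 0 < delta.
Hypothesis Hmean : forall i,
  is_cond_exp P <<s G >> (fun w => Delta w 0 i) (cst 0).
Hypothesis Htail : forall t, 0 <= t ->
  cond_prob_le P <<s G >> [set w | t <= enorm (Delta w)]
    (2 * expR (- (t ^+ 2 / (2 * delta ^+ 2)))).

Let E w := expR (enorm (Delta w) ^+ 2 / (4 * delta ^+ 2)).

Let mD : forall i, measurable_fun setT (fun w => Delta w 0 i).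
Proof. exact: (measurable_coord Hmean). Qed.

Let E0 w : 0 <= E w. Proof. exact: expR_ge0. Qed.

Let mE : measurable_fun setT E.
Proof.
apply: measurableT_comp => //; apply: measurable_funM => //.
exact: (measurable_normsq Hmean).
Qed.

Let d2 : 0 < delta ^+ 2. Proof. by rewrite exprn_gt0. Qed.

Lemma integral_weight_expR_normsq (c : Omega -> R) :
  sub_measurable <<s G >> c -> (forall w, 0 <= c w) ->
  (\int[P]_w (c w * E w)%:E <= \int[P]_w (c w * 4)%:E)%E.
Proof.
move=> mc c0; apply: (le_integral_weight GM) => // A FA.
by exact: (integral_expR_normsq GM delta0 Hmean Htail).
Qed.

(** The mean of [E] is at most 4; smaller exponents follow by convexity, because
    [1 + 3 * s <= expR (3 * s)]. *)
Lemma cond_mgf_normsq (xi : Omega -> R) (q : R) :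
  sub_measurable <<s G >> xi -> (forall w, 0 <= xi w) ->
  0 <= q <= (4 * delta ^+ 2)^-1 ->
  (\int[P]_w (xi w * expR (q * enorm (Delta w) ^+ 2))%:E
   <= \int[P]_w (xi w * expR (12 * (q * delta ^+ 2)))%:E)%E.
Proof.
move=> mxi xi0 /andP[q0 q1].
have mxi' : measurable_fun setT xi by exact: (sub_measurable_fun GM).
pose s := 4 * delta ^+ 2 * q.
have s01 : 0 <= s <= 1.
  apply/andP; split; first by rewrite !mulr_ge0 ?(ltW delta0).
  by rewrite /s mulrC -ler_pdivlMr ?mulr_gt0// div1r.
case/andP: (s01) => s0 s1.
have mn := measurable_normsq Hmean.
apply: (@le_trans _ _ (\int[P]_w (xi w * (1 - s) + (xi w * s) * E w)%:E)%E).
  apply: le_integral_ge0.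
  - by apply: measurable_funM => //; apply: measurableT_comp => //; exact: measurable_funM.
  - by apply: measurable_funD; apply: measurable_funM => //; apply: measurable_funM.
  - move=> w; rewrite mulr_ge0 ?expR_ge0//=.
    rewrite -mulrA -mulrDr ler_wpM2l//.
    have -> : q * enorm (Delta w) ^+ 2 = s * (enorm (Delta w) ^+ 2 / (4 * delta ^+ 2)).
      by rewrite /s; field; rewrite gt_eqF.
    by apply: le_trans (expR_convex01 _ s01) _; rewrite /E; lra.
have m1 : measurable_fun setT (fun w => xi w * (1 - s)) by exact: measurable_funM.
have m2 : measurable_fun setT (fun w => xi w * s) by exact: measurable_funM.
have p1 w : 0 <= xi w * (1 - s) by rewrite mulr_ge0// subr_ge0.
have p2 w : 0 <= xi w * s by rewrite mulr_ge0.
rewrite integral_ge0D//; last 2 first.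
  by exact: measurable_funM.
  by move=> w; rewrite mulr_ge0.
apply: (@le_trans _ _ (\int[P]_w (xi w * (1 - s))%:E
    + \int[P]_w ((xi w * s) * 4)%:E)%E).
  rewrite leeD2l//; apply: integral_weight_expR_normsq.
    by apply: sub_measurableM => //; exact: sub_measurable_cst.
  by move=> w; rewrite mulr_ge0.
rewrite -integral_ge0D//; last 2 first.
  by exact: measurable_funM.
  by move=> w; rewrite mulr_ge0.
apply: le_integral_ge0.
- by apply: measurable_funD; apply: measurable_funM => //; exact: measurable_funM.
- by apply: measurable_funM.
- move=> w; rewrite addr_ge0 ?p1 ?(mulr_ge0 (p2 w))//=.
  rewrite -mulrA -mulrDr ler_wpM2l//.
  by apply: le_trans (expR_ge1Dx _); rewrite /s; lra.
Qed.

(** On the set where [8 * delta ^+ 2 * enorm (v w) ^+ 2 <= 1] the inequality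
    [exp x <= x + exp (2 x^2)] leaves, after the zero mean has removed [x], a power
    of [E] with exponent at most 1.  Elsewhere the inner product is split by
    Young's inequality, and the factor 4 is absorbed by [four_le_expR]. *)
Lemma cond_mgf_linear_bounded (xi : Omega -> R) (v : Omega -> 'rV[R]_k) (N : R) :
  sub_measurable <<s G >> xi -> (forall w, 0 <= xi w <= N) ->
  (forall i, sub_measurable <<s G >> (fun w => v w 0 i)) ->
  (forall w i, `|v w 0 i| <= N) ->
  (\int[P]_w (xi w * expR (dot (Delta w) (v w)))%:E
   <= \int[P]_w (xi w * expR (24 * (delta ^+ 2 * enorm (v w) ^+ 2)))%:E)%E.
Proof.
move=> mxi xiN mv vN.
have xi0 w : 0 <= xi w by case/andP: (xiN w).
have N0 : 0 <= N by apply: le_trans (xi0 point) _; case/andP: (xiN point).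
have mxi' : measurable_fun setT xi by exact: (sub_measurable_fun GM).
have mv' i : measurable_fun setT (fun w => v w 0 i) by exact: (sub_measurable_fun GM).
pose n2 w := enorm (v w) ^+ 2.
have mn2 : sub_measurable <<s G >> n2.
  rewrite (_ : n2 = fun w => \sum_i v w 0 i * v w 0 i).
    by apply: sub_measurable_sum => i; exact: sub_measurableM.
  by apply/funext => w; rewrite /n2 enorm_sqr.
have n20 w : 0 <= n2 w by rewrite sqr_ge0.
pose s w := 8 * delta ^+ 2 * n2 w.
have ms : sub_measurable <<s G >> s by exact: sub_measurableZ.
have s0 w : 0 <= s w by apply: mulr_ge0 => //; apply: mulr_ge0 => //; exact: ltW.
pose S : set Omega := [set w | s w <= 1].
have FS : <<s G >> S by exact: (sub_measurable_le 1 ms).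
pose uS : Omega -> R := \1_S.
have muS : sub_measurable <<s G >> uS by exact: sub_measurable_indic.
have uS01 w : 0 <= uS w <= 1 by rewrite /uS indicE; case: (_ \in _); rewrite ?lexx ?ler01.
pose u i w := xi w * uS w * v w 0 i.
have mu i : sub_measurable <<s G >> (u i).
  by apply: sub_measurableM => //; exact: sub_measurableM.
have uN i w : `|u i w| <= N * N.
  rewrite normrM ler_pM//.
  case/andP: (uS01 w) => ? ?; case/andP: (xiN w) => ? ?.
  by rewrite ger0_norm ?mulr_ge0// -[leRHS]mulr1 ler_pM.
pose g w := \sum_i u i w * Delta w 0 i.
have ig : P.-integrable setT (EFin \o g).
  rewrite (_ : EFin \o g = fun w => (\sum_i (u i w * Delta w 0 i)%:E)%E).
    apply: integrable_sum => // i _.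
    by have [] := integral_weight_mean GM Hmean i (mu i) (uN i).
  by apply/funext => w /=; rewrite sumEFin.
have Ig : (\int[P]_w (g w)%:E = 0)%E.
  rewrite (_ : (fun w => _) = fun w => (\sum_i (u i w * Delta w 0 i)%:E)%E).
    rewrite integral_sum//.
      rewrite big1// => i _.
      by have [] := integral_weight_mean GM Hmean i (mu i) (uN i).
    by move=> i; have [] := integral_weight_mean GM Hmean i (mu i) (uN i).
  by apply/funext => w /=; rewrite sumEFin.
pose c1 w := xi w * uS w * (1 - s w).
pose c2 w := xi w * (uS w * s w + (1 - uS w) * expR (delta ^+ 2 * n2 w)).
have mc1 : sub_measurable <<s G >> c1.
  apply: sub_measurableM; first exact: sub_measurableM.
  by apply: sub_measurableB => //; exact: sub_measurable_cst.
have mc2 : sub_measurable <<s G >> c2.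
  apply: sub_measurableM => //; apply: sub_measurableD; apply: sub_measurableM => //.
    by apply: sub_measurableB => //; exact: sub_measurable_cst.
  by apply: sub_measurable_expR; exact: sub_measurableZ.
have c10 w : 0 <= c1 w.
  rewrite /c1 /uS indicE; case: (boolP (w \in S)) => [/set_mem /= wS|_].
    by rewrite mulr1 mulr_ge0 ?subr_ge0.
  by rewrite mulr0 mul0r.
have c20 w : 0 <= c2 w.
  case/andP: (uS01 w) => ? ?.
  by apply: mulr_ge0 => //; apply: addr_ge0; apply: mulr_ge0; rewrite ?subr_ge0 ?expR_ge0.
have mc1' := sub_measurable_fun GM mc1.
have mc2' := sub_measurable_fun GM mc2.
have mdot : measurable_fun setT (fun w => dot (Delta w) (v w)) by exact: measurable_dot.
apply: (@le_trans _ _ (\int[P]_w (c1 w + c2 w * E w)%:E)%E).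
  apply: (@le_integral_mean0 _ g) => //.
  - by apply: measurable_funM => //; exact: measurableT_comp.
  - by apply: measurable_funD => //; exact: measurable_funM.
  - by move=> w; rewrite mulr_ge0 ?expR_ge0.
  - by move=> w; rewrite addr_ge0// mulr_ge0.
  move=> w; have -> : g w = xi w * uS w * dot (Delta w) (v w).
    rewrite /g /dot mulr_sumr; apply: eq_bigr => i _; rewrite /u; ring.
  rewrite /c1 /c2 /uS indicE; case: (boolP (w \in S)) => [/set_mem /= wS|wS].
    rewrite [leRHS](_ : _ = xi w * (dot (Delta w) (v w) + (1 + s w * (E w - 1)))); last first.
      by rewrite /= ?mulr1n; ring.
    rewrite ler_wpM2l//; apply: le_trans (expR_le_linear_gauss _) _.
    rewrite lerD2l; apply: le_trans (expR_convex01 _ _); last by rewrite s0 wS.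
    rewrite ler_expR /s (_ : _ * (_ / _) = 2 * (n2 w * enorm (Delta w) ^+ 2)); last first.
      by field; rewrite gt_eqF.
    rewrite ler_wpM2l// -exprMn mulrC -real_normK ?num_real//.
    rewrite lerXn2r ?nnegrE ?mulr_ge0 ?enorm_ge0//.
    exact: normr_dot_le.
  rewrite /= !(mulr0, mul0r, add0r, subr0, mul1r) -mulrA ler_wpM2l//.
  rewrite -expRD ler_expR; apply: le_trans (dot_le_enorm _ _) _.
  have := sqr_ge0 (delta * enorm (v w) - enorm (Delta w) / (2 * delta)).
  rewrite (_ : (_ - _) ^+ 2 = delta ^+ 2 * n2 w + enorm (Delta w) ^+ 2 / (4 * delta ^+ 2)
     - enorm (Delta w) * enorm (v w)).
    by rewrite subr_ge0.
  by rewrite /n2; field; rewrite gt_eqF.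
rewrite integral_ge0D//; last 2 first.
  by exact: measurable_funM.
  by move=> w; rewrite mulr_ge0.
apply: (@le_trans _ _ (\int[P]_w (c1 w)%:E + \int[P]_w (c2 w * 4)%:E)%E).
  by rewrite leeD2l//; apply: integral_weight_expR_normsq.
rewrite -integral_ge0D//; last 2 first.
  by exact: measurable_funM.
  by move=> w; rewrite mulr_ge0.
apply: le_integral_ge0.
- by apply: measurable_funD => //; apply: measurable_funM.
- apply: measurable_funM => //; apply: measurableT_comp => //.
  apply: measurable_funM => //; apply: measurable_funM => //.
  exact: (sub_measurable_fun GM mn2).
move=> w; rewrite addr_ge0 ?c10 ?(mulr_ge0 (c20 w))//=.
rewrite /c1 /c2 /uS indicE; case: (boolP (w \in S)) => [/set_mem /= wS|wS].
  rewrite [leLHS](_ : _ = xi w * (1 + 3 * s w)); last by rewrite /= ?mulr1n; ring.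
  by rewrite ler_wpM2l//; apply: le_trans (expR_ge1Dx _); rewrite /s /n2; lra.
rewrite /= !(mulr0, mul0r, add0r, subr0, mul1r) -mulrA ler_wpM2l// mulrC.
apply: four_le_expR.
have : ~ (s w <= 1) by move/mem_set; apply/negP.
by move/negP; rewrite -ltNge /s => /ltW; rewrite -/(n2 w); lra.
Qed.

Lemma sub_measurable_normsq (v : Omega -> 'rV[R]_k) :
  (forall i, sub_measurable <<s G >> (fun w => v w 0 i)) ->
  sub_measurable <<s G >> (fun w => enorm (v w) ^+ 2).
Proof.
move=> mv; rewrite (_ : (fun w => _) = fun w => \sum_i v w 0 i * v w 0 i).
  by apply: sub_measurable_sum => i; exact: sub_measurableM.
by apply/funext => w; rewrite enorm_sqr.
Qed.

(** The bounded case holds on the sets where [xi] and [v] are at most [N], and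
    monotone convergence lets [N] grow. *)
Lemma cond_mgf_linear (xi : Omega -> R) (v : Omega -> 'rV[R]_k) :
  sub_measurable <<s G >> xi -> (forall w, 0 <= xi w) ->
  (forall i, sub_measurable <<s G >> (fun w => v w 0 i)) ->
  (\int[P]_w (xi w * expR (dot (Delta w) (v w)))%:E
   <= \int[P]_w (xi w * expR (24 * (delta ^+ 2 * enorm (v w) ^+ 2)))%:E)%E.
Proof.
move=> mxi xi0 mv.
have mn2 := sub_measurable_normsq mv.
have mxi' := sub_measurable_fun GM mxi.
have mv' i := sub_measurable_fun GM (mv i).
have mdot : measurable_fun setT (fun w => dot (Delta w) (v w)) by exact: measurable_dot.
pose M (N : nat) : R := N.+1%:R.
pose B N : set Omega := [set w | xi w <= M N] `&` [set w | enorm (v w) ^+ 2 <= M N].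
have FB N : <<s G >> (B N) by apply: sub_sigmaI; exact: sub_measurable_le.
pose u N : Omega -> R := \1_(B N).
have mu N : sub_measurable <<s G >> (u N) by exact: sub_measurable_indic.
have mu' N := sub_measurable_fun GM (mu N).
have u01 N w : u N w = 0 \/ (u N w = 1 /\ B N w).
  rewrite /u indicE; case: (boolP (w \in B N)) => [/set_mem ?|_]; first by right.
  by left.
have uge0 N w : 0 <= u N w by case: (u01 N w) => [->|[-> _]].
have ule1 N w : u N w <= 1 by case: (u01 N w) => [->|[-> _]].
pose f N w := xi w * u N w * expR (dot (Delta w) (v w)).
have f0 N w : 0 <= f N w.
  by apply: mulr_ge0; rewrite ?expR_ge0//; apply: mulr_ge0.
have mf N : measurable_fun setT (f N).
  apply: measurable_funM; last exact: measurableT_comp.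
  exact: measurable_funM.
have ndf w : nondecreasing_seq (fun N => (f N w)%:E).
  move=> a b ab; rewrite lee_fin /f ler_wpM2r ?expR_ge0// ler_wpM2l//.
  case: (u01 a w) => [->//|[-> [/= h1 h2]]].
  have Mab : M a <= M b by rewrite ler_nat ltnS.
  rewrite /u indicE mem_set//; split; exact: le_trans Mab.
have limf w : limn (fun N => (f N w)%:E) = (xi w * expR (dot (Delta w) (v w)))%:E.
  apply/cvg_lim => //; apply: cvg_near_cst.
  pose K := Num.truncn (Num.max (xi w) (enorm (v w) ^+ 2)).
  exists K => // N /= KN.
  have MK : Num.max (xi w) (enorm (v w) ^+ 2) <= M N.
    by rewrite (le_trans (ltW (truncnS_gt _)))// ler_nat ltnS.
  rewrite /f /u indicE mem_set ?mulr1//; split => /=;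
    by apply: le_trans MK; rewrite le_max lexx ?orbT.
have -> : (\int[P]_w (xi w * expR (dot (Delta w) (v w)))%:E
    = limn (fun N => \int[P]_w (f N w)%:E))%E.
  rewrite -monotone_convergence//.
  - by apply: eq_integral => w _; rewrite limf.
  - by move=> N; exact/measurable_EFinP.
  - by move=> N w _; rewrite lee_fin.
apply: lime_le.
  apply: ereal_nondecreasing_is_cvgn => a b ab; apply: ge0_le_integral => //.
  - by move=> w _; rewrite lee_fin.
  - exact/measurable_EFinP.
  - exact/measurable_EFinP.
  - by move=> w _; exact: ndf.
apply: nearW => N.
have M1 : 1 <= M N by rewrite ler1n.
have hb := @cond_mgf_linear_bounded (fun w => xi w * u N w) (fun w => u N w *: v w) (M N).
apply: (@le_trans _ _ (\int[P]_w (xi w * u N w * expR (dot (Delta w) (u N w *: v w)))%:E)%E).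
  apply: le_of_eq; apply: eq_integral => w _.
  congr (_%:E); rewrite /f dotZr.
  by case: (u01 N w) => [->|[-> _]]; rewrite ?mulr0 ?mul0r// mul1r.
apply: le_trans (hb _ _ _ _) _.
- exact: sub_measurableM.
- move=> w; apply/andP; split; first exact: mulr_ge0.
  case: (u01 N w) => [->|[-> [/= h1 _]]]; last by rewrite mulr1.
  by rewrite mulr0 (le_trans ler01).
- move=> i; rewrite (_ : (fun w => _) = fun w => u N w * v w 0 i).
    exact: sub_measurableM.
  by apply/funext => w; rewrite mxE.
- move=> w i; rewrite mxE.
  case: (u01 N w) => [->|[-> [/= _ h2]]].
    by rewrite mul0r normr0 (le_trans ler01).
  rewrite mul1r (le_trans (enorm_coord _ _))//.
  rewrite -(ler_pXn2r (n := 2)) ?nnegrE ?enorm_ge0 ?(le_trans ler01)//.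
  by rewrite (le_trans h2)// expr2 ler_peMr// (le_trans ler01).
apply: le_integral_ge0.
- apply: measurable_funM; first exact: measurable_funM.
  apply: measurableT_comp => //; apply: measurable_funM => //.
  apply: measurable_funM => //.
  apply: (sub_measurable_fun GM); apply: sub_measurable_normsq => i.
  rewrite (_ : (fun w => _) = fun w => u N w * v w 0 i).
    exact: sub_measurableM.
  by apply/funext => w; rewrite mxE.
- apply: measurable_funM => //; apply: measurableT_comp => //.
  by apply: measurable_funM => //; apply: measurable_funM => //; exact: (sub_measurable_fun GM).
move=> w; apply/andP; split.
  by apply: mulr_ge0; rewrite ?expR_ge0//; exact: mulr_ge0.
case: (u01 N w) => [->|[-> _]]; last by rewrite mulr1 scale1r.
by rewrite mulr0 mul0r; apply: mulr_ge0; rewrite ?expR_ge0.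
Qed.

(** The linear and the quadratic part are decoupled by the inequality
    [e^(a+b) <= (e^(2a-m) + e^(2b+m)) / 2], with [m] chosen so that both terms
    get the same bound. *)
Lemma cond_mgf (xi : Omega -> R) (v : Omega -> 'rV[R]_k) (q : R) :
  sub_measurable <<s G >> xi -> (forall w, 0 <= xi w) ->
  (forall i, sub_measurable <<s G >> (fun w => v w 0 i)) ->
  0 <= q <= (8 * delta ^+ 2)^-1 ->
  (\int[P]_w (xi w * expR (dot (Delta w) (v w) + q * enorm (Delta w) ^+ 2))%:E
   <= \int[P]_w (xi w * expR (48 * (delta ^+ 2 * enorm (v w) ^+ 2)
                              + 12 * (q * delta ^+ 2)))%:E)%E.
Proof.
move=> mxi xi0 mv /andP[q0 q1].
have mn2 := sub_measurable_normsq mv.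
have mxi' := sub_measurable_fun GM mxi.
have mv' i := sub_measurable_fun GM (mv i).
have mn := measurable_normsq Hmean.
have mdot : measurable_fun setT (fun w => dot (Delta w) (v w)) by exact: measurable_dot.
pose m w := 48 * (delta ^+ 2 * enorm (v w) ^+ 2) - 12 * (q * delta ^+ 2).
have mm : sub_measurable <<s G >> m.
  apply: sub_measurableB; last exact: sub_measurable_cst.
  by apply: sub_measurableZ; exact: sub_measurableZ.
have mm' := sub_measurable_fun GM mm.
pose x1 w := 2^-1 * (xi w * expR (- m w)).
pose x2 w := 2^-1 * (xi w * expR (m w)).
have mx1 : sub_measurable <<s G >> x1.
  apply: sub_measurableZ; apply: sub_measurableM => //.
  by apply: sub_measurable_expR; exact: sub_measurableN.
have mx2 : sub_measurable <<s G >> x2.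
  apply: sub_measurableZ; apply: sub_measurableM => //.
  exact: sub_measurable_expR.
have x10 w : 0 <= x1 w.
  by apply: mulr_ge0 => //; apply: mulr_ge0; rewrite ?expR_ge0.
have x20 w : 0 <= x2 w.
  by apply: mulr_ge0 => //; apply: mulr_ge0; rewrite ?expR_ge0.
have mx1' := sub_measurable_fun GM mx1.
have mx2' := sub_measurable_fun GM mx2.
have me1 : measurable_fun setT (fun w => x1 w * expR (dot (Delta w) (2 *: v w))).
  apply: measurable_funM => //; apply: measurableT_comp => //.
  under eq_fun do rewrite dotZr.
  exact: measurable_funM.
have me2 : measurable_fun setT (fun w => x2 w * expR (2 * q * enorm (Delta w) ^+ 2)).
  by apply: measurable_funM => //; apply: measurableT_comp => //; exact: measurable_funM.
apply: (@le_trans _ _ (\int[P]_w (x1 w * expR (dot (Delta w) (2 *: v w)) +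
     x2 w * expR (2 * q * enorm (Delta w) ^+ 2))%:E)%E).
  apply: le_integral_ge0.
  - apply: measurable_funM => //; apply: measurableT_comp => //.
    by apply: measurable_funD => //; exact: measurable_funM.
  - exact: measurable_funD.
  move=> w; apply/andP; split; first by apply: mulr_ge0; rewrite ?expR_ge0.
  rewrite /x1 /x2 dotZr.
  set a := dot _ _; set b := enorm (Delta w) ^+ 2.
  have := sqr_ge0 (expR (a - m w / 2) - expR (q * b + m w / 2)).
  rewrite sqrrB -!expRM_natl -expRD => h.
  rewrite (_ : a - m w / 2 + (q * b + m w / 2) = a + q * b) in h; last by ring.
  rewrite (_ : 2%:R * (a - m w / 2) = - m w + 2 * a) in h; last by field.
  rewrite (_ : 2%:R * (q * b + m w / 2) = m w + 2 * q * b) in h; last by field.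
  rewrite !expRD in h *.
  have xw := xi0 w.
  by nra.
rewrite integral_ge0D//; last 2 first.
  by move=> w; apply: mulr_ge0; rewrite ?expR_ge0.
  by move=> w; apply: mulr_ge0; rewrite ?expR_ge0.
have q2 : 0 <= 2 * q <= (4 * delta ^+ 2)^-1.
  apply/andP; split; first exact: mulr_ge0.
  rewrite (_ : (4 * delta ^+ 2)^-1 = 2 * (8 * delta ^+ 2)^-1); last first.
    by field; rewrite gt_eqF.
  by rewrite ler_wpM2l.
have mv2 i : sub_measurable <<s G >> (fun w => (2 *: v w) 0 i).
  rewrite (_ : (fun w => _) = fun w => 2 * v w 0 i); first exact: sub_measurableZ.
  by apply/funext => w; rewrite mxE.
apply: le_trans (leeD (cond_mgf_linear mx1 x10 mv2) (cond_mgf_normsq mx2 x20 q2)) _.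
rewrite -integral_ge0D//; last 4 first.
- apply: measurable_funM => //; apply: measurableT_comp => //.
  apply: measurable_funM => //; apply: measurable_funM => //.
  exact: (sub_measurable_fun GM (sub_measurable_normsq mv2)).
- exact: measurable_funM.
- by move=> w; apply: mulr_ge0; rewrite ?expR_ge0.
- by move=> w; apply: mulr_ge0; rewrite ?expR_ge0.
apply: le_of_eq; apply: eq_integral => w _.
congr (_%:E).
have e1 : expR (- m w) * expR (24 * (delta ^+ 2 * enorm (2 *: v w) ^+ 2)) =
    expR (48 * (delta ^+ 2 * enorm (v w) ^+ 2) + 12 * (q * delta ^+ 2)).
  rewrite -expRD; congr expR; rewrite /m enormZ exprMn real_normK ?num_real//.
  by ring.
have e2 : expR (m w) * expR (12 * (2 * q * delta ^+ 2)) =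
    expR (48 * (delta ^+ 2 * enorm (v w) ^+ 2) + 12 * (q * delta ^+ 2)).
  by rewrite -expRD; congr expR; rewrite /m; ring.
rewrite /x1 /x2 -(mulrA 2^-1) -(mulrA (xi w)) e1 -(mulrA 2^-1) -(mulrA (xi w)) e2.
by field.
Qed.

End CondMGF.

(** * Adapted vectors *)

Section Lipschitz.
Context d (Omega : measurableType d) {R : realType}.
Variable G : set (set Omega).
Local Notation F := <<s G >>.

Definition adapted k (u : Omega -> 'rV[R]_k) :=
  forall i, sub_measurable F (fun w => u w 0 i).

Lemma sub_sigma_bigcup (A : nat -> set Omega) :
  (forall n, F (A n)) -> F (\bigcup_n A n).
Proof.
move=> FA.
by apply: (@bigcupT_measurable _ (g_sigma_algebraType G)).
Qed.

Lemma sub_measurable_lt (h : Omega -> R) :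
  (forall a, F [set w | h w < a]) -> sub_measurable F h.
Proof.
move=> hF; apply/sub_measurableP.
apply: (measurability _ (RGenInftyO.measurableE R)) => //.
move=> _ [_ [a ->] <-]; rewrite setTI.
rewrite (_ : h @^-1` _ = [set w | h w < a]); first exact: hF.
by apply/seteqP; split => w /=; rewrite in_itv.
Qed.

(** [h] is a Lipschitz function of [Z], but defined only on the range of [Z],
    which need not be a Borel set.  The range is cut into countably many small
    cells with a representative each; [h w < a] holds exactly when, for some
    cell, the value at its representative plus the Lipschitz error is below [a],
    a condition on [Z w] alone. *)
Lemma sub_measurable_lipschitz k (Z : Omega -> 'rV[R]_k) (h : Omega -> R) (L : R) :
  adapted Z -> 0 <= L ->
  (forall w w', h w <= h w' + L * \sum_i `|Z w 0 i - Z w' 0 i|) ->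
  sub_measurable F h.
Proof.
move=> mZ L0 hL; apply: sub_measurable_lt => a.
pose cell (j : nat) (z : {ffun 'I_k -> int}) : set Omega :=
  [set w | forall i, Num.floor (Z w 0 i * j.+1%:R) = z i].
pose rep j z := if pselect (cell j z !=set0) is left e then projT1 (cid e) else point.
have repP j z w : cell j z w -> cell j z (rep j z).
  move=> cw; rewrite /rep; case: pselect => [e|]; first exact: (projT2 (cid e)).
  by move=> n; exfalso; apply: n; exists w.
pose near j z w := h (rep j z) + L * \sum_i `|Z w 0 i - Z (rep j z) 0 i|.
pose A (c : nat * {ffun 'I_k -> int}) : set Omega :=
  [set w | near c.1 c.2 w < a].
pose B (n : nat) : set Omega := if unpickle n is Some c then A c else set0.
have FA c : F (A c).
  have mn : sub_measurable F (near c.1 c.2).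
    apply: sub_measurableD; first exact: sub_measurable_cst.
    apply: sub_measurableZ; apply: sub_measurable_sum => i.
    apply: (@sub_measurable_comp _ _ _ _ (fun x => `|x|)); first exact: normr_measurable.
    by apply: sub_measurableB => //; exact: sub_measurable_cst.
  have := mn _ (measurable_itv `]-oo, a[).
  congr (F _); apply/seteqP; split => w /=; by rewrite in_itv.
rewrite (_ : [set w | h w < a] = \bigcup_n B n).
  apply: sub_sigma_bigcup => n; rewrite /B; case: unpickle => [c|]; first exact: FA.
  exact: sigma_algebra0.
apply/seteqP; split => w /=; last first.
  move=> [n _]; rewrite /B; case: unpickle => [c|//] /=; rewrite /near.
  by move=> h1; apply: le_lt_trans h1; exact: hL.
move=> hwa.
pose K := 2 * L * k%:R / (a - h w).
pose j := Num.truncn K.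
have aw : 0 < a - h w by rewrite subr_gt0.
have K0 : 0 <= K by rewrite divr_ge0 ?mulr_ge0// ltW.
have jK : K < j.+1%:R by exact: truncnS_gt.
pose z := [ffun i => Num.floor (Z w 0 i * j.+1%:R)].
have cw : cell j z w by move=> i; rewrite ffunE.
exists (pickle (j, z)) => //; rewrite /B pickleK /A /= /near.
have j0 : 0 < j.+1%:R :> R by rewrite ltr0n.
have close i : `|Z w 0 i - Z (rep j z) 0 i| <= j.+1%:R^-1.
  rewrite -[leRHS]mul1r ler_pdivlMr// -[X in _ * X]gtr0_norm// -normrM mulrBl.
  have c1 := cw i; have c2 := repP _ _ _ cw i.
  have := floor_itv (Z w 0 i * j.+1%:R); rewrite c1.
  have := floor_itv (Z (rep j z) 0 i * j.+1%:R); rewrite c2.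
  rewrite intrD => /andP[h1 h2] /andP[h3 h4]; rewrite ler_norml; apply/andP; split; lra.
have sumle : \sum_i `|Z w 0 i - Z (rep j z) 0 i| <= k%:R * j.+1%:R^-1.
  apply: (@le_trans _ _ (\sum_(i < k) j.+1%:R^-1)); first exact: ler_sum.
  by rewrite sumr_const card_ord mulr_natl.
have hrep : h (rep j z) <= h w + L * \sum_i `|Z w 0 i - Z (rep j z) 0 i|.
  by apply: le_trans (hL _ w) _; under eq_bigr do rewrite distrC.
have := ler_wpM2l L0 sumle.
have : 2 * (L * (k%:R * j.+1%:R^-1)) < a - h w.
  rewrite (_ : 2 * _ = 2 * L * k%:R / j.+1%:R); last by ring.
  by rewrite ltr_pdivrMr// [ltRHS]mulrC -ltr_pdivrMr.
set t1 := L * (k%:R * _); set t2 := L * \sum_i _; move: hrep; rewrite -/t2. lra.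
Qed.

Lemma sub_measurable_enorm_lipschitz k (Z : Omega -> 'rV[R]_k) (h : Omega -> R) (L : R) :
  adapted Z -> 0 <= L ->
  (forall w w', h w <= h w' + L * enorm (Z w - Z w')) ->
  sub_measurable F h.
Proof.
move=> mZ L0 hL; apply: (sub_measurable_lipschitz mZ L0) => w w'.
apply: le_trans (hL w w') _; rewrite lerD2l ler_wpM2l//.
apply: le_trans (enorm_le_sum _) _.
by apply: ler_sum => i _; rewrite !mxE.
Qed.

Lemma adapted_row_mx p q (u : Omega -> 'rV[R]_p) (v : Omega -> 'rV[R]_q) :
  adapted u -> adapted v -> adapted (fun w => row_mx (u w) (v w)).
Proof.
move=> mu mv i; case: (split_ordP i) => j ->.
  by under eq_fun do rewrite row_mxEl; exact: mu.
by under eq_fun do rewrite row_mxEr; exact: mv.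
Qed.

Lemma enorm_row_mxl p q (a : 'rV[R]_p) (b : 'rV[R]_q) : enorm a <= enorm (row_mx a b).
Proof.
rewrite -(ler_pXn2r (n := 2)) ?nnegrE ?enorm_ge0// !enorm_sqr /dot big_split_ord/=.
under [X in _ <= X + _]eq_bigr do rewrite row_mxEl.
by rewrite lerDl sumr_ge0// => i _; rewrite -expr2 sqr_ge0.
Qed.

Lemma enorm_row_mxr p q (a : 'rV[R]_p) (b : 'rV[R]_q) : enorm b <= enorm (row_mx a b).
Proof.
rewrite -(ler_pXn2r (n := 2)) ?nnegrE ?enorm_ge0// !enorm_sqr /dot big_split_ord/=.
under [X in _ <= _ + X]eq_bigr do rewrite row_mxEr.
by rewrite lerDr sumr_ge0// => i _; rewrite -expr2 sqr_ge0.
Qed.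

(** This spares exhibiting a measurable function of [a] and [b] with values [u];
    it makes proximal points and gradients along the iterates adapted. *)
Lemma adapted_lipschitz p q l (a : Omega -> 'rV[R]_p) (b : Omega -> 'rV[R]_q)
    (u : Omega -> 'rV[R]_l) (L : R) :
  adapted a -> adapted b -> 0 <= L ->
  (forall w w', enorm (u w - u w') <= L * (enorm (a w - a w') + enorm (b w - b w'))) ->
  adapted u.
Proof.
move=> ma mb L0 uL i.
pose Z w := row_mx (a w) (b w).
have mZ : adapted Z by exact: adapted_row_mx.
apply: (@sub_measurable_enorm_lipschitz _ Z _ (2 * L)) => //; first exact: mulr_ge0.
move=> w w'; rewrite -lerBlDl.
have -> : u w 0 i - u w' 0 i = (u w - u w') 0 i by rewrite !mxE.
apply: le_trans (ler_norm _) _; apply: le_trans (enorm_coord _ _) _.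
apply: le_trans (uL w w') _; rewrite (mulrC 2) -mulrA ler_wpM2l//.
rewrite /Z opp_row_mx add_row_mx.
have h1 := enorm_row_mxl (a w - a w') (b w - b w').
have h2 := enorm_row_mxr (a w - a w') (b w - b w').
lra.
Qed.

Lemma adapted_dot k (u v : Omega -> 'rV[R]_k) :
  adapted u -> adapted v -> sub_measurable F (fun w => dot (u w) (v w)).
Proof. by move=> mu mv; apply: sub_measurable_sum => i; exact: sub_measurableM. Qed.

Lemma adaptedZ k (t : R) (u : Omega -> 'rV[R]_k) :
  adapted u -> adapted (fun w => t *: u w).
Proof.
move=> mu i; rewrite (_ : (fun w => _) = fun w => t * u w 0 i).
  exact: sub_measurableZ.
by apply/funext => w; rewrite mxE.
Qed.

Lemma adaptedD k (u v : Omega -> 'rV[R]_k) :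
  adapted u -> adapted v -> adapted (fun w => u w + v w).
Proof.
move=> mu mv i; rewrite (_ : (fun w => _) = fun w => u w 0 i + v w 0 i).
  exact: sub_measurableD.
by apply/funext => w; rewrite !mxE.
Qed.

Lemma adaptedB k (u v : Omega -> 'rV[R]_k) :
  adapted u -> adapted v -> adapted (fun w => u w - v w).
Proof.
move=> mu mv i; rewrite (_ : (fun w => _) = fun w => u w 0 i - v w 0 i).
  exact: sub_measurableB.
by apply/funext => w; rewrite !mxE.
Qed.

Lemma adapted_cst k (v : 'rV[R]_k) : adapted (fun _ => v).
Proof. by move=> i; exact: sub_measurable_cst. Qed.

End Lipschitz.

Lemma sub_measurable_mono d (Omega : measurableType d) (R : realType)
    (G G' : set (set Omega)) (u : Omega -> R) :
  G `<=` G' -> sub_measurable <<s G >> u -> sub_measurable <<s G' >> u.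
Proof. by move=> GG mu B mB; exact: (sub_sigma_algebra2 GG (mu B mB)). Qed.

Lemma adapted_mono d (Omega : measurableType d) (R : realType)
    (G G' : set (set Omega)) k (u : Omega -> 'rV[R]_k) :
  G `<=` G' -> adapted G u -> adapted G' u.
Proof. by move=> GG mu i; exact: sub_measurable_mono (mu i). Qed.

(** * Risk measures of the square root of a variable with an exponential moment *)

Section LogIntegral.
Context {R : realType}.
Local Notation mu := (@lebesgue_measure R).

Let f (q : R) : R := - ln (1 - q).
Let F (q : R) : R := (1 - q) * ln (1 - q) + q.

Lemma is_derive_ln1B (q : R) : q < 1 -> is_derive q 1 (fun x : R => ln (1 - x)) (- (1 - q)^-1).
Proof.
move=> q1.
have h : is_derive q 1 (fun x : R => 1 - x) (-1).
  by apply: is_derive_eq; rewrite add0r mul1r.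
have q0 : 0 < 1 - q by rewrite subr_gt0.
have := @is_derive1_comp R (@ln R) (fun x => 1 - x) q _ _ (is_derive1_ln q0) h.
by rewrite mulrN1.
Qed.

Lemma is_derive_F (q : R) : q < 1 -> is_derive q 1 F (f q).
Proof.
move=> q1; rewrite /F.
have h := is_derive_ln1B q1.
have h' : is_derive q 1 (fun x : R => 1 - x) (-1).
  by apply: is_derive_eq; rewrite add0r mul1r.
apply: is_derive_eq; rewrite /f /GRing.scale/=.
by field; rewrite subr_eq0 gt_eqF.
Qed.

Lemma integral_ln_le (p x : R) : 0 <= p -> p < x -> x < 1 ->
  (\int[mu]_(q in `[p, x]) (f q)%:E <= ((1 - p) * (1 - ln (1 - p)))%:E)%E.
Proof.
move=> p0 px x1.
have cF (q : R) : q < 1 -> {for q, continuous F}.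
  move=> q1; apply: differentiable_continuous; apply/derivable1_diffP.
  by have [] := is_derive_F q1.
have cf (q : R) : q < 1 -> {for q, continuous f}.
  move=> q1; apply: differentiable_continuous; apply/derivable1_diffP.
  by have [] := is_deriveN (is_derive_ln1B q1).
rewrite (@continuous_FTC2 R f F)//.
- rewrite -EFinB lee_fin /F.
  have : (1 - x) * ln (1 - x) <= 0.
    by rewrite mulr_ge0_le0 ?ln_le0//; lra.
  lra.
- apply: continuous_in_subspaceT => q; rewrite inE/= in_itv/= => /andP[_ qx].
  by apply: cf; exact: le_lt_trans qx x1.
- split.
  + move=> q; rewrite in_itv/= => /andP[_ qx].
    by have [] := is_derive_F (lt_trans qx x1).
  + by apply: cvg_at_right_filter; apply: cF; exact: lt_trans px x1.
  + by apply: cvg_at_left_filter; exact: cF.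
- move=> q; rewrite in_itv/= => /andP[_ qx]; rewrite derive1E.
  by have [_ ->] := is_derive_F (lt_trans qx x1).
Qed.

Lemma measurable_ln1B : measurable_fun setT (fun q : R => - ln (1 - q)).
Proof.
apply: measurableT_comp => //; apply: measurableT_comp; first exact: measurable_ln.
exact: measurable_funB.
Qed.

(** The integrand is unbounded at 1, so the interval is exhausted by compact ones. *)
Lemma integral_ln1B_le (p : R) : 0 <= p -> p < 1 ->
  (\int[mu]_(q in `[p, 1%R[) (f q)%:E <= ((1 - p) * (1 - ln (1 - p)))%:E)%E.
Proof.
move=> p0 p1.
pose x (i : nat) := 1 - (1 - p) / i.+2%:R.
have x1 i : x i < 1 by rewrite /x gtrBl divr_gt0// subr_gt0.
have px i : p < x i.
  rewrite /x ltrBrDl -ltrBrDr ltr_pdivrMr// ltr_pMr ?subr_gt0//.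
  by rewrite ltr1n.
have f0 (q : R) : p <= q -> q < 1 -> 0 <= f q.
  by move=> pq q1; rewrite /f oppr_ge0 ln_le0//; lra.
rewrite (_ : `[p, 1[%classic = \bigcup_i `[p, x i]%classic); last first.
  apply/seteqP; split => q /=; last first.
    move=> [i _] /=; rewrite !in_itv/= => /andP[-> qx]/=.
    exact: le_lt_trans qx (x1 i).
  rewrite in_itv/= => /andP[pq q1].
  have q1' : 0 < 1 - q by rewrite subr_gt0.
  pose i := Num.truncn ((1 - p) / (1 - q)).
  exists i => //=; rewrite in_itv/= pq/= /x lerBrDl -lerBrDr.
  rewrite ler_pdivrMr// mulrC -ler_pdivrMr//.
  apply: (@le_trans _ _ i.+1%:R); last by rewrite ler_nat.
  exact/ltW/truncnS_gt.
have ndI : nondecreasing_seq (fun i => `[p, x i]%classic : set R).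
  apply/nondecreasing_seqP => i; rewrite subsetEset; apply: subset_itvl.
  rewrite bnd_simp /x lerD2l lerN2 ler_wpM2l ?subr_ge0 ?ltW//.
  by rewrite ltf_pV2 ?posrE// ltr_nat.
have mI i : measurable (`[p, x i]%classic : set R) by [].
have mf i : measurable_fun `[p, x i] (EFin \o f).
  by apply/measurable_EFinP/measurable_funTS; exact: measurable_ln1B.
have fI i (q : R) : `[p, x i]%classic q -> (0 <= (EFin \o f) q)%E.
  rewrite /= in_itv/= => /andP[pq qx]; rewrite lee_fin f0//.
  exact: le_lt_trans qx (x1 i).
have cv := ge0_nondecreasing_set_cvg_integral (mu := mu) ndI mI mf fI.
rewrite -(cvg_lim _ cv)//.
apply: lime_le; last by apply: nearW => i; exact: integral_ln_le.
by apply: cvgP cv.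
Qed.

End LogIntegral.

(** Every simple function below the positive part of [f] is below [g]; hence [f],
    in the application a quantile function, may fail to be measurable. *)
Lemma le_integral_nonmeasurable d (T : measurableType d) (R : realType)
    (mu : {measure set T -> \bar R}) (D : set T) (f g : T -> \bar R) :
  (forall x, D x -> (0 <= g x)%E) -> (forall x, D x -> (f x <= g x)%E) ->
  (\int[mu]_(x in D) f x <= \int[mu]_(x in D) g x)%E.
Proof.
move=> g0 fg; rewrite [in leLHS]integralE.
rewrite -[leRHS]sube0; apply: leeB; last exact: integral_ge0.
rewrite !ge0_integralE//; apply: le_ereal_sup => _ [h /= hf <-].
exists h => // x; apply: le_trans (hf x) _.
rewrite !patchE; case: ifPn => // /set_mem Dx.
by rewrite funeposE ge_max fg//= g0.
Qed.

Section RiskMeasures.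
Context d (Omega : measurableType d) {R : realType} (P : probability Omega R).
Variables (D : Omega -> R) (b s : R).
Hypothesis mD : measurable_fun setT D.
Hypothesis D0 : forall w, 0 <= D w.
Hypothesis b0 : 0 < b.
Hypothesis s0 : 0 < s.
Hypothesis mgfD : (\int[P]_w (expR (D w / s))%:E <= (expR (b / s))%:E)%E.

Let U w := Num.sqrt (D w).

Let mU : measurable_fun setT U.
Proof.
by apply: measurableT_comp => //; apply: continuous_measurable_fun; exact: sqrt_continuous. Qed.

(** Markov's inequality for [expR (D / s)]. *)
Lemma tail_le (t : R) : b <= t ->
  (P [set w | (t < D w)%R] <= (expR ((b - t) / s))%:E)%E.
Proof.
move=> bt.
have mA : measurable [set w | (t < D w)%R].
  rewrite -[X in measurable X]setTI (_ : [set w | _] = D @^-1` `]t, +oo[).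
    exact: mD.
  by apply/seteqP; split => w /=; rewrite in_itv/= andbT.
rewrite -[X in (X <= _)%E](_ : \int[P]_w (\1_[set w | (t < D w)%R] w)%:E = _)%E; last first.
  by rewrite integral_indic// setIT.
rewrite (_ : (expR ((b - t) / s))%:E = (expR (- (t / s)))%:E * (expR (b / s))%:E)%E; last first.
  by rewrite -EFinM -expRD; congr (expR _)%:E; rewrite mulrBl addrC.
apply: (@le_trans _ _ ((expR (- (t / s)))%:E * \int[P]_w (expR (D w / s))%:E)%E); last first.
  by rewrite lee_wpmul2l// lee_fin expR_ge0.
have mE : measurable_fun setT (fun w => expR (D w / s)).
  by apply: measurableT_comp => //; exact: measurable_funM.
rewrite -ge0_integralZl_EFin ?expR_ge0//; last first.
  exact/measurable_EFinP.
under [leRHS]eq_integral do rewrite -EFinM.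
apply: le_integral_ge0.
- exact: measurable_indic.
- exact: measurable_funM.
move=> w; rewrite indicE ler0n/= -expRD.
case: (boolP (w \in _)) => [/set_mem/= tD|_]; last by rewrite expR_ge0.
rewrite -[leLHS]expR0 ler_expR addrC -mulNr -mulrDl.
by apply: divr_ge0; [rewrite subr_ge0 ltW|exact: ltW].
Qed.

(** The free parameter [c] is chosen after the expectation has been taken. *)
Lemma sqrt_le_linear (u c : R) : 0 <= u -> 0 < c ->
  Num.sqrt u <= u / (2 * c) + c / 2.
Proof.
move=> u0 c0; have := sqr_ge0 (Num.sqrt u - c).
rewrite sqrrB sqr_sqrtr// => h.
rewrite -[leLHS]mulr1 -[X in _ * X <= _](@divff _ (2 * c)) ?mulf_neq0 ?gt_eqF//.
rewrite mulrA (_ : _ + c / 2 = (u + c ^+ 2) / (2 * c)); last first.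
  by field; rewrite gt_eqF.
rewrite ler_pM2r ?invr_gt0 ?mulr_gt0//.
by move: h; rewrite -mulr_natl; lra.
Qed.

Lemma quantile_sqrt_le (q : R) : q < 1 -> 0 <= q ->
  (quantile P U q <= (Num.sqrt (b - s * ln (1 - q)))%:E)%E.
Proof.
move=> q1 q0; apply: ereal_inf_lbound => /=.
exists (Num.sqrt (b - s * ln (1 - q))) => //=.
have l0 : s * ln (1 - q) <= 0 by rewrite mulr_ge0_le0 ?(ltW s0)// ln_le0//; lra.
have t0 : 0 <= b - s * ln (1 - q) by rewrite subr_ge0 (le_trans l0)// ltW.
rewrite (_ : [set w | _] = ~` [set w | (b - s * ln (1 - q) < D w)%R]); last first.
  apply/seteqP; split => w /=; rewrite /U ler_sqrt// => h.
    by apply/negP; rewrite -leNgt.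
  by rewrite leNgt; apply/negP.
have mA : measurable [set w | (b - s * ln (1 - q) < D w)%R].
  rewrite -[X in measurable X]setTI (_ : [set w | _] = D @^-1` `]b - s * ln (1 - q), +oo[).
    exact: mD.
  by apply/seteqP; split => w /=; rewrite in_itv/= andbT.
rewrite probability_setC// leeBrDr ?fin_num_measure//.
have h : (P [set w | (b - s * ln (1 - q) < D w)%R] <= (1 - q)%:E)%E.
  apply: le_trans (tail_le _) _; first by lra.
  rewrite (_ : _ / s = ln (1 - q)); last by field; rewrite gt_eqF.
  by rewrite lnK// posrE subr_gt0.
by apply: le_trans (leeD2l _ h) _; rewrite -EFinD addrC subrK.
Qed.

(** The quantile at level [q] is at most [sqrt (b - s * ln (1 - q))].  The root is
    linearised at [c], the value of the bound to be proved, before it is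
    integrated over [q]. *)
Lemma CVaR_sqrt_le (p : R) : 0 <= p < 1 ->
  (CVaR P U p <= (Num.sqrt (b + s * (1 + ln (1 / (1 - p)))))%:E)%E.
Proof.
move=> /andP[p0 p1].
have p1' : 0 < 1 - p by rewrite subr_gt0.
rewrite div1r lnV ?posrE//.
have lp : ln (1 - p) <= 0 by rewrite ln_le0//; lra.
have c20 : 0 < b + s * (1 - ln (1 - p)).
  by rewrite ltr_wpDr// mulr_ge0 ?(ltW s0)//; lra.
set c := Num.sqrt _.
have c0 : 0 < c by rewrite sqrtr_gt0.
have c2 : c ^+ 2 = b + s * (1 - ln (1 - p)) by rewrite sqr_sqrtr ?ltW.
rewrite /CVaR lee_pdivrMl//.
pose g (q : R) : R := (b / (2 * c) + c / 2) + s / (2 * c) * (- ln (1 - q)).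
have mg : measurable_fun setT g.
  apply: measurable_funD => //; apply: measurable_funM => //; exact: measurable_ln1B.
have A0 : 0 <= b / (2 * c) + c / 2.
  by apply: addr_ge0; apply: divr_ge0 => //; rewrite ?mulr_ge0 ?(ltW c0) ?(ltW b0) ?(ltW s0).
have B0 : 0 <= s / (2 * c) by apply: divr_ge0; rewrite ?mulr_ge0 ?(ltW c0) ?(ltW b0) ?(ltW s0).
have f0 (q : R) : 0 <= q -> q < 1 -> 0 <= - ln (1 - q).
  by move=> q0 q1; rewrite oppr_ge0 ln_le0//; lra.
(* the quantile may be infinite at the null point [q = 1] *)
pose G (q : R) : \bar R := if q == 1 then +oo%E else (g q)%:E.
apply: (@le_trans _ _ (\int[lebesgue_measure]_(q in `[p, 1%R]) G q)%E).
  apply: le_integral_nonmeasurable => q /=; rewrite in_itv/= => /andP[pq q1]; rewrite /G.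
    case: eqVneq => // qn1; rewrite lee_fin addr_ge0// mulr_ge0// f0 ?(le_trans p0)//.
    by rewrite lt_neqAle qn1.
  case: eqVneq => [_|qn1]; first by rewrite leey.
  have q1' : q < 1 by rewrite lt_neqAle qn1.
  have q0 : 0 <= q by apply: le_trans pq.
  apply: le_trans (quantile_sqrt_le q1' q0) _; rewrite lee_fin.
  have l0 : s * ln (1 - q) <= 0.
    by rewrite mulr_ge0_le0 ?(ltW s0)// -oppr_ge0 f0.
  apply: le_trans (sqrt_le_linear _ c0) _.
    by rewrite subr_ge0 (le_trans l0)// ltW.
  by rewrite /g; apply: le_of_eq; field; rewrite gt_eqF.
have mG : measurable_fun setT G.
  apply: measurable_fun_if => //.
  - exact: measurable_fun_eqr.
  - exact/measurable_funTS/measurable_EFinP.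
rewrite -integral_itv_bndo_bndc; last exact: measurable_funTS.
apply: (@le_trans _ _ (\int[lebesgue_measure]_(q in `[p, 1%R[)
    ((b / (2 * c) + c / 2)%:E + (s / (2 * c))%:E * (- ln (1 - q))%:E)))%E.
  apply: le_of_eq; apply: eq_integral => q.
  by rewrite inE/= in_itv/= => /andP[_ q1]; rewrite /G lt_eqF// EFinD EFinM.
have mln : measurable_fun `[p, 1%R[ (fun q : R => (- ln (1 - q))%:E).
  by apply/measurable_EFinP/measurable_funTS; exact: measurable_ln1B.
have ln0 (q : R) : `[p, 1%R[%classic q -> (0 <= (- ln (1 - q))%:E)%E.
  by rewrite /= in_itv/= => /andP[pq q1]; rewrite lee_fin f0// (le_trans p0).
have mln2 : measurable_fun `[p, 1%R[
    (fun q : R => (s / (2 * c))%:E * (- ln (1 - q))%:E)%E by exact: emeasurable_funM.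
have ln02 (q : R) : `[p, 1%R[%classic q -> (0 <= (s / (2 * c))%:E * (- ln (1 - q))%:E)%E.
  by move=> qI; rewrite mule_ge0// ?lee_fin//; exact: ln0.
rewrite ge0_integralD//.
rewrite ge0_integralZl_EFin//.
have icst (K : R) : (\int[lebesgue_measure]_(q in `[p, 1%R[) K%:E = K%:E * (1%:E - p%:E))%E.
  by rewrite integral_cst//= lebesgue_measure_itv/= lte_fin p1.
rewrite icst.
apply: (@le_trans _ _ ((b / (2 * c) + c / 2)%:E * (1%:E - p%:E)
   + (s / (2 * c))%:E * ((1 - p) * (1 - ln (1 - p)))%:E)%E).
  by rewrite leeD2l// lee_wpmul2l ?lee_fin//; exact: integral_ln1B_le.
rewrite -EFinB -!EFinM -EFinD lee_fin.
rewrite [leLHS](_ : _ = (1 - p) * ((b + s * (1 - ln (1 - p))) / (2 * c) + c / 2)); last by ring.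
rewrite -c2 (_ : c ^+ 2 / (2 * c) + c / 2 = c)//.
by field; rewrite gt_eqF.
Qed.

(** With [eta * sqrt D <= D / s + eta ^+ 2 * s / 4] the exponential moment of [D]
    bounds that of its root; [eta] is the minimiser of the resulting bound. *)
Lemma EVaR_sqrt_le (p : R) : 0 <= p < 1 ->
  (EVaR P U p <= (Num.sqrt (b + s * ln (1 / (1 - p))))%:E)%E.
Proof.
move=> /andP[p0 p1].
have p1' : 0 < 1 - p by rewrite subr_gt0.
rewrite div1r lnV ?posrE//.
have lp : ln (1 - p) <= 0 by rewrite ln_le0//; lra.
have c20 : 0 < b + s * - ln (1 - p).
  by rewrite ltr_wpDr// mulr_ge0 ?(ltW s0)//; lra.
set c := Num.sqrt _.
have c0 : 0 < c by rewrite sqrtr_gt0.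
have c2 : c ^+ 2 = b + s * - ln (1 - p) by rewrite sqr_sqrtr ?ltW.
pose eta := 2 * c / s.
have eta0 : 0 < eta by rewrite divr_gt0// mulr_gt0.
apply: (@le_trans _ _ ((- (eta^-1 * ln (1 - p)))%:E
                  + (eta^-1)%:E * lne (mmt_gen_fun P U eta))%E).
  by apply: ereal_inf_lbound; exists eta.
have M : (mmt_gen_fun P U eta <= (expR (b / s + eta ^+ 2 * s / 4))%:E)%E.
  rewrite /mmt_gen_fun unlock expRD EFinM.
  apply: (@le_trans _ _ (\int[P]_w (expR (D w / s) * expR (eta ^+ 2 * s / 4))%:E)%E).
    apply: le_integral_ge0.
    - by apply: measurableT_comp => //; exact: measurable_funM.
    - by apply: measurable_funM => //; apply: measurableT_comp => //; exact: measurable_funM.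
    move=> w /=; rewrite expR_ge0/= -expRD ler_expR.
    have es0 : 0 < eta * s / 2 by apply: divr_gt0 => //; apply: mulr_gt0.
    apply: le_trans (ler_wpM2r (ltW eta0) (sqrt_le_linear (D0 w) es0)) _.
    apply: le_of_eq.
    by field; rewrite !gt_eqF.
  under eq_integral do rewrite mulrC EFinM.
  rewrite ge0_integralZl_EFin ?expR_ge0//; last first.
    by apply/measurable_EFinP; apply: measurableT_comp => //; exact: measurable_funM.
  by rewrite muleC lee_wpmul2r// lee_fin expR_ge0.
have M0 : (0 <= mmt_gen_fun P U eta)%E.
  by rewrite /mmt_gen_fun unlock; apply: integral_ge0 => w _; rewrite lee_fin expR_ge0.
have lM : (lne (mmt_gen_fun P U eta) <= (b / s + eta ^+ 2 * s / 4)%:E)%E.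
  by rewrite -[leRHS]expeRK lee_lne ?in_itv/= ?M0 ?leey// lee_fin expR_ge0.
apply: (@le_trans _ _ ((- (eta^-1 * ln (1 - p)))%:E
                  + (eta^-1)%:E * (b / s + eta ^+ 2 * s / 4)%:E)%E).
  by rewrite leeD2l// lee_wpmul2l// lee_fin invr_ge0 ltW.
rewrite -EFinM -EFinD lee_fin; apply: le_of_eq.
rewrite [LHS](_ : _ = (b + s * - ln (1 - p)) / (s * eta) + eta * s / 4); last first.
  by field; rewrite !gt_eqF.
rewrite -c2 /eta; field; rewrite !gt_eqF//.
Qed.

End RiskMeasures.

(** * The chi-square risk measure *)

Section ChiSquare.
Context d (Omega : measurableType d) {R : realType} (P : probability Omega R).

Lemma integral_probability_cst (Q : probability Omega R) (K : R) :
  (\int[Q]_w K%:E = K%:E)%E.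
Proof.
have -> := integral_cst Q measurableT K%:E.
by rewrite -[RHS]mule1; congr (_ * _)%E; exact: probability_setT.
Qed.

(** The Fenchel inequality [x * g <= g * ln g - g + exp x], in which [ln g] is
    replaced by its tangent at [M]; this leaves a square of [g - 1], the quantity
    controlled by the chi-square divergence. *)
Lemma young_chi2 (M g x : R) : 0 < M -> 0 <= g ->
  x * g + (M^-1 + 2 * g) <= M^-1 * (g - 1) ^+ 2 + ((2 / M + ln M) * g + expR x).
Proof.
move=> M0 g0; have [g1|g1] := eqVneq g 0.
  rewrite g1; have := expR_ge0 x; lra.
have gp : 0 < g by rewrite lt_neqAle eq_sym g1.
have h1 : g * (1 + (x - ln g)) <= expR x.
  rewrite -[in leRHS](subrK (ln g) x) expRD lnK ?posrE// mulrC ler_wpM2r//.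
  exact: expR_ge1Dx.
have h2 : g * (ln g - ln M) <= g * (g / M - 1).
  rewrite ler_wpM2l// -ln_div ?posrE//.
  have := expR_ge1Dx (ln (g / M)); rewrite lnK ?posrE ?divr_gt0//; lra.
rewrite (_ : M^-1 * (g - 1) ^+ 2 = g * (g / M) - 2 / M * g + M^-1); last by ring.
by rewrite !mulrDr in h1 h2; lra.
Qed.

Variables (D : Omega -> R) (b s : R).
Hypothesis mD : measurable_fun setT D.
Hypothesis D0 : forall w, 0 <= D w.
Hypothesis b0 : 0 < b.
Hypothesis s0 : 0 < s.
Hypothesis mgfD : (\int[P]_w (expR (D w / s))%:E <= (expR (b / s))%:E)%E.

(** The tangent point in [young_chi2] is [M = 1 + 2 * r], the largest possible
    value of the second moment of the density [g]. *)
Lemma expectation_chi2_le (Q : probability Omega R) (r : R) : 0 < r ->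
  Q `<< P -> (chi2_div P Q <= r%:E)%E ->
  (\int[Q]_w (D w)%:E <= (b + s * ln (1 + 2 * r))%:E)%E.
Proof.
move=> r0 QP chi.
pose phi := Radon_Nikodym_SigmaFinite.f Q P.
have phi0 w : (0 <= phi w)%E by exact: Radon_Nikodym_SigmaFinite.f_ge0.
have phif w : phi w \is a fin_num by exact: Radon_Nikodym_SigmaFinite.f_fin_num.
have iphi : P.-integrable setT phi by exact: Radon_Nikodym_SigmaFinite.f_integrable.
have mphi : measurable_fun setT phi by exact: measurable_int iphi.
pose g w := fine (phi w).
have gE w : phi w = (g w)%:E by rewrite fineK.
have g0 w : 0 <= g w by rewrite -lee_fin -gE.
have mg : measurable_fun setT g by exact: measurableT_comp.
have Ig : (\int[P]_w (g w)%:E = 1)%E.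
  under eq_integral do rewrite -gE.
  rewrite -(Radon_Nikodym_SigmaFinite.f_integral QP measurableT).
  exact: probability_setT.
have ID : (\int[Q]_w (D w)%:E = \int[P]_w (D w * g w)%:E)%E.
  rewrite -(Radon_Nikodym_SigmaFinite.change_of_variables QP)//; last first.
    exact/measurable_EFinP.
  by apply: eq_integral => w _; rewrite -/phi gE.
have Ichi : (\int[P]_w ((g w - 1) ^+ 2)%:E <= (2 * r)%:E)%E.
  move: chi; rewrite /chi2_div => chi.
  rewrite EFinM -lee_pdivrMl// -[X in (X%:E * _)%E]/(2^-1).
  rewrite -ge0_integralZl_EFin//; last 2 first.
  - by move=> w _; rewrite lee_fin sqr_ge0.
  - apply/measurable_EFinP; apply: measurable_funX.
    by apply: measurable_funB.
  apply: le_trans chi; apply: le_of_eq.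
  have QP' : charge_of_finite_measure Q `<< P by exact: QP.
  have mRN : measurable_fun setT (Radon_Nikodym (charge_of_finite_measure Q) P).
    exact: (measurable_int P (Radon_Nikodym_integrable QP')).
  have RNf w : Radon_Nikodym (charge_of_finite_measure Q) P w \is a fin_num.
    exact: Radon_Nikodym_fin_num.
  apply: ae_eq_integral => //.
  - apply/measurable_EFinP; apply: measurable_funM => //; apply: measurable_funX.
    by apply: measurable_funB.
  - apply: emeasurable_funM => //.
    rewrite (_ : (fun w => _) = fun w =>
      ((fine (Radon_Nikodym (charge_of_finite_measure Q) P w) - 1) ^+ 2)%:E).
      apply/measurable_EFinP; apply: measurable_funX; apply: measurable_funB => //.
      exact: measurableT_comp.
    by apply/funext => w; rewrite -{1}(fineK (RNf w)).
  have := ae_eq_Radon_Nikodym_SigmaFinite QP measurableT.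
  apply: filterS => w /= /(_ I) h _.
  by rewrite -h -/phi gE EFinM.
pose M := 1 + 2 * r.
have M0 : 0 < M by rewrite /M; lra.
have lM : 0 <= ln M by rewrite ln_ge0// /M; lra.
have mE : measurable_fun setT (fun w => expR (D w / s - b / s)).
  by apply: measurableT_comp => //; apply: measurable_funB => //; exact: measurable_funM.
have mDg : measurable_fun setT (fun w => D w * g w) by exact: measurable_funM.
have Dg0 w : 0 <= D w * g w by rewrite mulr_ge0.
have IE : (\int[P]_w (expR (D w / s - b / s))%:E <= 1)%E.
  under eq_integral do rewrite expRD mulrC EFinM.
  rewrite ge0_integralZl_EFin ?expR_ge0//; last first.
    by apply/measurable_EFinP; apply: measurableT_comp => //; exact: measurable_funM.
  apply: (@le_trans _ _ ((expR (- (b / s)))%:E * (expR (b / s))%:E)%E).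
    by rewrite lee_wpmul2l// lee_fin expR_ge0.
  by rewrite -EFinM -expRD addNr expR0.
pose K := 2 / M + ln M + b / s.
have bs0 : 0 <= b / s by apply: divr_ge0; exact: ltW.
have M20 : 0 <= 2 / M by apply: divr_ge0 => //; exact: ltW.
have K0 : 0 <= K by rewrite !addr_ge0.
have key : (\int[P]_w (s^-1 * (D w * g w) + (M^-1 + 2 * g w))%:E
    <= \int[P]_w (M^-1 * (g w - 1) ^+ 2 + (K * g w + expR (D w / s - b / s)))%:E)%E.
  apply: le_integral_ge0.
  - apply: measurable_funD; first exact: measurable_funM.
    by apply: measurable_funD => //; exact: measurable_funM.
  - apply: measurable_funD.
      by apply: measurable_funM => //; apply: measurable_funX; exact: measurable_funB.
    by apply: measurable_funD => //; exact: measurable_funM.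
  move=> w; apply/andP; split.
    apply: addr_ge0; first by apply: mulr_ge0 => //; rewrite invr_ge0 ltW.
    by apply: addr_ge0; rewrite ?invr_ge0 ?(ltW M0)// mulr_ge0.
  have := young_chi2 (D w / s - b / s) M0 (g0 w).
  by rewrite /K; lra.
move: key.
rewrite integral_ge0D//; last 4 first.
- exact: measurable_funM.
- by apply: measurable_funD => //; exact: measurable_funM.
- by move=> w; apply: mulr_ge0 => //; rewrite invr_ge0 ltW.
- by move=> w; apply: addr_ge0; rewrite ?invr_ge0 ?(ltW M0)// mulr_ge0.
rewrite (@integral_ge0D _ _ _ P (fun=> M^-1))//; last 3 first.
- exact: measurable_funM.
- by move=> w; rewrite invr_ge0 ltW.
- by move=> w; rewrite mulr_ge0.
rewrite integral_ge0D//; last 4 first.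
- by apply: measurable_funM => //; apply: measurable_funX; exact: measurable_funB.
- by apply: measurable_funD => //; exact: measurable_funM.
- by move=> w; rewrite mulr_ge0 ?sqr_ge0 ?invr_ge0 ?ltW.
- by move=> w; apply: addr_ge0; rewrite ?expR_ge0// mulr_ge0.
rewrite (@integral_ge0D _ _ _ P (fun w => K * g w))//; last 2 first.
- exact: measurable_funM.
- by move=> w; rewrite mulr_ge0.
have Zl (a : R) (f : Omega -> R) : 0 <= a -> measurable_fun setT f ->
    (forall w, 0 <= f w) ->
    (\int[P]_w (a * f w)%:E = a%:E * \int[P]_w (f w)%:E)%E.
  move=> a0 mf f0; under eq_integral do rewrite EFinM.
  rewrite ge0_integralZl_EFin//; first by move=> w _; rewrite lee_fin.
  exact/measurable_EFinP.
have mg2 : measurable_fun setT (fun w => (g w - 1) ^+ 2).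
  by apply: measurable_funX; exact: measurable_funB.
have Mi0 : 0 <= M^-1 by rewrite invr_ge0 ltW.
have si0 : 0 <= s^-1 by rewrite invr_ge0 ltW.
rewrite !Zl//; last by move=> w; rewrite sqr_ge0.
rewrite Ig !mule1 -ID.
rewrite (integral_probability_cst P).
move=> key.
have {}key : ((s^-1)%:E * \int[Q]_w (D w)%:E + (M^-1 + 2)%:E
    <= (M^-1 * (2 * r) + (K + 1))%:E)%E.
  rewrite (EFinD M^-1 2); apply: le_trans key _.
  rewrite (EFinD (M^-1 * (2 * r))) (EFinM M^-1) (EFinD K 1).
  apply: leeD; first by rewrite lee_wpmul2l.
  by rewrite leeD2l.
have : ((s^-1)%:E * \int[Q]_w (D w)%:E <= (M^-1 * (2 * r) + (K + 1) - (M^-1 + 2))%:E)%E.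
  by rewrite EFinB leeBrDr.
rewrite (_ : M^-1 * (2 * r) + (K + 1) - (M^-1 + 2) = s^-1 * (b + s * ln M)); last first.
  by rewrite /K /M; field; rewrite !gt_eqF//.
by rewrite EFinM lee_pmul2l// lte_fin invr_gt0.
Qed.

Lemma chi2_risk_sqrt_le (r : R) : 0 < r ->
  (chi2_risk P (fun w => Num.sqrt (D w)) r
     <= (Num.sqrt (b + s * ln (1 + 2 * r)))%:E)%E.
Proof.
move=> r0; apply: ge_ereal_sup => _ [Q [QP chi] <-].
have lM : 0 <= ln (1 + 2 * r) by rewrite ln_ge0//; lra.
have c20 : 0 < b + s * ln (1 + 2 * r).
  by rewrite ltr_wpDr// mulr_ge0 ?(ltW s0).
set c := Num.sqrt _.
have c0 : 0 < c by rewrite sqrtr_gt0.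
have c2 : c ^+ 2 = b + s * ln (1 + 2 * r) by rewrite sqr_sqrtr ?ltW.
rewrite unlock.
have c20' : 0 <= (2 * c)^-1 by rewrite invr_ge0 mulr_ge0// ltW.
apply: (@le_trans _ _ (\int[Q]_w ((2 * c)^-1 * D w + c / 2)%:E)%E).
  apply: le_integral_ge0.
  - by apply: measurableT_comp => //; apply: continuous_measurable_fun; exact: sqrt_continuous.
  - by apply: measurable_funD => //; exact: measurable_funM.
  move=> w; rewrite sqrtr_ge0/=; apply: le_trans (sqrt_le_linear (D0 w) c0) _.
  by rewrite mulrC.
rewrite integral_ge0D//; last 3 first.
- exact: measurable_funM.
- by move=> w; rewrite mulr_ge0.
- by move=> w; rewrite divr_ge0 ?ltW.
under eq_integral do rewrite EFinM.
rewrite ge0_integralZl_EFin//; last exact/measurable_EFinP.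
  2: by move=> w _; rewrite lee_fin.
rewrite (integral_probability_cst Q).
apply: (@le_trans _ _ (((2 * c)^-1)%:E * (b + s * ln (1 + 2 * r))%:E + (c / 2)%:E)%E).
  by rewrite leeD2r// lee_wpmul2l//; exact: expectation_chi2_le.
rewrite -EFinM -EFinD lee_fin -c2; apply: le_of_eq.
by field; rewrite gt_eqF.
Qed.

End ChiSquare.

(** * Gradients of convex functions *)

Section Calculus.
Context {R : realType}.

(** Only one-sided information on the increments is available, because the
    segment may leave the domain on the other side. *)
Lemma slope_le (phi : R -> R) (d c : R) :
  is_derive (0 : R) (1 : R) phi d ->
  (forall t, 0 < t < 1 -> phi t - phi 0 <= t * c) -> d <= c.
Proof.
move=> [dphi <-] phic; rewrite leNgt; apply/negP => cd.
have := dphi; rewrite /derivable => /cvgrPdist_lt /(_ ('D_1 phi 0 - c)).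
rewrite subr_gt0 => /(_ cd) [e /= e0 he].
pose t := Num.min (e / 2) 2^-1.
have t0 : 0 < t by rewrite lt_min divr_gt0//= invr_gt0.
have t1 : t < 1 by rewrite gt_min; apply/orP; right; lra.
have te : t < e by rewrite gt_min; apply/orP; left; lra.
have := he t; rewrite /= sub0r normrN gtr0_norm// => /(_ te).
rewrite gt_eqF// => /(_ isT).
rewrite -/(derive _ _ _) /= [t%:A]mulr1 addr0.
have := phic t; rewrite t0 t1 => /(_ isT) h.
have h2 : t^-1 *: (phi t - phi 0) <= c.
  by rewrite [_ *: _]mulrC ler_pdivrMr// mulrC.
by move=> /ltr_normlW; lra.
Qed.

Lemma slope_ge (phi : R -> R) (d c : R) :
  is_derive (0 : R) (1 : R) phi d ->
  (forall t, 0 < t < 1 -> t * c <= phi t - phi 0) -> c <= d.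
Proof.
move=> dphi phic; rewrite -lerN2.
have D : is_derive (0 : R) (1 : R) (fun t => - phi t) (- d) by exact: is_deriveN.
apply: (slope_le D) => t t01.
by rewrite mulrN -opprD lerN2 phic.
Qed.

Lemma is_derive_line (V : normedModType R) (F : V -> R^o) (z v : V) (t : R) :
  differentiable F (z + t *: v) ->
  is_derive t (1 : R) (fun s : R => F (z + s *: v) : R) ('D_v F (z + t *: v)).
Proof.
move=> dF.
have E : (fun h : R => h^-1 *: (((fun s : R => F (z + s *: v) : R) \o shift t) (h *: (1 : R)) - F (z + t *: v) : R))
  = (fun h : R => h^-1 *: ((F \o shift (z + t *: v)) (h *: v) - F (z + t *: v))).
  apply/funext => h /=; congr (_ *: (F _ - _)).
  by rewrite [h%:A]mulr1 scalerDl addrCA.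
split; rewrite /derivable /derive E//.
exact: diff_derivable.
Qed.

(** The gradient is defined by partial derivatives; it represents the directional
    derivatives as soon as these are linear in the direction. *)
Lemma dot_grad k (h : 'rV[R]_k -> R) (a : 'rV[R]_k) (L : 'rV[R]_k -> R) :
  (forall v, derive (h : 'rV[R]_k -> R^o) a v = L v) ->
  (forall u v, L (u + v) = L u + L v) -> (forall c u, L (c *: u) = c * L u) ->
  forall v, dot (grad h a) v = L v.
Proof.
move=> dh LD LZ v; rewrite /dot.
have L0 : L 0 = 0 by rewrite -(scale0r 0) LZ mul0r.
rewrite [in RHS](row_sum_delta v) (big_morph L LD L0).
by apply: eq_bigr => i _; rewrite LZ mxE dh mulrC.
Qed.

Section Joint.
Variables (m n : nat) (Phi : 'rV[R]_m -> 'rV[R]_n -> R).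
Let F : 'rV[R]_m * 'rV[R]_n -> R^o := fun z => Phi z.1 z.2.

Lemma derive_fst x y v :
  derive (fun u => Phi u y : R^o) x v = derive F (x, y) (v, 0).
Proof.
rewrite /derive; set g1 := fun h : R => _; set g2 := fun h : R => _.
suff -> : g1 = g2 by [].
by apply/funext => h; rewrite /g1 /g2 /F /= scaler0 add0r.
Qed.

Lemma derive_snd x y v :
  derive (fun u => Phi x u : R^o) y v = derive F (x, y) (0, v).
Proof.
rewrite /derive; set g1 := fun h : R => _; set g2 := fun h : R => _.
suff -> : g1 = g2 by [].
by apply/funext => h; rewrite /g1 /g2 /F /= scaler0 add0r.
Qed.

Lemma dot_grad_x x y v : differentiable F (x, y) ->
  dot (grad_x Phi x y) v = derive F (x, y) (v, 0).
Proof.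
move=> dF; apply: (@dot_grad m (fun u => Phi u y) x (fun v => derive F (x, y) (v, 0))) => [u|u u'|c u].
- exact: derive_fst.
- rewrite !deriveE// -linearD; congr ('d F _ _).
  by apply: injective_projections => //=; rewrite addr0.
- rewrite !deriveE// -[RHS]/(c *: _) -linearZ; congr ('d F _ _).
  by apply: injective_projections => //=; rewrite scaler0.
Qed.

Lemma dot_grad_y x y v : differentiable F (x, y) ->
  dot (grad_y Phi x y) v = derive F (x, y) (0, v).
Proof.
move=> dF; apply: (@dot_grad n (fun u => Phi x u) y (fun v => derive F (x, y) (0, v))) => [u|u u'|c u].
- exact: derive_snd.
- rewrite !deriveE// -linearD; congr ('d F _ _).
  by apply: injective_projections => //=; rewrite addr0.
- rewrite !deriveE// -[RHS]/(c *: _) -linearZ; congr ('d F _ _).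
  by apply: injective_projections => //=; rewrite scaler0.
Qed.

Lemma is_derive_x x y v t : differentiable F (x + t *: v, y) ->
  is_derive t (1 : R) (fun s : R => Phi (x + s *: v) y)
    (dot (grad_x Phi (x + t *: v) y) v).
Proof.
move=> dF; rewrite dot_grad_x//.
have E : ((x, y) : 'rV[R]_m * 'rV[R]_n) + t *: (v, 0) = (x + t *: v, y).
  by apply: injective_projections => //=; rewrite scaler0 addr0.
have := @is_derive_line _ F (x, y) (v, 0) t; rewrite E => /(_ dF).
congr (is_derive _ _ _ _); apply/funext => s.
by rewrite /F /= scaler0 addr0.
Qed.

Lemma is_derive_y x y v t : differentiable F (x, y + t *: v) ->
  is_derive t (1 : R) (fun s : R => Phi x (y + s *: v))
    (dot (grad_y Phi x (y + t *: v)) v).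
Proof.
move=> dF; rewrite dot_grad_y//.
have E : ((x, y) : 'rV[R]_m * 'rV[R]_n) + t *: (0, v) = (x, y + t *: v).
  by apply: injective_projections => //=; rewrite scaler0 addr0.
have := @is_derive_line _ F (x, y) (0, v) t; rewrite E => /(_ dF).
congr (is_derive _ _ _ _); apply/funext => s.
by rewrite /F /= scaler0 addr0.
Qed.

End Joint.

Section Convex.
Variables (k : nat) (C : set 'rV[R]_k) (h : 'rV[R]_k -> R) (p : 'rV[R]_k -> 'rV[R]_k).
Hypothesis convC : forall a b (t : R), C a -> C b -> 0 <= t <= 1 -> C (a + t *: (b - a)).
Hypothesis gradh : forall a v (t : R), C (a + t *: v) ->
  is_derive t (1 : R) (fun s : R => h (a + s *: v)) (dot (p (a + t *: v)) v).
Hypothesis convh : forall a b (t : R), C a -> C b -> 0 < t < 1 ->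
  h (a + t *: (b - a)) <= (1 - t) * h a + t * h b.

Lemma convex_gradient_le a b : C a -> C b -> h a + dot (p a) (b - a) <= h b.
Proof.
move=> Ca Cb; rewrite -lerBrDl.
have := @gradh a (b - a) 0; rewrite scale0r addr0 => /(_ Ca) D.
apply: (slope_le D) => t t01.
rewrite scale0r addr0; have := convh Ca Cb t01; lra.
Qed.

(** The difference of the two sides along the segment has a nonpositive
    derivative. *)
Lemma descent_le (L : R) a b : C a -> C b -> 0 <= L ->
  (forall u v, C u -> C v -> enorm (p u - p v) <= L * enorm (u - v)) ->
  h b <= h a + dot (p a) (b - a) + L / 2 * enorm (b - a) ^+ 2.
Proof.
move=> Ca Cb L0 lipp.
pose v := b - a.
pose psi (t : R) := h (a + t *: v) - (dot (p a) v * t + L / 2 * enorm v ^+ 2 * t ^+ 2).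
pose dpsi (t : R) := dot (p (a + t *: v)) v - (dot (p a) v + L * enorm v ^+ 2 * t).
have Dpsi (t : R) : 0 <= t <= 1 -> is_derive t 1 psi (dpsi t).
  move=> t01; apply: is_deriveB; first exact/gradh/convC.
  apply: is_derive_eq; rewrite /GRing.scale/=.
  by field.
have [c c01 E] : exists2 c, c \in `]0, 1[%R & psi 1 - psi 0 = dpsi c * (1 - 0).
  apply: MVT => // [t|].
    by rewrite in_itv/= => /andP[t0 t1]; apply: Dpsi; rewrite !ltW.
  apply: derivable_within_continuous => t; rewrite in_itv/= => t01.
  by have [] := Dpsi t t01.
move: c01; rewrite in_itv/= => /andP[c0 c1].
have dc : dpsi c <= 0.
  rewrite /dpsi opprD addrA -dotBl subr_le0.
  apply: le_trans (dot_le_enorm _ _) _.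
  have Cc : C (a + c *: v) by apply: convC => //; rewrite !ltW.
  have := lipp _ _ Cc Ca; rewrite addrAC subrr add0r enormZ gtr0_norm// => h1.
  apply: le_trans (ler_wpM2r (enorm_ge0 _) h1) _.
  by apply: le_of_eq; ring.
have : psi 1 - psi 0 <= 0 by rewrite E subr0 mulr1.
rewrite /psi scale1r scale0r addr0 (_ : a + v = b); last by rewrite /v addrC subrK.
by rewrite expr1n expr0n/= /v; lra.
Qed.

End Convex.

End Calculus.

(** * Proximal points of strongly convex functions *)

Section Prox.
Context {R : realType} {k : nat}.
Variables (f : 'rV[R]_k -> \bar R) (mu tau : R).
Hypothesis f_ninfty : forall x, f x != -oo%E.
Hypothesis f_closed : closed_fun f.
Hypothesis f_sconvex : strongly_convex mu f.
Hypothesis mu0 : 0 < mu.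
Hypothesis tau0 : 0 < tau.
Local Notation ff x := (fine (f x)).
Local Notation tf := (fun u => (tau%:E * f u)%E).

Lemma domE x : dom f x -> f x = (ff x)%:E.
Proof.
rewrite /dom /= => fx; rewrite fineK// fin_numE f_ninfty/=.
by rewrite lt_eqF.
Qed.

Lemma dom_le x (r : R) : (f x <= r%:E)%E -> dom f x.
Proof. by move=> h; rewrite /dom /=; apply: le_lt_trans h _; rewrite ltry. Qed.

Lemma not_dom x : ~ dom f x -> f x = +oo%E.
Proof. by rewrite /dom /= => /negP; rewrite -leNgt leye_eq => /eqP. Qed.

Lemma strongly_convex_fine a b (t : R) : dom f a -> dom f b -> 0 < t < 1 ->
  dom f (a + t *: (b - a)) /\
  ff (a + t *: (b - a)) + mu / 2 * (t * (1 - t)) * enorm (b - a) ^+ 2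
    <= (1 - t) * ff a + t * ff b.
Proof.
move=> da db t01; have := f_sconvex b a t01.
rewrite (domE da) (domE db) -!EFinM -EFinD.
rewrite (_ : t *: b + (1 - t) *: a = a + t *: (b - a)); last first.
  by rewrite scalerBl scalerBr scale1r addrC addrAC -addrA.
have [dt|/not_dom ->] := pselect (dom f (a + t *: (b - a))); last first.
  by rewrite addye// leye_eq.
rewrite (domE dt) -EFinD lee_fin => h; split => //.
by rewrite addrC [leRHS]addrC addrC.
Qed.

Lemma dom_convex a b (t : R) : dom f a -> dom f b -> 0 <= t <= 1 ->
  dom f (a + t *: (b - a)).
Proof.
move=> da db /andP[t0 t1].
have [->|tn0] := eqVneq t 0; first by rewrite scale0r addr0.
have [->|tn1] := eqVneq t 1; first by rewrite scale1r addrC subrK.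
have [] // := @strongly_convex_fine a b t da db.
by rewrite !lt_neqAle eq_sym tn0 tn1 t0 t1.
Qed.

Lemma fine_convex a b (t : R) : dom f a -> dom f b -> 0 < t < 1 ->
  ff (a + t *: (b - a)) <= (1 - t) * ff a + t * ff b.
Proof.
move=> da db t01; have [_ h] := strongly_convex_fine da db t01.
apply: le_trans h; rewrite lerDl.
case/andP: t01 => t0 t1.
rewrite mulr_ge0 ?sqr_ge0// mulr_ge0 ?divr_ge0 ?ltW// mulr_gt0//.
by rewrite subr_gt0.
Qed.

Definition prox_obj z u : R := tau * ff u + 2^-1 * enorm (u - z) ^+ 2.

Lemma prox_objE z u : dom f u ->
  (tau%:E * f u + (2^-1 * enorm (u - z) ^+ 2)%:E = (prox_obj z u)%:E)%E.
Proof. by move=> du; rewrite (domE du) -EFinM -EFinD. Qed.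

Lemma prox_intro z u : dom f u ->
  (forall v, dom f v -> prox_obj z u <= prox_obj z v) -> prox tf z u.
Proof.
move=> du hu v /=; rewrite prox_objE//.
have [dv|/not_dom ->] := pselect (dom f v); first by rewrite prox_objE// lee_fin hu.
by rewrite gt0_muley ?lte_fin// addye// leey.
Qed.

Lemma enorm_convex (a b z : 'rV[R]_k) (t : R) :
  enorm (a + t *: (b - a) - z) ^+ 2 =
  (1 - t) * enorm (a - z) ^+ 2 + t * enorm (b - z) ^+ 2
   - t * (1 - t) * enorm (b - a) ^+ 2.
Proof.
have key (A B : 'rV[R]_k) : enorm (A + t *: (B - A)) ^+ 2 =
    (1 - t) * enorm A ^+ 2 + t * enorm B ^+ 2 - t * (1 - t) * enorm (B - A) ^+ 2.
  by rewrite !enorm_sqr !dotE (dotC B A); ring.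
have E : (b - z) - (a - z) = b - a by rewrite opprB addrA subrK.
by have := key (a - z) (b - z); rewrite E addrAC.
Qed.

(** The square in the proximal problem adds 1 to the modulus [tau * mu]. *)
Lemma prox_obj_convex z a b (t : R) : dom f a -> dom f b -> 0 < t < 1 ->
  prox_obj z (a + t *: (b - a)) + (1 + tau * mu) / 2 * (t * (1 - t)) * enorm (b - a) ^+ 2
  <= (1 - t) * prox_obj z a + t * prox_obj z b.
Proof.
move=> da db t01; have [_ /(ler_wpM2l (ltW tau0)) h] := strongly_convex_fine da db t01.
by rewrite /prox_obj enorm_convex; lra.
Qed.

Lemma prox_dom x0 z u : dom f x0 -> prox tf z u -> dom f u.
Proof.
move=> d0 /(_ x0) /=; rewrite (prox_objE z d0).
have [//|/not_dom ->] := pselect (dom f u).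
by rewrite gt0_muley ?lte_fin// addye.
Qed.

(** The convexity inequality of the objective between [u] and [v] is divided by
    the step [t], which then tends to 0. *)
Lemma prox_strong x0 z u v : dom f x0 -> prox tf z u -> dom f v ->
  prox_obj z u + (1 + tau * mu) / 2 * enorm (v - u) ^+ 2 <= prox_obj z v.
Proof.
move=> d0 pu dv; have du := prox_dom d0 pu.
have min w : dom f w -> prox_obj z u <= prox_obj z w.
  by move=> dw; have := pu w; rewrite /= !prox_objE// lee_fin.
rewrite -lerBrDl.
set c := _ * _; set d := prox_obj z v - prox_obj z u.
have key (t : R) : 0 < t < 1 -> c * (1 - t) <= d.
  move=> t01; case/andP: (t01) => t0 t1.
  have [dt _] := strongly_convex_fine du dv t01.
  have := prox_obj_convex z du dv t01; have := min _ dt.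
  move=> h1 h2; rewrite -(ler_pM2l t0) /c /d; lra.
apply/ler_addgt0Pr => e e0.
have c0 : 0 <= c.
  by rewrite mulr_ge0 ?sqr_ge0// divr_ge0// addr_ge0// mulr_ge0 ?ltW.
pose t := e / (2 * (c + e)).
have ce : 0 < c + e by lra.
have t0 : 0 < t by rewrite divr_gt0// mulr_gt0.
have t1 : t < 1 by rewrite ltr_pdivrMr ?mulr_gt0//; lra.
have := key t; rewrite t0 t1 => /(_ isT).
have : c * t <= e.
  rewrite mulrA ler_pdivrMr ?mulr_gt0//; nra.
lra.
Qed.

(** Both strong minimality inequalities are added; the factor [1 + tau * mu] is the
    source of the denominators in the constants. *)
Lemma prox_lipschitz x0 z z' u u' : dom f x0 -> prox tf z u -> prox tf z' u' ->
  (1 + tau * mu) * enorm (u - u') <= enorm (z - z').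
Proof.
move=> d0 pu pu'.
have du := prox_dom d0 pu; have du' := prox_dom d0 pu'.
have h1 := prox_strong d0 pu du'; have h2 := prox_strong d0 pu' du.
have [e0|e0] := eqVneq (enorm (u - u')) 0; first by rewrite e0 mulr0 enorm_ge0.
have ep : 0 < enorm (u - u') by rewrite lt_neqAle eq_sym e0 enorm_ge0.
rewrite -(ler_pM2r ep) -mulrA -expr2.
apply: le_trans (dot_le_enorm _ _).
move: h1 h2; rewrite /prox_obj (enormC u' u) !enorm_sqr !dotE.
rewrite (dotC u' u) (dotC z u) (dotC z u') (dotC z' u) (dotC z' u'); lra.
Qed.

(** The affine minorant makes the objective bounded below.  A minimising sequence
    is Cauchy by strong convexity, and the closed epigraph contains the limit. *)
Lemma prox_exists x0 (c : R) p z : dom f x0 ->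
  (forall v, dom f v -> c + dot p v <= ff v) -> exists u, prox tf z u.
Proof.
move=> d0 minor.
pose S := [set prox_obj z v | v in dom f].
have lbS : has_lbound S.
  exists (tau * (c + dot p z) - 2^-1 * (tau ^+ 2 * enorm p ^+ 2)) => _ [v dv <-].
  have := ler_wpM2l (ltW tau0) (minor v dv).
  have := sqr_ge0 (enorm (v - z + tau *: p)).
  rewrite /prox_obj !enorm_sqr !dotE (dotC v z) (dotC p v) (dotC p z).
  lra.
have infS : has_inf S by split => //; exists (prox_obj z x0); exists x0.
pose m := inf S.
have mS v : dom f v -> m <= prox_obj z v by move=> dv; apply: ge_inf => //; exists v.
have /choice[v vP] : forall i : nat, exists v, dom f v /\ prox_obj z v < m + i.+1%:R^-1.
  move=> i; have [|_ [w dw <-] h] := @inf_adherent _ S i.+1%:R^-1 _ infS.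
    by rewrite invr_gt0.
  by exists w.
have dv i : dom f (v i) by case: (vP i).
have vm i : prox_obj z (v i) < m + i.+1%:R^-1 by case: (vP i).
have near_v i j : enorm (v j - v i) ^+ 2 <= 4 * (i.+1%:R^-1 + j.+1%:R^-1).
  have h12 : 0 < (2^-1 : R) < 1 by apply/andP; split; lra.
  have [dw _] := strongly_convex_fine (dv i) (dv j) h12.
  have := prox_obj_convex z (dv i) (dv j) h12.
  have := mS _ dw; have := vm i; have := vm j.
  have : 0 <= tau * mu * enorm (v j - v i) ^+ 2.
    by rewrite mulr_ge0 ?sqr_ge0// mulr_ge0 ?ltW.
  set e := enorm (v j - v i) ^+ 2; set wm := v i + _.
  move: (prox_obj z wm) (prox_obj z (v i)) (prox_obj z (v j)) (i.+1%:R^-1) (j.+1%:R^-1).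
  move=> H1 H2 H3 x1 x2; lra.
have close (e : R) : 0 < e -> exists N, forall i, (N <= i)%N -> enorm (v i - v N) < e.
  move=> e0; exists (Num.truncn (8 / e ^+ 2)) => i Ni.
  set N := Num.truncn _ in Ni *.
  rewrite -(ltr_pXn2r (n := 2)) ?nnegrE ?enorm_ge0 ?(ltW e0)//.
  apply: le_lt_trans (near_v N i) _.
  have e20 : 0 < e ^+ 2 by rewrite exprn_gt0.
  have h : 8 / e ^+ 2 < N.+1%:R by exact: truncnS_gt.
  have N0 : 0 < N.+1%:R :> R by rewrite ltr0n.
  have hi : i.+1%:R^-1 <= N.+1%:R^-1 :> R by rewrite lef_pV2 ?posrE ?ltr0n// ler_nat.
  have : 8 * N.+1%:R^-1 < e ^+ 2.
    by rewrite ltr_pdivrMr// mulrC -ltr_pdivrMr.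
  by move: hi; move: (N.+1%:R^-1) (i.+1%:R^-1) => x1 x2; lra.
have cv : cvgn v.
  apply: cauchy_cvg; apply: cauchy_exP => e e0.
  have [N hN] := close e e0; exists (v N).
  exists N => // i /= Ni; split => // a b.
  rewrite (ord1 a) /ball /= distrC.
  have -> : v i 0 b - v N 0 b = (v i - v N) 0 b by rewrite !mxE.
  exact: le_lt_trans (enorm_coord _ _) (hN i Ni).
pose u := limn v.
have vu (e : R) : 0 < e -> \forall i \near \oo, enorm (v i - u) < e.
  move=> e0.
  have ek : 0 < e / k.+1%:R by rewrite divr_gt0.
  have /cvg_ballP /(_ _ ek) : v @ \oo --> u by [].
  apply: filterS => i /= [_ hb].
  apply: le_lt_trans (enorm_le_sum _) _.
  apply: (@le_lt_trans _ _ (\sum_(b < k) e / k.+1%:R)).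
    apply: ler_sum => b _; rewrite !mxE distrC.
    by have := hb 0 b; rewrite /ball /= => /ltW.
  rewrite sumr_const card_ord -[ltLHS]mulr_natr -mulrA gtr_pMr//.
  by rewrite mulrC ltr_pdivrMr// mul1r ltr_nat.
have en : enorm (v i - z) @[i --> \oo] --> enorm (u - z).
  apply/cvgrPdist_lt => e e0; have := vu e e0; apply: filterS => i.
  apply: le_lt_trans; rewrite ler_norml; apply/andP; split.
    rewrite lerBrDl lerBlDr.
    apply: le_trans (enorm_triangle u (v i) z) _; by rewrite addrC.
  rewrite lerBlDr (enormC (v i) u).
  exact: enorm_triangle.
have ob : prox_obj z (v i) @[i --> \oo] --> m.
  apply/cvgrPdist_lt => e e0.
  exists (Num.truncn e^-1) => // i /= Ni.
  rewrite distrC ger0_norm ?subr_ge0 ?mS// ltrBlDl.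
  apply: lt_trans (vm i) _; rewrite ltrD2l.
  rewrite -[ltRHS]invrK ltf_pV2 ?posrE ?invr_gt0// ?ltr0n//.
  by apply: lt_le_trans (truncnS_gt _) _; rewrite ler_nat ltnS.
pose r := tau^-1 * (m - 2^-1 * enorm (u - z) ^+ 2).
have rv : (ff (v i) : R^o) @[i --> \oo] --> (r : R^o).
  rewrite (_ : (fun i => _) = fun i => tau^-1 * (prox_obj z (v i) - 2^-1 * enorm (v i - z) ^+ 2)).
    apply: cvgMr; apply: cvgB => //; apply: cvgMr.
    rewrite expr2; under eq_fun do rewrite expr2.
    exact: cvgM.
  by apply/funext => i; rewrite /prox_obj; field; rewrite gt_eqF.
have fu : (f u <= r%:E)%E.
  have := @closed_cvg _ _ \oo _ (fun i => (v i, ff (v i) : R^o)) _ f_closed.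
  move=> h; apply: (h _ _ (u, r)) => /=.
    by apply: nearW => i /=; rewrite -domE.
  have cvu : v @ \oo --> u by exact: cv.
  by apply: (@cvg_pair _ _ _ \oo (nbhs u) (nbhs (r : R^o)) _ _ _ v (fun i => ff (v i))).
have du := dom_le fu.
exists u; apply: prox_intro => // w dw.
apply: le_trans (mS w dw).
move: fu; rewrite (domE du) lee_fin => fu.
rewrite /prox_obj; have := ler_wpM2l (ltW tau0) fu.
rewrite /r mulVKf ?gt_eqF//; lra.
Qed.

End Prox.

(** * First-order inequalities at the saddle point *)

Section ProblemFacts.
Context {R : realType} {m n : nat} (c : params R).
Context (f : 'rV[R]_m -> \bar R) (g : 'rV[R]_n -> \bar R).
Context (Phi : 'rV[R]_m -> 'rV[R]_n -> R).
Hypothesis Hpb : problem_assumption c f g Phi.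
Variables (xs x0 : 'rV[R]_m) (ys y0 : 'rV[R]_n).
Hypothesis Hsaddle : saddle_point f g Phi xs ys.
Hypothesis (dx0 : dom f x0) (dy0 : dom g y0).

Local Notation ff x := (fine (f x)).
Local Notation gg y := (fine (g y)).
Local Notation Gx := (grad_x Phi).
Local Notation Gy := (grad_y Phi).

Let domfE := @domE _ _ f (pa_f_ninfty Hpb).
Let domgE := @domE _ _ g (pa_g_ninfty Hpb).

(** Comparing with the finite value at [(x0, y0)] excludes infinite values. *)
Lemma saddle_dom : dom f xs /\ dom g ys.
Proof.
have [h1 h2] := Hsaddle x0 y0; rewrite /lagrangian in h1 h2.
have dfs : dom f xs.
  have [//|/not_dom fxs] := pselect (dom f xs); exfalso.
  have : (f x0 + (Phi x0 ys)%:E - g ys < +oo)%E.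
    rewrite (domfE dx0); have := pa_g_ninfty Hpb ys.
    by case: (g ys) => [r||] // _; rewrite ltry.
  move: (le_trans h1 h2); rewrite fxs (domgE dy0) /= => h3 h4.
  by have := le_lt_trans h3 h4.
split=> //.
have [//|/not_dom gys] := pselect (dom g ys); exfalso.
by move: h1; rewrite gys (domfE dfs) (domgE dy0) /=.
Qed.

Let dxs : dom f xs. Proof. by case: saddle_dom. Qed.
Let dys : dom g ys. Proof. by case: saddle_dom. Qed.

Lemma saddle_x x : dom f x -> ff xs + Phi xs ys <= ff x + Phi x ys.
Proof.
move=> dx; have [_] := Hsaddle x ys.
rewrite /lagrangian (domfE dx) (domfE dxs) (domgE dys) -!EFinD lee_fin.
by rewrite lerD2r.
Qed.

Lemma saddle_y y : dom g y -> gg ys - Phi xs ys <= gg y - Phi xs y.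
Proof.
move=> dy; have [h _] := Hsaddle xs y; move: h.
rewrite /lagrangian (domgE dy) (domfE dxs) (domgE dys) -!EFinD lee_fin.
by rewrite /=; lra.
Qed.

Lemma Phi_differentiable x y : dom f x -> dom g y ->
  differentiable (fun z : 'rV[R]_m * 'rV[R]_n => Phi z.1 z.2 : R^o) (x, y).
Proof.
move=> dx dy; have [U [_ dU C1]] := pa_Phi_C1 Hpb.
by have [] := C1 (x, y) (dU (x, y) (conj dx dy)).
Qed.

Let cv_f := @dom_convex _ _ f _ (pa_f_ninfty Hpb) (pa_f_sconvex Hpb).
Let cv_g := @dom_convex _ _ g _ (pa_g_ninfty Hpb) (pa_g_sconvex Hpb).

Lemma convex_function_line k (D : set 'rV[R]_k) (h : 'rV[R]_k -> R) a b (t : R) :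
  convex_function D h -> D a -> D b -> 0 < t < 1 ->
  h (a + t *: (b - a)) <= (1 - t) * h a + t * h b.
Proof.
move=> ch Da Db /andP[t0 t1].
have ht : h (t *: b + (1 - t) *: a) <= t * h b + (1 - t) * h a.
  exact: (ch (Itv01 (ltW t0) (ltW t1)) b a (mem_set Db) (mem_set Da)).
rewrite (_ : a + t *: (b - a) = t *: b + (1 - t) *: a); last first.
  by rewrite scalerBl scalerBr scale1r addrC addrAC -addrA.
by rewrite [leRHS]addrC.
Qed.

Lemma Phi_x_convex y a b (t : R) : dom g y -> dom f a -> dom f b -> 0 < t < 1 ->
  Phi (a + t *: (b - a)) y <= (1 - t) * Phi a y + t * Phi b y.
Proof.
by move=> dy; apply: (@convex_function_line _ (dom f) (fun x => Phi x y));
  exact: (pa_Phi_convex Hpb).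
Qed.

Lemma Phi_y_concave x a b (t : R) : dom f x -> dom g a -> dom g b -> 0 < t < 1 ->
  - Phi x (a + t *: (b - a)) <= (1 - t) * - Phi x a + t * - Phi x b.
Proof.
by move=> dx; apply: (@convex_function_line _ (dom g) (fun y => - Phi x y));
  exact: (pa_Phi_concave Hpb).
Qed.

Let Dx y a v (t : R) : dom g y -> dom f (a + t *: v) ->
  is_derive t (1 : R) (fun s : R => Phi (a + s *: v) y) (dot (Gx (a + t *: v) y) v).
Proof. by move=> dy da; apply: is_derive_x; exact: Phi_differentiable. Qed.

Let Dy x a v (t : R) : dom f x -> dom g (a + t *: v) ->
  is_derive t (1 : R) (fun s : R => - Phi x (a + s *: v)) (dot (- Gy x (a + t *: v)) v).
Proof.
move=> dx da; rewrite dotNl; apply: is_deriveN.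
by apply: is_derive_y; exact: Phi_differentiable.
Qed.

Lemma Phi_x_gradient y a b : dom g y -> dom f a -> dom f b ->
  Phi a y + dot (Gx a y) (b - a) <= Phi b y.
Proof.
move=> dy; apply: (@convex_gradient_le _ _ (dom f) (fun x => Phi x y) (Gx ^~ y)).
- by move=> *; exact: Dx.
- by move=> *; exact: Phi_x_convex.
Qed.

Lemma Phi_y_gradient x a b : dom f x -> dom g a -> dom g b ->
  Phi x b <= Phi x a + dot (Gy x a) (b - a).
Proof.
move=> dx da db.
have := @convex_gradient_le _ _ (dom g) (fun y => - Phi x y) (fun y => - Gy x y).
move=> /(_ _ _ a b da db); rewrite dotNl => h.
have : - Phi x a - dot (Gy x a) (b - a) <= - Phi x b.
  by apply: h => *; [exact: Dy|exact: Phi_y_concave].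
lra.
Qed.

Lemma Phi_x_descent y a b : dom g y -> dom f a -> dom f b ->
  Phi b y <= Phi a y + dot (Gx a y) (b - a) + p_Lxx c / 2 * enorm (b - a) ^+ 2.
Proof.
move=> dy da db.
apply: (@descent_le _ _ (dom f) (fun x => Phi x y) (Gx ^~ y)) => //.
- by move=> *; exact: Dx.
- exact: (pa_Lxx Hpb).
move=> u v du dv; have := pa_lip_x Hpb du dy dv dy.
by rewrite subrr enorm0 mulr0 addr0.
Qed.

(** [xs] minimises [f + Phi (., ys)]; the slope of [Phi] at [xs] is compared with
    the increments of [f] along the segment to [v]. *)
Lemma optimality_x v : dom f v -> ff xs - dot (Gx xs ys) (v - xs) <= ff v.
Proof.
move=> dv.
have := @Dx ys xs (v - xs) 0 dys; rewrite scale0r addr0 => /(_ dxs) D.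
have : ff xs - ff v <= dot (Gx xs ys) (v - xs).
  apply: (slope_ge D) => t t01; rewrite scale0r addr0.
  case/andP: (t01) => t0 t1.
  have dt : dom f (xs + t *: (v - xs)) by apply: cv_f => //; rewrite !ltW.
  have := saddle_x dt.
  have := @fine_convex _ _ f _ (pa_f_ninfty Hpb) (pa_f_sconvex Hpb) (pa_mux Hpb) _ _ _ dxs dv t01.
  lra.
lra.
Qed.

Lemma optimality_y v : dom g v -> gg ys + dot (Gy xs ys) (v - ys) <= gg v.
Proof.
move=> dv.
have := @Dy xs ys (v - ys) 0 dxs; rewrite scale0r addr0 => /(_ dys) D.
have : gg ys - gg v <= dot (- Gy xs ys) (v - ys).
  apply: (slope_ge D) => t t01; rewrite scale0r addr0.
  case/andP: (t01) => t0 t1.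
  have dt : dom g (ys + t *: (v - ys)) by apply: cv_g => //; rewrite !ltW.
  have := saddle_y dt.
  have := @fine_convex _ _ g _ (pa_g_ninfty Hpb) (pa_g_sconvex Hpb) (pa_muy Hpb) _ _ _ dys dv t01.
  lra.
rewrite dotNl; lra.
Qed.

Lemma saddle_prox_x (tau : R) : 0 < tau ->
  prox (fun u => (tau%:E * f u)%E) (xs - tau *: Gx xs ys) xs.
Proof.
move=> tau0; apply: prox_intro => //; first exact: (pa_f_ninfty Hpb).
move=> v dv; rewrite /prox_obj.
have := ler_wpM2l (ltW tau0) (optimality_x dv).
rewrite !enorm_sqr !dotE.
rewrite (dotC v xs) (dotC (Gx xs ys) v) (dotC (Gx xs ys) xs).
have := dot_le_enorm (v - xs) (v - xs); have := sqr_ge0 (enorm (v - xs)).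
rewrite enorm_sqr !dotE (dotC v xs); lra.
Qed.

Lemma saddle_prox_y (sigma : R) : 0 < sigma ->
  prox (fun u => (sigma%:E * g u)%E) (ys + sigma *: Gy xs ys) ys.
Proof.
move=> s0; apply: prox_intro => //; first exact: (pa_g_ninfty Hpb).
move=> v dv; rewrite /prox_obj.
have := ler_wpM2l (ltW s0) (optimality_y dv).
rewrite !enorm_sqr !dotE.
rewrite (dotC v ys) (dotC (Gy xs ys) v) (dotC (Gy xs ys) ys).
have := sqr_ge0 (enorm (v - ys)).
rewrite enorm_sqr !dotE (dotC v ys); lra.
Qed.

Lemma prox_x_exists (tau : R) z : 0 < tau ->
  exists u, prox (fun u => (tau%:E * f u)%E) z u.
Proof.
move=> tau0.
apply: (@prox_exists _ _ f (p_mux c) tau _ _ _ _ _ xs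
  (ff xs + dot (Gx xs ys) xs) (- Gx xs ys)) => //.
- exact: (pa_f_ninfty Hpb).
- exact: (pa_f_closed Hpb).
- exact: (pa_f_sconvex Hpb).
- exact: (pa_mux Hpb).
move=> v dv; have := optimality_x dv; rewrite dotBr dotNl; lra.
Qed.

Lemma prox_y_exists (sigma : R) z : 0 < sigma ->
  exists u, prox (fun u => (sigma%:E * g u)%E) z u.
Proof.
move=> s0.
apply: (@prox_exists _ _ g (p_muy c) sigma _ _ _ _ _ ys
  (gg ys - dot (Gy xs ys) ys) (Gy xs ys)) => //.
- exact: (pa_g_ninfty Hpb).
- exact: (pa_g_closed Hpb).
- exact: (pa_g_sconvex Hpb).
- exact: (pa_muy Hpb).
move=> v dv; have := optimality_y dv; rewrite dotBr; lra.
Qed.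

(** The strong minimality of [x'] and [y'] is tested against [xs] and [ys].  The
    error [e] stands for the noise in the ascent direction [s], and [d] for the
    noise in the descent direction. *)
Lemma one_step (tau sigma : R) x y s e d x' y' : 0 < tau -> 0 < sigma ->
  dom f x -> dom g y ->
  prox (fun v => (sigma%:E * g v)%E) (y + sigma *: (s + e)) y' ->
  prox (fun u => (tau%:E * f u)%E) (x - tau *: (Gx x y' + d)) x' ->
  (1 + tau * p_mux c) / (2 * tau) * enorm (x' - xs) ^+ 2
  + (1 + sigma * p_muy c) / (2 * sigma) * enorm (y' - ys) ^+ 2
  + dot (Gy x' y' - s) (y' - ys)
  + ((2 * tau)^-1 - p_Lxx c / 2) * enorm (x' - x) ^+ 2
  + (2 * sigma)^-1 * enorm (y' - y) ^+ 2
  <= (2 * tau)^-1 * enorm (x - xs) ^+ 2 + (2 * sigma)^-1 * enorm (y - ys) ^+ 2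
     + dot e (y' - ys) - dot d (x' - xs).
Proof.
move=> tau0 s0 dx dy py px.
have dy' : dom g y' by exact: (prox_dom (pa_g_ninfty Hpb) s0 dys py).
have dx' : dom f x' by exact: (prox_dom (pa_f_ninfty Hpb) tau0 dxs px).
have hy := prox_strong (pa_g_ninfty Hpb) (pa_g_sconvex Hpb) (pa_muy Hpb) s0 dys py dys.
have hx := prox_strong (pa_f_ninfty Hpb) (pa_f_sconvex Hpb) (pa_mux Hpb) tau0 dxs px dxs.
have sx := saddle_x dx'; have sy := saddle_y dy'.
have h1 := Phi_x_descent dy' dx dx'.
have h2 := Phi_x_gradient dy' dx dxs.
have h3 := Phi_y_gradient dx' dy' dys.
have {}hy : gg y' + (1 + sigma * p_muy c) / (2 * sigma) * enorm (y' - ys) ^+ 2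
    + (2 * sigma)^-1 * enorm (y' - y) ^+ 2
    <= gg ys + (2 * sigma)^-1 * enorm (y - ys) ^+ 2 + dot (s + e) (y' - ys).
  rewrite -(ler_pM2l s0).
  move: hy; rewrite /prox_obj (enormC ys y') => hy.
  rewrite -subr_ge0; rewrite -subr_ge0 in hy.
  apply: (le_trans hy); apply: le_of_eq.
  rewrite !enorm_sqr; move: (s + e) => a; rewrite !dotE.
  rewrite ?(dotC ys y') ?(dotC y y') ?(dotC a y') ?(dotC a y) ?(dotC a ys) ?(dotC ys y).
  by field; rewrite gt_eqF.
have {}hx : ff x' + (1 + tau * p_mux c) / (2 * tau) * enorm (x' - xs) ^+ 2
    + (2 * tau)^-1 * enorm (x' - x) ^+ 2
    <= ff xs + (2 * tau)^-1 * enorm (x - xs) ^+ 2 - dot (Gx x y' + d) (x' - xs).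
  rewrite -(ler_pM2l tau0).
  move: hx; rewrite /prox_obj (enormC xs x') => hx.
  rewrite -subr_ge0; rewrite -subr_ge0 in hx.
  apply: (le_trans hx); apply: le_of_eq.
  rewrite !enorm_sqr; move: (_ + d) => a; rewrite !dotE.
  rewrite ?(dotC xs x') ?(dotC x x') ?(dotC a x') ?(dotC a x) ?(dotC a xs) ?(dotC xs x).
  by field; rewrite gt_eqF.
move: hx hy h1 h2 h3; rewrite !dotE; lra.
Qed.

End ProblemFacts.

(** * The matrix inequality and the update maps *)

Ltac nonneg := repeat first
  [ assumption | exact: sqr_ge0 | exact: ler01 | exact: ler0n | exact: enorm_ge0
  | solve [apply: ltW; assumption] | rewrite invr_ge0
  | apply: addr_ge0 | apply: mulr_ge0 | apply: exprn_ge0 ].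

Section MatrixInequality.
Context {R : realType} (c : params R).
Local Notation tau := (p_tau c).
Local Notation sigma := (p_sigma c).
Local Notation theta := (p_theta c).
Local Notation rho := (p_rho c).
Local Notation alpha := (p_alpha c).
Local Notation mux := (p_mux c).
Local Notation muy := (p_muy c).
Local Notation Lxx := (p_Lxx c).
Local Notation Lxy := (p_Lxy c).
Local Notation Lyx := (p_Lyx c).
Local Notation Lyy := (p_Lyy c).
Hypothesis HMI : MI c.
Hypotheses (tau0 : 0 < tau) (sigma0 : 0 < sigma) (theta0 : 0 <= theta).
Hypothesis rho01 : 0 < rho < 1.
Hypotheses (Lxy0 : 0 < Lxy) (Lyx0 : 0 < Lyx) (Lyy0 : 0 <= Lyy).
Hypotheses (mux0 : 0 < mux) (muy0 : 0 < muy).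

Let rho0 : 0 < rho. Proof. by case/andP: rho01. Qed.

Lemma MI_form (v1 v2 v3 v4 v5 : R) :
  0 <= (tau^-1 + mux - (rho * tau)^-1) * v1 ^+ 2
    + (sigma^-1 + muy - (rho * sigma)^-1) * v2 ^+ 2
    + (tau^-1 - Lxx) * v3 ^+ 2 + (sigma^-1 - alpha) * v4 ^+ 2
    + alpha / rho * v5 ^+ 2
    + 2 * (theta / rho - 1) * v2 * (Lyx * v3 + Lyy * v4)
    - 2 * (theta / rho) * v5 * (Lyx * v3 + Lyy * v4).
Proof.
have [_ /(_ (row_of 5 [:: v1; v2; v3; v4; v5]))] := HMI.
rewrite !mxE !big_ord_recl big_ord0 !mxE /=.
rewrite !big_ord_recl !big_ord0 !mxE /= => h.
by apply: (le_trans h); apply: le_of_eq; ring.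
Qed.

(** The matrix is evaluated at the norms of the vectors involved, with the sign of
    the second entry chosen so that its cross terms bound the part of [dot q Y]
    with coefficient [1 - theta / rho], whatever the sign of that coefficient. *)
Lemma MI_potential k (X2 a b : R) (Y q z : 'rV[R]_k) : 0 <= X2 -> 0 <= a -> 0 <= b ->
  enorm q <= Lyx * a + Lyy * b ->
  rho^-1 * ((2 * tau)^-1 * X2 + (2 * sigma)^-1 * enorm Y ^+ 2
     + theta * dot q (Y + z) - alpha / 2 * enorm z ^+ 2)
  <= (1 + tau * mux) / (2 * tau) * X2
   + (1 + sigma * muy) / (2 * sigma) * enorm Y ^+ 2 + dot q Y
   + ((2 * tau)^-1 - Lxx / 2) * a ^+ 2 + ((2 * sigma)^-1 - alpha / 2) * b ^+ 2.
Proof.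
move=> X20 a0 b0 qle.
(* the sign that makes the cross term of the quadratic form nonpositive *)
pose sg : R := if 0 <= theta / rho - 1 then 1 else -1.
have sgE : (theta / rho - 1) * sg = `|theta / rho - 1|.
  rewrite /sg; case: ifP => h; first by rewrite mulr1 ger0_norm.
  by rewrite mulrN1 ler0_norm// ltW// ltNge h.
have sg2 : sg ^+ 2 = 1 by rewrite /sg; case: ifP; rewrite ?expr1n ?sqrrN ?expr1n.
have := MI_form (Num.sqrt X2) (- sg * enorm Y) a b (enorm z).
rewrite sqr_sqrtr// exprMn sqrrN sg2 mul1r.
rewrite (_ : 2 * (theta / rho - 1) * (- sg * enorm Y) =
   - 2 * ((theta / rho - 1) * sg) * enorm Y); last by ring.
rewrite sgE => MIh.
set Q := Lyx * a + Lyy * b in qle MIh.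
have h1 : `|theta / rho - 1| * - (Q * enorm Y) <= (1 - theta / rho) * dot q Y.
  have : `|(1 - theta / rho) * dot q Y| <= `|theta / rho - 1| * (Q * enorm Y).
    rewrite normrM distrC ler_wpM2l//; apply: le_trans (normr_dot_le _ _) _.
    by rewrite ler_wpM2r ?enorm_ge0.
  by rewrite ler_norml mulrN => /andP[].
have tr0 : 0 <= theta / rho by rewrite divr_ge0// ltW.
have h2 : theta / rho * dot q z <= theta / rho * (Q * enorm z).
  rewrite ler_wpM2l//; apply: le_trans (dot_le_enorm _ _) _.
  by rewrite ler_wpM2r ?enorm_ge0.
rewrite dotDr -subr_ge0.
have h3 : 0 <= 2^-1 * ((tau^-1 + mux - (rho * tau)^-1) * X2
    + (sigma^-1 + muy - (rho * sigma)^-1) * enorm Y ^+ 2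
    + (tau^-1 - Lxx) * a ^+ 2 + (sigma^-1 - alpha) * b ^+ 2
    + alpha / rho * enorm z ^+ 2)
    + (1 - theta / rho) * dot q Y - theta / rho * dot q z.
  by move: MIh h1 h2; lra.
apply: (le_trans h3); apply: le_of_eq.
by field; rewrite !gt_eqF.
Qed.

Local Notation dx := (1 + tau * mux).
Local Notation dy := (1 + sigma * muy).

(** The difference of the two sides is a combination of squares of differences,
    i.e. every product of two norms is split by the arithmetic-geometric mean
    inequality; this is where [C_x], ..., [C_y2] come from. *)
Lemma noise_quadratic (n n1 n2 m m1 : R) :
  0 <= n -> 0 <= n1 -> 0 <= n2 -> 0 <= m -> 0 <= m1 ->
  (1 + theta) * n * (sigma / dy * ((1 + theta) * n + theta * n1))
  + theta * n1 * (sigma / dy * ((1 + theta) * n + theta * n1)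
      + F_cst c * (sigma / dy) * ((1 + theta) * n1 + theta * n2)
      + sigma * (1 + theta) * Lyx * (tau / dx) / dy * m1)
  + m * (tau / dx * m + tau / dx * Lxy * (sigma / dy) * ((1 + theta) * n + theta * n1))
  <= C_x c * m ^+ 2 + rho * C_x1 c * m1 ^+ 2 + C_y c * n ^+ 2
     + rho * C_y1 c * n1 ^+ 2 + rho ^+ 2 * C_y2 c * n2 ^+ 2.
Proof.
move=> n0 n10 n20 m0 m10.
have dx0 : 0 < dx by rewrite addr_gt0// mulr_gt0.
have dy0 : 0 < dy by rewrite addr_gt0// mulr_gt0.
have F0 : 0 <= F_cst c.
  by rewrite /F_cst /C_st; nonneg.
set F := F_cst c in F0 *.
rewrite -subr_ge0.
have -> : C_x c * m ^+ 2 + rho * C_x1 c * m1 ^+ 2 + C_y c * n ^+ 2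
     + rho * C_y1 c * n1 ^+ 2 + rho ^+ 2 * C_y2 c * n2 ^+ 2 -
  ((1 + theta) * n * (sigma / dy * ((1 + theta) * n + theta * n1))
  + theta * n1 * (sigma / dy * ((1 + theta) * n + theta * n1)
      + F * (sigma / dy) * ((1 + theta) * n1 + theta * n2)
      + sigma * (1 + theta) * Lyx * (tau / dx) / dy * m1)
  + m * (tau / dx * m + tau / dx * Lxy * (sigma / dy) * ((1 + theta) * n + theta * n1)))
  = sigma / dy * ((1 + theta) * theta * (n - n1) ^+ 2)
    + sigma / dy * (theta ^+ 2 * F / 2 * (n1 - n2) ^+ 2)
    + sigma / dy * (theta * (1 + theta) * Lyx * (tau / dx) / 2 * (n1 - m1) ^+ 2)
    + sigma / dy * (tau / dx * Lxy * (1 + theta) / 2 * (m - n) ^+ 2)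
    + sigma / dy * (tau / dx * Lxy * theta / 2 * (m - n1) ^+ 2).
  rewrite /C_x /C_x1 /C_y /C_y1 /C_y2 -/F.
  by field; rewrite !gt_eqF.
by nonneg.
Qed.

End MatrixInequality.

Section Updates.
Context {R : realType} {m n : nat} (c : params R).
Context (f : 'rV[R]_m -> \bar R) (g : 'rV[R]_n -> \bar R).
Context (Phi : 'rV[R]_m -> 'rV[R]_n -> R).
Hypothesis Hpb : problem_assumption c f g Phi.
Local Notation tau := (p_tau c).
Local Notation sigma := (p_sigma c).
Local Notation theta := (p_theta c).
Hypotheses (tau0 : 0 < tau) (sigma0 : 0 < sigma) (theta0 : 0 <= theta).
Local Notation Gx := (grad_x Phi).
Local Notation Gy := (grad_y Phi).
Local Notation Lxx := (p_Lxx c).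
Local Notation Lxy := (p_Lxy c).
Local Notation Lyx := (p_Lyx c).
Local Notation Lyy := (p_Lyy c).

(** Argument of the proximal step in [y] with exact gradients; [t] is the weight
    of the momentum. *)
Definition yarg (t : R) x y xm ym : 'rV[R]_n :=
  y + sigma *: (Gy x y + t *: (Gy x y - Gy xm ym)).

Definition xarg x y : 'rV[R]_m := x - tau *: Gx x y.

Lemma xarg_lipschitz x y x' y' : dom f x -> dom g y -> dom f x' -> dom g y' ->
  enorm (xarg x y - xarg x' y')
    <= (1 + tau * Lxx) * enorm (x - x') + tau * Lxy * enorm (y - y').
Proof.
move=> dx dy dx' dy'; rewrite /xarg.
rewrite (_ : _ - _ = (x - x') - tau *: (Gx x y - Gx x' y')); last first.
  by move: (Gx x y) (Gx x' y') => u v; apply/rowP => i; rewrite !mxE; ring.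
apply: le_trans (enormB _ _) _; rewrite enormZ gtr0_norm//.
have h := ler_wpM2l (ltW tau0) (pa_lip_x Hpb dx dy dx' dy').
by clear -h; lra.
Qed.

Lemma yarg_lipschitz t x y xm ym x' y' xm' ym' : 0 <= t <= theta ->
  dom f x -> dom g y -> dom f xm -> dom g ym ->
  dom f x' -> dom g y' -> dom f xm' -> dom g ym' ->
  enorm (yarg t x y xm ym - yarg t x' y' xm' ym')
  <= C_st c * enorm (y - y') + sigma * (1 + theta) * Lyx * enorm (x - x')
     + sigma * theta * Lyx * enorm (xm - xm') + sigma * theta * Lyy * enorm (ym - ym').
Proof.
move=> /andP[t0 tth] dx dy dxm dym dx' dy' dxm' dym'; rewrite /yarg.
rewrite (_ : _ - _ = (y - y') + (sigma * (1 + t)) *: (Gy x y - Gy x' y')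
     - (sigma * t) *: (Gy xm ym - Gy xm' ym')); last first.
  move: (Gy x y) (Gy x' y') (Gy xm ym) (Gy xm' ym') => u u' v v'.
  by apply/rowP => i; rewrite !mxE; ring.
apply: le_trans (enormB _ _) _.
apply: le_trans (lerD (enormD _ _) (lexx _)) _.
have st0 : 0 <= sigma * (1 + t) by rewrite mulr_ge0 ?addr_ge0// ltW.
have st1 : 0 <= sigma * t by rewrite mulr_ge0// ltW.
rewrite !enormZ !ger0_norm//.
have h1 := pa_lip_y Hpb dx dy dx' dy'.
have h2 := pa_lip_y Hpb dxm dym dxm' dym'.
have b1 : 0 <= Lyx * enorm (x - x') + Lyy * enorm (y - y').
  by apply: le_trans h1; exact: enorm_ge0.
have b2 : 0 <= Lyx * enorm (xm - xm') + Lyy * enorm (ym - ym').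
  by apply: le_trans h2; exact: enorm_ge0.
have k1 : sigma * (1 + t) * enorm (Gy x y - Gy x' y') <=
  sigma * (1 + theta) * (Lyx * enorm (x - x') + Lyy * enorm (y - y')).
  apply: le_trans (ler_wpM2l st0 h1) _.
  by rewrite ler_wpM2r// ler_pM2l// lerD2l.
have k2 : sigma * t * enorm (Gy xm ym - Gy xm' ym') <=
  sigma * theta * (Lyx * enorm (xm - xm') + Lyy * enorm (ym - ym')).
  apply: le_trans (ler_wpM2l st1 h2) _.
  by rewrite ler_wpM2r// ler_pM2l.
clear -k1 k2; move: k1 k2; rewrite /C_st.
move: (enorm (Gy x y - Gy x' y')) (enorm (Gy xm ym - Gy xm' ym')).
move: (enorm (x - x')) (enorm (y - y')) (enorm (xm - xm')) (enorm (ym - ym')).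
move=> e1 e2 e3 e4 e5 e6 k1 k2; lra.
Qed.

End Updates.

(** * Integrating the noise backwards in time *)

Section BackwardInduction.
Context d (Omega : measurableType d) {R : realType} (P : probability Omega R).
Context {m n : nat} (GX GY : nat -> set (set Omega)).
Variables (D W pend : nat -> Omega -> R).
Variables (Dy a b : nat -> Omega -> 'rV[R]_n) (Dx c : nat -> Omega -> 'rV[R]_m).
Variables (rho lam kX kY dX dY Kc Ka Kb W0 : R).
Local Notation r := ((1 + rho) / 2).
Local Notation Q := (kX * dX ^+ 2 + kY * dY ^+ 2).

(* [GY k] generates the past of [Dy k], and [GX k] the past of [Dx k], which
   includes [Dy k] *)
Hypothesis GXM : forall k, GX k `<=` @measurable _ Omega.
Hypothesis GYX : forall k, GY k `<=` GX k.
Hypotheses (mD : forall k, sub_measurable <<s GY k >> (D k))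
  (mDp : forall k, sub_measurable <<s GY k >> (D k.-1))
  (mW : forall k, sub_measurable <<s GY k >> (W k))
  (mpend : forall k, sub_measurable <<s GY k >> (pend k)).
Hypotheses (ma : forall k, adapted (GY k) (a k)) (mb : forall k, adapted (GY k) (b k))
  (mc : forall k, adapted (GY k) (c k)) (mDy : forall k, adapted (GX k) (Dy k)).
Hypotheses (D0 : forall k w, 0 <= D k w) (DW : forall k w, D k w <= W k w).
Hypothesis W_init : forall w, W 0 w = W0.
Hypothesis W_step : forall k w, W k.+1 w =
  rho * (W k w + dot (Dy k w) (a k w) - pend k w - dot (Dx k w) (c k w)
         + kX * enorm (Dx k w) ^+ 2 + kY * enorm (Dy k w) ^+ 2).
Hypothesis pend_init : forall w, pend 0 w = 0.
Hypothesis pend_step : forall k w, pend k.+1 w = dot (Dy k w) (b k w).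
Hypotheses
  (a_le : forall k w, enorm (a k w) ^+ 2 <= Ka * (D k w + D k.-1 w))
  (b_le : forall k w, enorm (b k w) ^+ 2 <= Kb * (D k w + D k.-1 w))
  (c_le : forall k w, enorm (c k w) ^+ 2 <= Kc * (D k w + D k.-1 w)).
Hypotheses (rho01 : 0 < rho < 1) (lam0 : 0 < lam) (dX0 : 0 < dX) (dY0 : 0 < dY).
Hypotheses (kX0 : 0 <= kX) (kY0 : 0 <= kY) (Ka0 : 0 <= Ka) (Kb0 : 0 <= Kb) (Kc0 : 0 <= Kc).
Hypotheses (kX_le : lam * kX <= (8 * dX ^+ 2)^-1) (kY_le : lam * kY <= (8 * dY ^+ 2)^-1).
Hypothesis small : 48 * (lam * (dX ^+ 2 * Kc + 2 * (dY ^+ 2 * (Ka + Kb))))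
  <= 3 / 16 * (1 - rho).
Hypotheses
  (meanY : forall k i, is_cond_exp P <<s GY k >> (fun w => Dy k w 0 i) (cst 0))
  (meanX : forall k i, is_cond_exp P <<s GX k >> (fun w => Dx k w 0 i) (cst 0))
  (tailY : forall k t, 0 <= t ->
    cond_prob_le P <<s GY k >> [set w | t <= enorm (Dy k w)]
      (2 * expR (- (t ^+ 2 / (2 * dY ^+ 2)))))
  (tailX : forall k t, 0 <= t ->
    cond_prob_le P <<s GX k >> [set w | t <= enorm (Dx k w)]
      (2 * expR (- (t ^+ 2 / (2 * dX ^+ 2))))).

Let rho0 : 0 < rho. Proof. by case/andP: rho01. Qed.
Let rho1 : rho < 1. Proof. by case/andP: rho01. Qed.

Let GYM k : GY k `<=` @measurable _ Omega.
Proof. by move=> A /GYX; exact: GXM. Qed.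

Let mono k (f : Omega -> R) : sub_measurable <<s GY k >> f -> sub_measurable <<s GX k >> f.
Proof. by move=> mf B mB; exact: (sub_sigma_algebra2 (@GYX k) (mf B mB)). Qed.

(** Two applications of [cond_mgf]: the newest variable [Dx] is integrated out
    given everything before it, then [Dy].  The vector paired with [Dy k] collects
    its contribution to [W k.+1] and the one still pending. *)
Lemma mgf_step k (be be' ka : R) : 0 <= be <= 1 ->
  (\int[P]_w (expR (lam * (be * W k.+1 w - be' * pend k.+1 w + ka * D k w)))%:E
   <= \int[P]_w (expR (lam * (rho * be * (W k w - pend k w) + ka * D k w
        + 12 * (rho * be * Q))
        + 48 * (dX ^+ 2 * enorm (- (lam * rho * be) *: c k w) ^+ 2
        + dY ^+ 2 * enorm ((lam * rho * be) *: a k w - (lam * be') *: b k w) ^+ 2)))%:E)%E.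
Proof.
move=> /andP[be0 be1].
pose A w := lam * (rho * be * (W k w - pend k w) + ka * D k w).
pose u w := - (lam * rho * be) *: c k w.
pose v w := (lam * rho * be) *: a k w - (lam * be') *: b k w.
pose qX := lam * rho * be * kX.
pose qY := lam * rho * be * kY.
have rb0 : 0 <= lam * rho * be by rewrite !mulr_ge0// ltW.
have rb1 : lam * rho * be <= lam.
  rewrite -mulrA ler_piMr ?(ltW lam0)//.
  by apply: le_trans (ler_piMr (ltW rho0) be1) (ltW rho1).
have qX01 : 0 <= qX <= (8 * dX ^+ 2)^-1.
  rewrite mulr_ge0//=; apply: le_trans kX_le; exact: ler_wpM2r.
have qY01 : 0 <= qY <= (8 * dY ^+ 2)^-1.
  rewrite mulr_ge0//=; apply: le_trans kY_le; exact: ler_wpM2r.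
have mA : sub_measurable <<s GY k >> A.
  apply: sub_measurableZ; apply: sub_measurableD; last exact: sub_measurableZ.
  by apply: sub_measurableZ; exact: sub_measurableB.
have mu : adapted (GY k) u by exact: adaptedZ.
have mv : adapted (GY k) v by apply: adaptedB; exact: adaptedZ.
pose xi1 w := expR (A w + (dot (Dy k w) (v w) + qY * enorm (Dy k w) ^+ 2)).
have mxi1 : sub_measurable <<s GX k >> xi1.
  apply: sub_measurable_expR; apply: sub_measurableD; first exact: mono.
  apply: sub_measurableD.
    by apply: adapted_dot => // i; apply: mono; exact: mv.
  by apply: sub_measurableZ; apply: sub_measurable_normsq; exact: mDy.
pose xi2 w := expR (A w + (48 * (dX ^+ 2 * enorm (u w) ^+ 2) + 12 * (qX * dX ^+ 2))).
have mxi2 : sub_measurable <<s GY k >> xi2.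
  apply: sub_measurable_expR; apply: sub_measurableD => //.
  apply: sub_measurableD; last exact: sub_measurable_cst.
  by apply: sub_measurableZ; apply: sub_measurableZ; exact: sub_measurable_normsq.
have h1 := cond_mgf (@GXM k) dX0 (meanX k) (@tailX k) mxi1
  (fun w => expR_ge0 _) (fun i => mono (mu i)) qX01.
have h2 := cond_mgf (@GYM k) dY0 (meanY k) (@tailY k) mxi2
  (fun w => expR_ge0 _) mv qY01.
rewrite (_ : (fun w => (expR (lam * (be * W k.+1 w - _ + _)))%:E) = fun w =>
  (xi1 w * expR (dot (Dx k w) (u w) + qX * enorm (Dx k w) ^+ 2))%:E); last first.
  apply/funext => w; congr (_%:E); rewrite /xi1 -expRD; congr expR.
  by rewrite /A /v /u /qX /qY W_step pend_step dotBr !dotZr; ring.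
apply: (le_trans h1).
rewrite (_ : (fun w => (xi1 w * _)%:E) = fun w =>
  (xi2 w * expR (dot (Dy k w) (v w) + qY * enorm (Dy k w) ^+ 2))%:E); last first.
  by apply/funext => w; congr (_%:E); rewrite /xi1 /xi2 -!expRD; congr expR; ring.
apply: (le_trans h2).
apply: le_of_eq; apply: eq_integral => w _.
congr (_%:E); rewrite /xi2 -expRD; congr expR.
by rewrite /A /qX /qY -/(u w) -/(v w); ring.
Qed.

Let kap := 3 / 16 * (1 - rho).

(** The bounds on [a], [b] and [c] express the cost of the linear noise terms
    through [D k + D k.-1]; one factor [lam] of it is used up by [small]. *)
Lemma mgf_step_le k (be be' ka s : R) : 0 <= be <= 1 -> 0 <= be' ->
  0 <= s <= 1 -> be <= s -> be' <= rho * s ->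
  (\int[P]_w (expR (lam * (be * W k.+1 w - be' * pend k.+1 w + ka * D k w)))%:E
   <= (expR (lam * (12 * (rho * be * Q))))%:E *
      \int[P]_w (expR (lam * (rho * be * (W k w - pend k w) + ka * D k w
        + rho ^+ 2 * kap * s * (D k w + D k.-1 w))))%:E)%E.
Proof.
move=> be01 be'0 /andP[s0 s1] bes be's; apply: (le_trans (mgf_step _ _ _ be01)).
case/andP: be01 => be0 be1.
rewrite -ge0_integralZl//; last first.
  apply/measurable_EFinP; apply: (sub_measurable_fun (@GYM k)).
  apply: sub_measurable_expR; apply: sub_measurableZ; apply: sub_measurableD.
    apply: sub_measurableD; last exact: sub_measurableZ.
    by apply: sub_measurableZ; exact: sub_measurableB.
  by apply: sub_measurableZ; exact: sub_measurableD.
under [leRHS]eq_integral do rewrite -EFinM -expRD.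
have Z0 w : 0 <= D k w + D k.-1 w by rewrite addr_ge0.
apply: le_integral_ge0 => [||w].
- apply: (sub_measurable_fun (@GYM k)).
  apply: sub_measurable_expR; apply: sub_measurableD.
    apply: sub_measurableZ; apply: sub_measurableD; last exact: sub_measurable_cst.
    apply: sub_measurableD; last exact: sub_measurableZ.
    by apply: sub_measurableZ; exact: sub_measurableB.
  apply: sub_measurableZ; apply: sub_measurableD.
    apply: sub_measurableZ; apply: sub_measurable_normsq; exact: adaptedZ.
  apply: sub_measurableZ; apply: sub_measurable_normsq.
  by apply: adaptedB; exact: adaptedZ.
- apply: (sub_measurable_fun (@GYM k)).
  apply: sub_measurable_expR; apply: sub_measurableD; first exact: sub_measurable_cst.
  apply: sub_measurableZ; apply: sub_measurableD.
    apply: sub_measurableD; last exact: sub_measurableZ.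
    by apply: sub_measurableZ; exact: sub_measurableB.
  by apply: sub_measurableZ; exact: sub_measurableD.
rewrite expR_ge0/= ler_expR.
have hc := c_le k w; have ha := a_le k w; have hb := b_le k w.
have par : enorm ((lam * rho * be) *: a k w - (lam * be') *: b k w) ^+ 2
    <= lam ^+ 2 * (2 * (rho * be) ^+ 2 * enorm (a k w) ^+ 2 + 2 * be' ^+ 2 * enorm (b k w) ^+ 2).
  have := sqr_ge0 (enorm ((lam * rho * be) *: a k w + (lam * be') *: b k w)).
  by rewrite !enorm_sqr !dotE (dotC (b k w) (a k w)) => h; lra.
rewrite enormZ normrN exprMn real_normK ?num_real//.
have Z0w := Z0 w; move: par hc ha hb Z0w.
move: (enorm (_ *: _ - _)) (enorm (a k w)) (enorm (b k w)) (enorm (c k w)) => e ea eb ec.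
move: (D k w + D k.-1 w) => Z; move: (W k w - pend k w) (D k w) => V D1 par hc ha hb Z0w.
have rs : 0 <= rho * s by rewrite mulr_ge0// ltW.
have sq1 : (rho * be) ^+ 2 <= (rho * s) ^+ 2.
  by rewrite lerXn2r ?nnegrE// ?ler_pM2l// mulr_ge0// ltW.
have sq2 : be' ^+ 2 <= (rho * s) ^+ 2 by rewrite lerXn2r ?nnegrE.
have t1 : (rho * be) ^+ 2 * ec ^+ 2 <= (rho * s) ^+ 2 * (Kc * Z).
  exact: ler_pM (sqr_ge0 _) (sqr_ge0 _) sq1 hc.
have t2 : (rho * be) ^+ 2 * ea ^+ 2 <= (rho * s) ^+ 2 * (Ka * Z).
  exact: ler_pM (sqr_ge0 _) (sqr_ge0 _) sq1 ha.
have t3 : be' ^+ 2 * eb ^+ 2 <= (rho * s) ^+ 2 * (Kb * Z).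
  exact: ler_pM (sqr_ge0 _) (sqr_ge0 _) sq2 hb.
have t4 : e ^+ 2 <= lam ^+ 2 * (2 * ((rho * s) ^+ 2 * (Ka * Z)) + 2 * ((rho * s) ^+ 2 * (Kb * Z))).
  by apply: (le_trans par); rewrite ler_wpM2l ?sqr_ge0//; move: t2 t3; lra.
have t5 : 48 * (dX ^+ 2 * ((lam * rho * be) ^+ 2 * ec ^+ 2) + dY ^+ 2 * e ^+ 2)
   <= (lam * rho ^+ 2 * s ^+ 2 * Z) * (48 * (lam * (dX ^+ 2 * Kc + 2 * (dY ^+ 2 * (Ka + Kb))))).
  have u1 := ler_wpM2l (sqr_ge0 dY) t4.
  have u2 := ler_wpM2l (mulr_ge0 (sqr_ge0 dX) (sqr_ge0 lam)) t1.
  by move: u1 u2; lra.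
have t6 : (lam * rho ^+ 2 * s ^+ 2 * Z) * (48 * (lam * (dX ^+ 2 * Kc + 2 * (dY ^+ 2 * (Ka + Kb)))))
   <= lam * rho ^+ 2 * s * Z * kap.
  apply: ler_pM => //.
  - by rewrite !mulr_ge0// ?sqr_ge0// ltW.
  - by rewrite !mulr_ge0// ?addr_ge0 ?mulr_ge0 ?sqr_ge0 ?addr_ge0// ltW.
  - have lr0 : 0 <= lam * rho ^+ 2 by rewrite mulr_ge0 ?sqr_ge0// ltW.
    rewrite ler_wpM2r// ler_wpM2l//.
    by rewrite expr2 ler_piMl.
by have := le_trans t5 t6; lra.
Qed.

Let r01 : 0 < r < 1. Proof. by move: rho0 rho1 => h h'; apply/andP; split; lra. Qed.
Let r0 : 0 < r. Proof. by case/andP: r01. Qed.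
Let r1 : r < 1. Proof. by case/andP: r01. Qed.
Let kap0 : 0 <= kap. Proof. by move: rho1 => h; rewrite /kap; lra. Qed.
Let Q0 : 0 <= Q. Proof. by rewrite addr_ge0// mulr_ge0// sqr_ge0. Qed.

Let measurable_exponent k (t1 t2 t3 t4 : R) :
  measurable_fun setT (fun w => expR (lam * (t1 * W k w - t2 * pend k w + t3 * D k w
    + t4 * D k.-1 w))).
Proof.
apply: (sub_measurable_fun (@GYM k)); apply: sub_measurable_expR.
apply: sub_measurableZ; apply: sub_measurableD; last exact: sub_measurableZ.
apply: sub_measurableD; last exact: sub_measurableZ.
by apply: sub_measurableB; exact: sub_measurableZ.
Qed.

Let le_exponent k (t1 t2 t3 t4 u1 u2 u3 u4 : R) :
  (forall w, t1 * W k w - t2 * pend k w + t3 * D k w + t4 * D k.-1 w <=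
    u1 * W k w - u2 * pend k w + u3 * D k w + u4 * D k.-1 w) ->
  (\int[P]_w (expR (lam * (t1 * W k w - t2 * pend k w + t3 * D k w + t4 * D k.-1 w)))%:E
   <= \int[P]_w (expR (lam * (u1 * W k w - u2 * pend k w + u3 * D k w
                              + u4 * D k.-1 w)))%:E)%E.
Proof.
move=> h; apply: le_integral_ge0 => [||w]; first exact: measurable_exponent.
  exact: measurable_exponent.
by rewrite expR_ge0/= ler_expR ler_pM2l//; exact: h.
Qed.

Let rr : 0 < r - rho. Proof. by move: rho1; lra. Qed.

Let sq_rr : rho ^+ 2 <= r ^+ 2.
Proof. by rewrite lerXn2r ?nnegrE ?(ltW r0) ?(ltW rho0)//; move: rr; lra. Qed.

Let core1 : kap * r + rho ^+ 2 * kap <= r * (r - rho).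
Proof.
have k1 : kap * (1 + r) <= r - rho.
  apply: (@le_trans _ _ (kap * 2)); first by rewrite ler_wpM2l//; move: r1; lra.
  by rewrite /kap; move: rho1; lra.
have k2 : rho ^+ 2 * kap <= r * (kap * r).
  by rewrite (_ : r * (kap * r) = r ^+ 2 * kap); [exact: ler_wpM2r|ring].
have k3 := ler_wpM2l (ltW r0) k1.
by move: k2 k3; lra.
Qed.

Let core2 : rho ^+ 2 * kap <= kap * r * r.
Proof.
by rewrite (_ : kap * r * r = r ^+ 2 * kap); [exact: ler_wpM2r|ring].
Qed.

Let core3 : rho ^+ 2 * kap <= r - rho.
Proof.
apply: (@le_trans _ _ (1 * kap)); last by rewrite /kap; move: rho1; lra.
by rewrite ler_wpM2r// exprn_ile1// ltW.
Qed.

Let core4 : rho ^+ 2 * kap <= kap * r.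
Proof.
apply: (le_trans core2); apply: ler_piMr; last exact: ltW.
exact: mulr_ge0 kap0 (ltW r0).
Qed.

(** Going one step back turns the weight [r ^+ j] into [r ^+ j.+1].  The increase
    from [rho] to [r] pays for the terms in [D k], through [D k <= W k]; the
    terms in [D k.-1] are kept for the next step. *)
Lemma mgf_backward k j :
  (\int[P]_w (expR (lam * (r ^+ j.+1 * W k w - rho * r ^+ j * pend k w
      + 0 * D k w + kap * r ^+ j.+1 * D k.-1 w)))%:E
   <= (expR (lam * (2 * r ^+ (j.+1 + k) * W0 + 12 * Q * (r ^+ j.+1 / (1 - r)))))%:E)%E.
Proof.
have rj i : 0 <= r ^+ i <= 1.
  by rewrite exprn_ge0 ?exprn_ile1// ltW.
have ir : 0 < 1 - r by rewrite subr_gt0.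
elim: k j => [|k IH] j.
  rewrite -(integral_probability_cst P) addn0; apply: le_integral_ge0 => //.
  move=> w; rewrite expR_ge0/= ler_expR ler_pM2l// pend_init mulr0 subr0 mul0r addr0 /=.
  have h1 := DW 0 w; rewrite W_init in h1 *; have h2 := D0 0 w.
  have /andP[q0 q1] := rj j.+1.
  have t1 : 0 <= 12 * Q * (r ^+ j.+1 / (1 - r)).
    by rewrite !mulr_ge0// ?invr_ge0 ltW.
  have t2 : kap * r ^+ j.+1 * D 0 w <= r ^+ j.+1 * W0.
    apply: ler_pM => //; first exact: mulr_ge0.
    by rewrite ler_piMl// /kap; move: rho0; lra.
  by move: t1 t2; lra.
have /andP[q0 q1] := rj j.
have step := @mgf_step_le k (r ^+ j.+1) (rho * r ^+ j) (kap * r ^+ j.+1) (r ^+ j)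
  (rj _) (mulr_ge0 (ltW rho0) q0) (rj _) _ (lexx _).
rewrite (_ : (fun w => (expR (lam * (_ * W k.+1 w - _ + _ + _)))%:E) = fun w =>
   (expR (lam * (r ^+ j.+1 * W k.+1 w - rho * r ^+ j * pend k.+1 w
     + kap * r ^+ j.+1 * D k w)))%:E); last first.
  by apply/funext => w; rewrite mul0r addr0.
have e1 : r ^+ j.+1 <= r ^+ j by rewrite exprS ler_piMl// ltW.
apply: (le_trans (step e1)).
rewrite (_ : (fun w => (expR (lam * (_ + _ + _)))%:E) = fun w =>
   (expR (lam * (rho * r ^+ j.+1 * W k w - rho * r ^+ j.+1 * pend k w
     + (kap * r ^+ j.+1 + rho ^+ 2 * kap * r ^+ j) * D k w
     + rho ^+ 2 * kap * r ^+ j * D k.-1 w)))%:E); last first.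
  by apply/funext => w; congr (expR _)%:E; ring.
have bump w : rho * r ^+ j.+1 * W k w - rho * r ^+ j.+1 * pend k w
     + (kap * r ^+ j.+1 + rho ^+ 2 * kap * r ^+ j) * D k w
     + rho ^+ 2 * kap * r ^+ j * D k.-1 w
   <= r ^+ j.+2 * W k w - rho * r ^+ j.+1 * pend k w
      + 0 * D k w + kap * r ^+ j.+2 * D k.-1 w.
  rewrite !exprS; move: (D0 k w) (D0 k.-1 w) (DW k w) q0.
  move: (W k w) (pend k w) (D k w) (D k.-1 w) (r ^+ j) => v1 v2 v3 v4 s h1 h2 h3 s0.
  have b1 := ler_wpM2l (mulr_ge0 s0 h1) core1.
  have b2 := ler_wpM2l (mulr_ge0 s0 h2) core2.
  have b3 := ler_wpM2l (mulr_ge0 (mulr_ge0 s0 (ltW r0)) (ltW rr)) h3.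
  by rewrite /kap; move: b1 b2 b3; rewrite /kap; lra.
have {}bump := le_trans (le_exponent bump) (IH j.+1).
apply: le_trans (lee_wpmul2l _ bump) _; first by rewrite lee_fin expR_ge0.
rewrite -EFinM lee_fin -expRD ler_expR -mulrDr ler_pM2l//.
rewrite addSnnS [leLHS]addrCA lerD2l.
have h : rho * r ^+ j.+1 * Q <= r ^+ j.+1 * Q.
  rewrite ler_wpM2r// ler_piMl//; last exact: ltW.
  by case/andP: (rj j.+1).
rewrite -subr_ge0 (_ : _ - _ = 12 * (r ^+ j.+1 * Q - rho * r ^+ j.+1 * Q)).
  by apply: mulr_ge0; rewrite ?subr_ge0.
by rewrite (exprS r j.+1); move: ir (r ^+ j.+1); move: r => s ir z; field; rewrite gt_eqF.
Qed.

(** The first backward step has no pending part; the remaining ones are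
    [mgf_backward] with [j = 0]. *)
Theorem mgf_bound k :
  (\int[P]_w (expR (lam * D k.+1 w))%:E
   <= (expR (lam * (2 * r ^+ k.+1 * W0 + 12 * Q / (1 - r))))%:E)%E.
Proof.
have ir : 0 < 1 - r by rewrite subr_gt0.
have h0 : (\int[P]_w (expR (lam * D k.+1 w))%:E <=
   \int[P]_w (expR (lam * (1 * W k.+1 w - 0 * pend k.+1 w + 0 * D k w)))%:E)%E.
  apply: le_integral_ge0 => [||w].
  - apply: (sub_measurable_fun (@GYM k.+1)); apply: sub_measurable_expR.
    exact: sub_measurableZ.
  - rewrite (_ : (fun w => _) = fun w => expR (lam * W k.+1 w)).
      apply: (sub_measurable_fun (@GYM k.+1)); apply: sub_measurable_expR.
      exact: sub_measurableZ.
    by apply/funext => w; rewrite !mul0r mul1r subr0 addr0.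
  by rewrite expR_ge0/= ler_expR ler_pM2l// !mul0r mul1r subr0 addr0.
apply: (le_trans h0).
have one01 : (0 : R) <= (1 : R) <= (1 : R) by rewrite ler01 lexx.
have step := @mgf_step_le k 1 0 0 1 one01 (lexx _) one01 (lexx _).
apply: le_trans (step _) _; first by rewrite mulr1 (ltW rho0).
rewrite (_ : (fun w => (expR (lam * (_ + _ + _)))%:E) = fun w =>
   (expR (lam * (rho * W k w - rho * pend k w + rho ^+ 2 * kap * D k w
     + rho ^+ 2 * kap * D k.-1 w)))%:E); last first.
  by apply/funext => w; congr (expR _)%:E; ring.
have bump w : rho * W k w - rho * pend k w + rho ^+ 2 * kap * D k w
     + rho ^+ 2 * kap * D k.-1 w <=
   r ^+ 1 * W k w - rho * r ^+ 0 * pend k w + 0 * D k w + kap * r ^+ 1 * D k.-1 w.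
  rewrite expr1 expr0 mulr1; move: (D0 k w) (D0 k.-1 w) (DW k w).
  move: (W k w) (pend k w) (D k w) (D k.-1 w) => v1 v2 v3 v4 h1 h2 h3.
  have b1 := ler_wpM2l h1 core3.
  have b2 := ler_wpM2l h2 core4.
  have b3 := ler_wpM2l (ltW rr) h3.
  by move: b1 b2 b3; lra.
have {}bump := le_trans (le_exponent bump) (mgf_backward k 0).
apply: le_trans (lee_wpmul2l _ bump) _; first by rewrite lee_fin expR_ge0.
rewrite -EFinM lee_fin -expRD ler_expR -mulrDr ler_pM2l//.
rewrite mulr1 add1n [leLHS]addrCA lerD2l.
have h : rho * Q <= Q by rewrite ler_piMl// ltW.
rewrite -subr_ge0 (_ : _ - _ = 12 * (Q - rho * Q)).
  by apply: mulr_ge0; rewrite ?subr_ge0.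
by rewrite expr1; move: ir; move: r => s ir; field; rewrite gt_eqF.
Qed.

End BackwardInduction.

(** * Bounds on the constants *)

Section ConstantBounds.
Context {R : realType} (c : params R).
Local Notation tau := (p_tau c).
Local Notation sigma := (p_sigma c).
Local Notation theta := (p_theta c).
Local Notation rho := (p_rho c).
Local Notation alpha := (p_alpha c).
Local Notation mux := (p_mux c).
Local Notation muy := (p_muy c).
Local Notation dX := (p_deltax c).
Local Notation dY := (p_deltay c).
Hypotheses (tau0 : 0 < tau) (sigma0 : 0 < sigma) (theta0 : 0 <= theta).
Hypotheses (rho01 : 0 < rho < 1) (alpha01 : 0 <= alpha < sigma^-1).
Hypotheses (mux0 : 0 < mux) (muy0 : 0 < muy).
Hypotheses (Lxx0 : 0 <= p_Lxx c) (Lyy0 : 0 <= p_Lyy c).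
Hypotheses (Lxy0 : 0 < p_Lxy c) (Lyx0 : 0 < p_Lyx c).
Hypotheses (dX0 : 0 < dX) (dY0 : 0 < dY).
Local Notation KX := (C_x c + C_x1 c).
Local Notation KY := (C_y c + C_y1 c + C_y2 c).

Let rho0 : 0 < rho. Proof. by case/andP: rho01. Qed.
Let rho1 : 0 < 1 - rho. Proof. by rewrite subr_gt0; case/andP: rho01. Qed.
Let as1 : 0 < 1 - alpha * sigma.
Proof. by rewrite subr_gt0 -ltr_pdivlMr// div1r; case/andP: alpha01. Qed.
Let F0 : 0 <= F_cst c. Proof. by rewrite /F_cst /C_st; nonneg. Qed.
Let G0 : 0 <= G_cst c. Proof. by rewrite /G_cst; nonneg. Qed.

Lemma KX_ge0 : 0 <= KX. Proof. by rewrite /C_x /C_x1; nonneg. Qed.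
Lemma KY_ge0 : 0 <= KY. Proof. by rewrite /C_y /C_y1 /C_y2; nonneg. Qed.

Lemma KX_lt_Q : KX < Q_x c.
Proof.
have B0 : 0 < B_x c.
  rewrite /B_x ltr_wpDr//; first by nonneg.
  by rewrite divr_gt0// ?mulr_gt0// addr_gt0.
have -> : Q_x c = B_x c + KX by rewrite /Q_x; ring.
by rewrite ltrDr.
Qed.

Lemma KY_lt_Q : KY < Q_y c.
Proof.
have B0 : 0 < B_y c.
  rewrite /B_y -!addrA ltr_wpDr//; first by rewrite /C_st; nonneg.
  have t1 : 0 < 1 + theta by rewrite ltr_pwDl.
  by rewrite divr_gt0// ?mulr_gt0// ?exprn_gt0// addr_gt0.
have B1 : 0 <= B_y1 c by rewrite /B_y1 /C_st; nonneg.
have -> : Q_y c = (B_y c + B_y1 c) + KY by rewrite /Q_y; ring.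
by rewrite ltrDr ltr_wpDr.
Qed.

Let Qx0 : 0 < Q_x c. Proof. exact: le_lt_trans KX_ge0 KX_lt_Q. Qed.
Let Qy0 : 0 < Q_y c. Proof. exact: le_lt_trans KY_ge0 KY_lt_Q. Qed.
Let dX2 : 0 < dX ^+ 2. Proof. exact: exprn_gt0. Qed.
Let dY2 : 0 < dY ^+ 2. Proof. exact: exprn_gt0. Qed.

(** The parts of [gamma_x] and [gamma_y] with a denominator [mux] or [muy] are
    dropped. *)
Lemma Xi3_ge : 4 / (1 - rho) * ((16 * Q_x c + 4 * enorm (A1 c) ^+ 2) * dX ^+ 2
   + (16 * Q_y c + 4 * (enorm (A2 c) ^+ 2 + enorm (A3 c) ^+ 2)) * dY ^+ 2) <= Xi3 c.
Proof.
rewrite /Xi3; apply: ler_wpM2l; first by nonneg.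
have g1 : 0 <= 2 * (1 - rho) / mux by nonneg.
have g2 : 0 <= 4 * (1 - rho) / muy by nonneg.
by apply: lerD; rewrite ler_pM2r// /gamma_x /gamma_y -addrA lerDr.
Qed.

Let A123 : 0 <= enorm (A1 c) ^+ 2 * dX ^+ 2
   + (enorm (A2 c) ^+ 2 + enorm (A3 c) ^+ 2) * dY ^+ 2.
Proof. by nonneg. Qed.

Let Xi3_ge_Q : 64 * (Q_x c * dX ^+ 2 + Q_y c * dY ^+ 2) / (1 - rho) <= Xi3 c.
Proof.
apply: le_trans Xi3_ge.
rewrite [leLHS](_ : _ = 4 / (1 - rho) * (16 * (Q_x c * dX ^+ 2 + Q_y c * dY ^+ 2))); last first.
  by ring.
apply: ler_wpM2l; first by nonneg.
by move: A123; lra.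
Qed.

Let Xi3_ge_A : 16 * (enorm (A1 c) ^+ 2 * dX ^+ 2
   + (enorm (A2 c) ^+ 2 + enorm (A3 c) ^+ 2) * dY ^+ 2) / (1 - rho) <= Xi3 c.
Proof.
apply: le_trans Xi3_ge.
have q1 : 0 <= Q_x c * dX ^+ 2 by nonneg.
have q2 : 0 <= Q_y c * dY ^+ 2 by nonneg.
rewrite [leLHS](_ : _ = 4 / (1 - rho) * (4 * (enorm (A1 c) ^+ 2 * dX ^+ 2
   + (enorm (A2 c) ^+ 2 + enorm (A3 c) ^+ 2) * dY ^+ 2))); last by ring.
apply: ler_wpM2l; first by nonneg.
by move: q1 q2; lra.
Qed.

Let QQ0 : 0 < Q_x c * dX ^+ 2 + Q_y c * dY ^+ 2.
Proof. by rewrite addr_gt0 ?mulr_gt0. Qed.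

Lemma Xi3_gt0 : 0 < Xi3 c.
Proof. by apply: lt_le_trans Xi3_ge_Q; rewrite divr_gt0// mulr_gt0. Qed.

Lemma Xi2_gt0 : 0 < Xi2 c.
Proof. by rewrite /Xi2 mulr_gt0// divr_gt0. Qed.

Lemma Xi1_ge0 : 0 <= Xi1 c.
Proof.
by rewrite /Xi1; nonneg.
Qed.

Lemma C_tst_ge : 2 <= C_tst c.
Proof.
have h : 0 <= (4 * (1 - rho))^-1
      * (mux * enorm (A1 c) ^+ 2 + muy / 2 * (enorm (A2 c) ^+ 2 + enorm (A3 c) ^+ 2)).
  by nonneg.
by rewrite /C_tst; lra.
Qed.

Let le_Xi3 (t u : R) : 0 < u -> 8 * u * t <= Xi3 c -> (Xi3 c)^-1 * t <= (8 * u)^-1.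
Proof.
move=> u0 h; rewrite ler_pdivrMl ?Xi3_gt0// ler_pdivlMr ?mulr_gt0//.
by rewrite mulrC.
Qed.

Let Xi3_ge_Q' : 64 * (Q_x c * dX ^+ 2 + Q_y c * dY ^+ 2) <= Xi3 c.
Proof.
apply: le_trans Xi3_ge_Q; rewrite ler_peMr//; first by rewrite mulr_ge0// ltW.
by rewrite invf_ge1// lerBlDr lerDl ltW.
Qed.

Lemma KX_small : (Xi3 c)^-1 * KX <= (8 * dX ^+ 2)^-1.
Proof.
apply: le_Xi3 => //; apply: le_trans Xi3_ge_Q'.
have h1 := ler_wpM2r (ltW dX2) (ltW KX_lt_Q).
have h2 : 0 <= Q_x c * dX ^+ 2 by nonneg.
have h3 : 0 <= Q_y c * dY ^+ 2 by nonneg.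
by move: h1 h2 h3; lra.
Qed.

Lemma KY_small : (Xi3 c)^-1 * KY <= (8 * dY ^+ 2)^-1.
Proof.
apply: le_Xi3 => //; apply: le_trans Xi3_ge_Q'.
have h1 := ler_wpM2r (ltW dY2) (ltW KY_lt_Q).
have h2 : 0 <= Q_x c * dX ^+ 2 by nonneg.
have h3 : 0 <= Q_y c * dY ^+ 2 by nonneg.
by move: h1 h2 h3; lra.
Qed.

Local Notation Kc := (enorm (A1 c) ^+ 2 / (16 * (1 + rho))).
Local Notation Ka := (enorm (A2 c) ^+ 2 / (32 * (1 + rho))).
Local Notation Kb := (rho ^+ 2 * enorm (A3 c) ^+ 2 / (32 * (1 + rho))).

Lemma A_small :
  48 * ((Xi3 c)^-1 * (dX ^+ 2 * Kc + 2 * (dY ^+ 2 * (Ka + Kb)))) <= 3 / 16 * (1 - rho).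
Proof.
have r1 : 0 < 1 + rho by rewrite addr_gt0.
set S := enorm (A1 c) ^+ 2 * dX ^+ 2
   + (enorm (A2 c) ^+ 2 + enorm (A3 c) ^+ 2) * dY ^+ 2.
have h : dX ^+ 2 * Kc + 2 * (dY ^+ 2 * (Ka + Kb)) <= S / 16.
  rewrite (_ : dX ^+ 2 * Kc + _ = (1 + rho)^-1 * ((enorm (A1 c) ^+ 2 * dX ^+ 2
   + (enorm (A2 c) ^+ 2 + rho ^+ 2 * enorm (A3 c) ^+ 2) * dY ^+ 2) / 16)); last first.
    by field; rewrite gt_eqF.
  apply: (@le_trans _ _ (1 * (S / 16))); last by rewrite mul1r.
  apply: ler_pM; [by nonneg|by nonneg| |].
    by rewrite invf_le1// lerDl ltW.
  rewrite ler_pM2r// lerD2l ler_pM2r// lerD2l ler_piMl ?sqr_ge0//.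
  by rewrite exprn_ile1 ?ltW//; case/andP: rho01.
have hS : (Xi3 c)^-1 * S <= (1 - rho) / 16.
  rewrite ler_pdivrMl ?Xi3_gt0// -ler_pdivrMr; last by rewrite divr_gt0.
  apply: le_trans Xi3_ge_A; rewrite -/S; apply: le_of_eq.
  by field; rewrite gt_eqF.
have X0 : 0 <= (Xi3 c)^-1 by rewrite invr_ge0 ltW// Xi3_gt0.
have h' := ler_wpM2l X0 h.
by move: h' hS; lra.
Qed.

Let r01 : 0 < (1 + rho) / 2 < 1.
Proof. by move: rho0 rho1 => h h'; apply/andP; split; lra. Qed.

Local Notation b D0 k := (((1 + rho) / 2) `^ (k%:R / 2) * (C_tst c * D0 + Xi1 c) + Xi2 c).

(** [12 / (1 - r) = 24 / (1 - rho)], and the power of [r] in the bias term has half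
    the exponent. *)
Lemma bias_ge D0 k : 0 <= D0 ->
  2 * ((1 + rho) / 2) ^+ k.+1 * D0
    + 12 * (KX * dX ^+ 2 + KY * dY ^+ 2) / (1 - (1 + rho) / 2) <= b D0 k.
Proof.
move=> D00; have /andP[r0 r1] := r01.
apply: lerD; last first.
  rewrite (_ : 1 - _ = (1 - rho) / 2); last by field.
  have q1 := ler_wpM2r (ltW dX2) (ltW KX_lt_Q).
  have q2 := ler_wpM2r (ltW dY2) (ltW KY_lt_Q).
  have q3 := addr_ge0 (mulr_ge0 KX_ge0 (ltW dX2)) (mulr_ge0 KY_ge0 (ltW dY2)).
  rewrite [leLHS](_ : _ = (1 - rho)^-1 * (24 * (KX * dX ^+ 2 + KY * dY ^+ 2))); last first.
    by field; rewrite gt_eqF.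
  rewrite /Xi2 (mulrC 64) -mulrA; apply: ler_wpM2l; first by nonneg.
  by move: q1 q2 q3; lra.
apply: (@le_trans _ _ (((1 + rho) / 2) `^ (k%:R / 2) * (C_tst c * D0))); last first.
  by rewrite ler_wpM2l ?powR_ge0// lerDl Xi1_ge0.
rewrite (mulrC 2) -mulrA; apply: ler_pM.
- by rewrite exprn_ge0// ltW.
- by rewrite mulr_ge0.
- rewrite -powR_mulrn; last exact: ltW.
  apply: ger_powR; first by rewrite r0 ltW.
  by rewrite ler_pdivrMr// -natrM ler_nat; rewrite (leq_trans (leqnSn k))// leq_pmulr.
- by rewrite ler_wpM2r// C_tst_ge.
Qed.

Lemma bias_gt0 D0 k : 0 <= D0 -> 0 < b D0 k.
Proof.
move=> D00; rewrite ltr_pwDr ?Xi2_gt0// mulr_ge0 ?powR_ge0//.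
by rewrite addr_ge0 ?Xi1_ge0// mulr_ge0//; apply: le_trans C_tst_ge.
Qed.

End ConstantBounds.

(** * The iterates and their noise-free counterparts *)

Lemma dot_row4 (R : realType) (a1 a2 a3 a4 : R) (v : 'rV[R]_4) :
  dot (row_of 4 [:: a1; a2; a3; a4]) v
  = a1 * v 0 0 + a2 * v 0 1 + a3 * v 0 (inord 2) + a4 * v 0 (inord 3).
Proof.
rewrite /dot !big_ord_recl big_ord0 !mxE/= addr0 !addrA.
by congr (_ * v 0 _ + _ * v 0 _ + _ * v 0 _ + _ * v 0 _);
  apply/val_inj; rewrite //= inordK.
Qed.

Lemma enorm_subrr (R : realType) k (u : 'rV[R]_k) : enorm (u - u) = 0.
Proof. by rewrite subrr enorm0. Qed.

Section Process.
Context {R : realType} {m n : nat} (c : params R).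
Context (f : 'rV[R]_m -> \bar R) (g : 'rV[R]_n -> \bar R).
Context (Phi : 'rV[R]_m -> 'rV[R]_n -> R).
Context (d dx dy : measure_display) (Omega : measurableType d).
Context (Sx : measurableType dx) (Sy : measurableType dy).
Context (wx : nat -> Omega -> Sx) (wy : nat -> Omega -> Sy).
Context (ox : 'rV[R]_m -> 'rV[R]_n -> Sx -> 'rV[R]_m).
Context (oy : 'rV[R]_m -> 'rV[R]_n -> Sy -> 'rV[R]_n).
Context (x : nat -> Omega -> 'rV[R]_m) (y : nat -> Omega -> 'rV[R]_n).
Context (x0 xs : 'rV[R]_m) (y0 ys : 'rV[R]_n).
Hypothesis Hpb : problem_assumption c f g Phi.
Hypotheses (tau0 : 0 < p_tau c) (sigma0 : 0 < p_sigma c) (theta0 : 0 <= p_theta c).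
Hypothesis rho01 : 0 < p_rho c < 1.
Hypothesis alpha01 : 0 <= p_alpha c < (p_sigma c)^-1.
Hypothesis HMI : MI c.
Hypothesis Hsaddle : saddle_point f g Phi xs ys.
Hypotheses (dx0 : dom f x0) (dy0 : dom g y0).
Hypothesis Hsapd : SAPD c f g wx wy ox oy x y x0 y0.

Local Notation tau := (p_tau c).
Local Notation sigma := (p_sigma c).
Local Notation theta := (p_theta c).
Local Notation rho := (p_rho c).
Local Notation alpha := (p_alpha c).
Local Notation mux := (p_mux c).
Local Notation muy := (p_muy c).
Local Notation Lxx := (p_Lxx c).
Local Notation Lxy := (p_Lxy c).
Local Notation Lyx := (p_Lyx c).
Local Notation Lyy := (p_Lyy c).
Local Notation Dy := (Delta_y Phi wy oy x y).
Local Notation Dx := (Delta_x Phi wx ox x y).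
Local Notation D := (D_dist c x y xs ys).
Local Notation px := (fun u => (tau%:E * f u)%E).
Local Notation py := (fun u => (sigma%:E * g u)%E).
Local Notation mx1 := (1 + tau * mux).
Local Notation my1 := (1 + sigma * muy).

Let rho0 : 0 < rho. Proof. by case/andP: rho01. Qed.
Let mux0 : 0 < mux := pa_mux Hpb.
Let muy0 : 0 < muy := pa_muy Hpb.
Let Lxy0 : 0 < Lxy := pa_Lxy Hpb.
Let Lyx0 : 0 < Lyx := pa_Lyx Hpb.
Let Lxx0 : 0 <= Lxx := pa_Lxx Hpb.
Let Lyy0 : 0 <= Lyy := pa_Lyy Hpb.
Let mx10 : 0 < mx1. Proof. by rewrite addr_gt0// mulr_gt0. Qed.
Let my10 : 0 < my1. Proof. by rewrite addr_gt0// mulr_gt0. Qed.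
Let as1 : 0 < 1 - alpha * sigma.
Proof. by rewrite subr_gt0 -ltr_pdivlMr// div1r; case/andP: alpha01. Qed.
Let alpha0 : 0 <= alpha. Proof. by case/andP: alpha01. Qed.

Let dxs : dom f xs. Proof. by case: (saddle_dom Hpb Hsaddle dx0 dy0). Qed.
Let dys : dom g ys. Proof. by case: (saddle_dom Hpb Hsaddle dx0 dy0). Qed.

Lemma xdom k w : dom f (x k w).
Proof.
case: k => [|k]; first by rewrite (sapd_x0 Hsapd).
exact: (prox_dom (pa_f_ninfty Hpb) tau0 dxs (sapd_x Hsapd k w)).
Qed.

Lemma ydom k w : dom g (y k w).
Proof.
case: k => [|k]; first by rewrite (sapd_y0 Hsapd).
exact: (prox_dom (pa_g_ninfty Hpb) sigma0 dys (sapd_y Hsapd k w)).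
Qed.

(** The momentum vanishes in the first step, as [q_til 0 = 0].  The
    momentum terms below therefore do not see the value of [k.-1] at [k = 0]. *)
Definition th (k : nat) : R := if k is 0%N then 0 else theta.

Lemma th01 k : 0 <= th k <= theta.
Proof. by case: k => [|k] /=; rewrite lexx theta0. Qed.

Definition noise_y k w := Dy k w + th k *: (Dy k w - Dy k.-1 w).

Lemma y_prox k w :
  prox py (yarg c Phi (th k) (x k w) (y k w) (x k.-1 w) (y k.-1 w)
           + sigma *: noise_y k w) (y k.+1 w).
Proof.
suff -> : yarg c Phi (th k) (x k w) (y k w) (x k.-1 w) (y k.-1 w)
    + sigma *: noise_y k w = y k w + sigma *: s_til c wy oy x y k w.
  exact: (sapd_y Hsapd).
rewrite /yarg /noise_y /Delta_y /s_til -addrA -scalerDr; congr (_ + _ *: _).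
case: k => [|k] /=.
  by rewrite !scale0r scaler0 !addr0 addrC subrK.
move: (Gy wy oy x y k.+1 w) (Gy wy oy x y k w) (grad_y Phi _ _) (grad_y Phi _ _).
by move=> u v u' v'; apply/rowP => i; rewrite !mxE; ring.
Qed.

Lemma x_prox k w :
  prox px (xarg c Phi (x k w) (y k.+1 w) - tau *: Dx k w) (x k.+1 w).
Proof.
suff -> : xarg c Phi (x k w) (y k.+1 w) - tau *: Dx k w
    = x k w - tau *: Gx wx ox x y k w.
  exact: (sapd_x Hsapd).
rewrite /xarg /Delta_x -addrA -opprD -scalerDr; congr (_ - _ *: _).
by rewrite addrC subrK.
Qed.

Definition prox_pt k (phi : 'rV[R]_k -> \bar R) z := xget 0 (prox phi z).

Lemma prox_ptx z : prox px z (prox_pt px z).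
Proof. by apply: xgetPex; exact: (prox_x_exists Hpb Hsaddle dx0 dy0 z tau0). Qed.

Lemma prox_pty z : prox py z (prox_pt py z).
Proof. by apply: xgetPex; exact: (prox_y_exists Hpb Hsaddle dx0 dy0 z sigma0). Qed.

(** Outcomes of the updates when the newest noise is removed: [yh] and [xh] replace
    [y k.+1] and [x k.+1], and [yhh] replaces [y k.+2] when the noise of time [k]
    and [k.+1] is absent.  They depend on the past of time [k] only. *)
Definition yh k w :=
  prox_pt py (yarg c Phi (th k) (x k w) (y k w) (x k.-1 w) (y k.-1 w)).
Definition xh k w := prox_pt px (xarg c Phi (x k w) (yh k w)).
Definition yhh k w := prox_pt py (yarg c Phi theta (xh k w) (yh k w) (x k w) (y k w)).

Lemma yh_dom k w : dom g (yh k w).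
Proof. exact: (prox_dom (pa_g_ninfty Hpb) sigma0 dys (prox_pty _)). Qed.

Lemma xh_dom k w : dom f (xh k w).
Proof. exact: (prox_dom (pa_f_ninfty Hpb) tau0 dxs (prox_ptx _)). Qed.

Lemma lip_px z z' u u' : prox px z u -> prox px z' u' ->
  enorm (u - u') <= mx1^-1 * enorm (z - z').
Proof.
move=> pu pu'; rewrite ler_pdivlMl//.
exact: (prox_lipschitz (pa_f_ninfty Hpb) (pa_f_sconvex Hpb) mux0 tau0 dxs pu pu').
Qed.

Lemma lip_py z z' u u' : prox py z u -> prox py z' u' ->
  enorm (u - u') <= my1^-1 * enorm (z - z').
Proof.
move=> pu pu'; rewrite ler_pdivlMl//.
exact: (prox_lipschitz (pa_g_ninfty Hpb) (pa_g_sconvex Hpb) muy0 sigma0 dys pu pu').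
Qed.

Let ys_prox t : prox py (yarg c Phi t xs ys xs ys) ys.
Proof.
rewrite /yarg subrr scaler0 addr0.
exact: (saddle_prox_y Hpb Hsaddle dx0 dy0 sigma0).
Qed.

Let xs_prox : prox px (xarg c Phi xs ys) xs.
Proof. exact: (saddle_prox_x Hpb Hsaddle dx0 dy0 tau0). Qed.

(** * Distances of the noise-free points to the saddle point *)

(** The norms in the order of the entries of the vectors [hatA1], [hatA2], [hatA3].
    At [k = 0] the index [k.-1] reflects the convention that the iterate before
    the first one is the first one. *)
Definition dvec k w : 'rV[R]_4 := row_of 4
  [:: enorm (x k w - xs); enorm (y k w - ys);
      enorm (x k.-1 w - xs); enorm (y k.-1 w - ys)].

Lemma dvecE k w : [/\ dvec k w 0 0 = enorm (x k w - xs),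
  dvec k w 0 1 = enorm (y k w - ys),
  dvec k w 0 (inord 2) = enorm (x k.-1 w - xs) &
  dvec k w 0 (inord 3) = enorm (y k.-1 w - ys)].
Proof. by split; rewrite /dvec mxE ?inordK. Qed.

Lemma yh_dist k w : enorm (yh k w - ys) <= my1^-1 * dot (hatA2 c) (dvec k w).
Proof.
apply: le_trans (lip_py (prox_pty _) (ys_prox (th k))) _.
rewrite ler_pM2l ?invr_gt0//.
have h := yarg_lipschitz Hpb sigma0 (th01 k) (xdom k w) (ydom k w)
  (xdom k.-1 w) (ydom k.-1 w) dxs dys dxs dys.
apply: (le_trans h); rewrite dot_row4; have [-> -> -> ->] := dvecE k w.
by rewrite -lerBlDr; apply: le_of_eq; ring.
Qed.

Lemma xh_dist k w : enorm (xh k w - xs) <= mx1^-1 * dot (hatA1 c) (dvec k w).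
Proof.
apply: le_trans (lip_px (prox_ptx _) xs_prox) _.
rewrite ler_pM2l ?invr_gt0//.
have h := xarg_lipschitz Hpb tau0 (xdom k w) (yh_dom k w) dxs dys.
apply: (le_trans h).
have tL : 0 <= tau * Lxy by rewrite mulr_ge0// ltW.
apply: le_trans (lerD (lexx _) (ler_wpM2l tL (yh_dist k w))) _.
rewrite !dot_row4; have [-> -> -> ->] := dvecE k w.
by apply: le_of_eq; ring.
Qed.

Let Cst0 : 0 <= C_st c. Proof. by rewrite /C_st; nonneg. Qed.

Lemma yhh_dist k w :
  enorm (yhh k w - ys) <= (my1 ^+ 2 * mx1)^-1 * dot (hatA3 c) (dvec k w).
Proof.
apply: le_trans (lip_py (prox_pty _) (ys_prox theta)) _.
have tt : 0 <= theta <= theta by rewrite lexx theta0.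
have h := yarg_lipschitz Hpb sigma0 tt (xh_dom k w) (yh_dom k w)
  (xdom k w) (ydom k w) dxs dys dxs dys.
have my1i : 0 <= my1^-1 by rewrite invr_ge0 ltW.
apply: le_trans (ler_wpM2l my1i h) _.
have s1 : 0 <= sigma * (1 + theta) * Lyx by nonneg.
have h1 := ler_wpM2l Cst0 (yh_dist k w).
have h2 := ler_wpM2l s1 (xh_dist k w).
have := ler_wpM2l my1i (lerD h1 h2).
move: (enorm (yh k w - ys)) (enorm (xh k w - xs)) => e1 e2.
rewrite !dot_row4; have [-> -> -> ->] := dvecE k w.
move: (enorm (x k w - xs)) (enorm (y k w - ys)) (enorm (x k.-1 w - xs))
  (enorm (y k.-1 w - ys)) => X Y X' Y' h12.
rewrite -addrA [leLHS]mulrDr; apply: (le_trans (lerD h12 (lexx _))).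
apply: le_of_eq.
by field; rewrite !gt_eqF.
Qed.

Let sx2 : s_x c ^+ 2 = 2 * rho * tau.
Proof. by rewrite sqr_sqrtr//; nonneg. Qed.
Let sy2 : s_y c ^+ 2 = 2 * rho * sigma / (1 - alpha * sigma).
Proof. by rewrite sqr_sqrtr//; nonneg. Qed.
Let sx0 : 0 < s_x c. Proof. by rewrite sqrtr_gt0 !mulr_gt0. Qed.
Let sy0 : 0 < s_y c. Proof. by rewrite sqrtr_gt0 divr_gt0// !mulr_gt0. Qed.

Lemma D_ge0 k w : 0 <= D k w.
Proof. by rewrite /D_dist; nonneg. Qed.

(** Cauchy-Schwarz with the weights [s_x] and [s_y], which normalise the distances
    so that their squares add up to [(D k + D k.-1) / rho]. *)
Lemma dot_dvec_le (h : 'rV[R]_4) k w :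
  dot h (dvec k w) <= enorm (h *m S_mx c) * Num.sqrt ((D k w + D k.-1 w) / rho).
Proof.
pose v : 'rV[R]_4 := row_of 4
  [:: enorm (x k w - xs) / s_x c; enorm (y k w - ys) / s_y c;
      enorm (x k.-1 w - xs) / s_x c; enorm (y k.-1 w - ys) / s_y c].
have -> : dot h (dvec k w) = dot (h *m S_mx c) v.
  rewrite /dot; apply: eq_bigr => i _; rewrite /S_mx mul_mx_diag !mxE.
  case: i => [[|[|[|[|//]]]] ?] /=; field; rewrite ?(gt_eqF sx0) ?(gt_eqF sy0)//.
have -> : (D k w + D k.-1 w) / rho = enorm v ^+ 2.
  rewrite enorm_sqr dot_row4 !mxE !inordK//= /D_dist.
  rewrite -!expr2 !expr_div_n sx2 sy2.
  by field; rewrite !gt_eqF.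
by rewrite sqrtr_sqr ger0_norm ?enorm_ge0// dot_le_enorm.
Qed.

Lemma dist_sq_le (a K : R) (h : 'rV[R]_4) k w : 0 <= a -> 0 <= K ->
  a <= K * dot h (dvec k w) ->
  a ^+ 2 <= K ^+ 2 * enorm (h *m S_mx c) ^+ 2 / rho * (D k w + D k.-1 w).
Proof.
move=> a0 K0 aK.
have aK' : a <= K * (enorm (h *m S_mx c) * Num.sqrt ((D k w + D k.-1 w) / rho)).
  by apply: (le_trans aK); rewrite ler_wpM2l// dot_dvec_le.
have DD : 0 <= (D k w + D k.-1 w) / rho.
  by apply: divr_ge0; [apply: addr_ge0; exact: D_ge0|exact: ltW].
have -> : K ^+ 2 * enorm (h *m S_mx c) ^+ 2 / rho * (D k w + D k.-1 w) =
    (K * (enorm (h *m S_mx c) * Num.sqrt ((D k w + D k.-1 w) / rho))) ^+ 2.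
  by rewrite 2!exprMn (sqr_sqrtr DD); ring.
rewrite lerXn2r ?nnegrE//; apply: mulr_ge0 => //.
by apply: mulr_ge0; [exact: enorm_ge0|exact: sqrtr_ge0].
Qed.

Let rr0 : 0 <= (1 + rho) / rho. Proof. by nonneg. Qed.

Let normA (K : R) (h : 'rV[R]_4) : enorm ((Num.sqrt ((1 + rho) / rho) * K) *: h) ^+ 2
  = (1 + rho) / rho * K ^+ 2 * enorm h ^+ 2.
Proof. by rewrite enormZ exprMn real_normK ?num_real// exprMn sqr_sqrtr. Qed.

Lemma xh_sq k w : enorm (xh k w - xs) ^+ 2 <=
  enorm (A1 c) ^+ 2 / (16 * (1 + rho)) * (D k w + D k.-1 w).
Proof.
have mi : 0 <= mx1^-1 by rewrite invr_ge0 ltW.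
apply: le_trans (dist_sq_le (enorm_ge0 _) mi (xh_dist k w)) _.
rewrite /A1 normA; apply: le_of_eq.
have r1 : 0 < 1 + rho by rewrite addr_gt0.
by field; rewrite !gt_eqF.
Qed.

Lemma yh_sq k w : ((1 + theta) * enorm (yh k w - ys)) ^+ 2 <=
  enorm (A2 c) ^+ 2 / (32 * (1 + rho)) * (D k w + D k.-1 w).
Proof.
have th1 : 0 <= 1 + theta by rewrite addr_ge0.
have mi : 0 <= (1 + theta) * my1^-1 by nonneg.
have h : (1 + theta) * enorm (yh k w - ys) <= (1 + theta) * my1^-1 * dot (hatA2 c) (dvec k w).
  by rewrite -mulrA ler_wpM2l// yh_dist.
apply: le_trans (dist_sq_le (mulr_ge0 th1 (enorm_ge0 _)) mi h) _.
rewrite /A2 normA; apply: le_of_eq.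
have r1 : 0 < 1 + rho by rewrite addr_gt0.
rewrite (_ : (4 * Num.sqrt 2 * (1 + theta) / my1) ^+ 2 =
  32 * ((1 + theta) / my1) ^+ 2); last first.
  have s2 : Num.sqrt 2 ^+ 2 = 2 :> R by rewrite sqr_sqrtr.
  rewrite (_ : _ ^+ 2 = 16 * Num.sqrt 2 ^+ 2 * ((1 + theta) / my1) ^+ 2); last by ring.
  by rewrite s2; ring.
by field; rewrite !gt_eqF.
Qed.

Lemma yhh_sq k w : (theta * enorm (yhh k w - ys)) ^+ 2 <=
  rho ^+ 2 * enorm (A3 c) ^+ 2 / (32 * (1 + rho)) * (D k w + D k.-1 w).
Proof.
have mi : 0 <= theta * (my1 ^+ 2 * mx1)^-1 by nonneg.
have h : theta * enorm (yhh k w - ys) <=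
    theta * (my1 ^+ 2 * mx1)^-1 * dot (hatA3 c) (dvec k w).
  by rewrite -mulrA ler_wpM2l// yhh_dist.
apply: le_trans (dist_sq_le (mulr_ge0 theta0 (enorm_ge0 _)) mi h) _.
rewrite /A3 normA; apply: le_of_eq.
have r1 : 0 < 1 + rho by rewrite addr_gt0.
rewrite (_ : (4 * Num.sqrt 2 * theta * rho^-1 / (my1 ^+ 2 * mx1)) ^+ 2 =
  32 * (theta / rho / (my1 ^+ 2 * mx1)) ^+ 2); last first.
  have s2 : Num.sqrt 2 ^+ 2 = 2 :> R by rewrite sqr_sqrtr.
  rewrite (_ : _ ^+ 2 = 16 * Num.sqrt 2 ^+ 2 * (theta / rho / (my1 ^+ 2 * mx1)) ^+ 2); last by ring.
  by rewrite s2; ring.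
by field; rewrite !gt_eqF.
Qed.

(** * Effect of the noise on the iterates *)

Definition prev (u : nat -> R) k : R := if k is j.+1 then u j else 0.

Local Notation ny w := (fun k => enorm (Dy k w)).
Local Notation nx w := (fun k => enorm (Dx k w)).

Lemma noise_yE k w : noise_y k w = Dy k w + th k *: (Dy k w - Dy k.-1 w).
Proof. by []. Qed.

(* Up to [potential_le] the noise and the noise-free points are abstract vectors,
   related by the lemmas only. *)
#[local] Opaque Delta_y Delta_x xh yh yhh grad_x grad_y enorm.

Lemma noise_y_le k w :
  enorm (noise_y k w) <= (1 + theta) * ny w k + theta * prev (ny w) k.
Proof.
have th1 : 0 <= 1 + theta by rewrite addr_ge0.
rewrite noise_yE; case: k => [|k] /=.
  by rewrite scale0r addr0 mulr0 addr0 ler_peMl ?enorm_ge0// lerDl.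
rewrite (_ : _ + _ = (1 + theta) *: Dy k.+1 w - theta *: Dy k w); last first.
  by rewrite scalerBr addrA scalerDl scale1r.
apply: le_trans (enormB _ _) _.
rewrite (enormZ (1 + theta)) (enormZ theta).
by rewrite (ger0_norm th1) (ger0_norm theta0).
Qed.

#[local] Opaque noise_y.

Lemma yh_dev k w : enorm (y k.+1 w - yh k w) <= sigma / my1 * enorm (noise_y k w).
Proof.
apply: le_trans (lip_py (y_prox k w) (prox_pty _)) _.
by rewrite addrAC subrr add0r enormZ gtr0_norm// mulrA [my1^-1 * _]mulrC.
Qed.

Lemma xh_dev k w : enorm (x k.+1 w - xh k w) <=
  tau / mx1 * enorm (Dx k w) + tau / mx1 * Lxy * (sigma / my1) * enorm (noise_y k w).
Proof.
apply: le_trans (lip_px (x_prox k w) (prox_ptx _)) _.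
rewrite addrAC.
have h := xarg_lipschitz Hpb tau0 (xdom k w) (ydom k.+1 w) (xdom k w) (yh_dom k w).
have {}h : enorm (xarg c Phi (x k w) (y k.+1 w) - xarg c Phi (x k w) (yh k w))
    <= tau * Lxy * enorm (y k.+1 w - yh k w).
  move: h; rewrite (enorm_subrr (x k w)); move: (enorm _) (enorm _) => u v.
  by rewrite mulr0 add0r.
have mi : 0 <= mx1^-1 by rewrite invr_ge0 ltW.
apply: le_trans (ler_wpM2l mi (enormB _ _)) _.
rewrite enormZ gtr0_norm//.
have tL : 0 <= tau * Lxy by rewrite mulr_ge0// ltW.
have h2 := ler_wpM2l mi (le_trans h (ler_wpM2l tL (yh_dev k w))).
rewrite mulrDr [leLHS]addrC; apply: lerD; last apply: (le_trans h2).
  by apply: le_of_eq; ring.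
by apply: le_of_eq; ring.
Qed.

Lemma yhh_dev k w : enorm (y k.+2 w - yhh k w) <=
  sigma / my1 * enorm (noise_y k.+1 w)
  + F_cst c * (sigma / my1) * enorm (noise_y k w)
  + sigma * (1 + theta) * Lyx * (tau / mx1) / my1 * enorm (Dx k w).
Proof.
apply: le_trans (lip_py (y_prox k.+1 w) (prox_pty _)) _.
rewrite addrAC.
have h := yarg_lipschitz Hpb sigma0 (th01 k.+1) (xdom k.+1 w) (ydom k.+1 w)
  (xdom k w) (ydom k w) (xh_dom k w) (yh_dom k w) (xdom k w) (ydom k w).
have {}h : enorm (yarg c Phi theta (x k.+1 w) (y k.+1 w) (x k w) (y k w)
      - yarg c Phi theta (xh k w) (yh k w) (x k w) (y k w))
    <= C_st c * enorm (y k.+1 w - yh k w)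
       + sigma * (1 + theta) * Lyx * enorm (x k.+1 w - xh k w).
  move: h; rewrite (enorm_subrr (x k w)) (enorm_subrr (y k w)).
  move: (enorm _) (enorm _) (enorm _) => u v u'.
  by rewrite !mulr0 !addr0.
have mi : 0 <= my1^-1 by rewrite invr_ge0 ltW.
apply: le_trans (ler_wpM2l mi (enormD _ _)) _.
rewrite enormZ gtr0_norm//.
have s1 : 0 <= sigma * (1 + theta) * Lyx by nonneg.
have h1 := ler_wpM2l Cst0 (yh_dev k w).
have h2 := ler_wpM2l s1 (xh_dev k w).
have h3 := ler_wpM2l mi (le_trans h (lerD h1 h2)).
rewrite mulrDr -lerBrDr; apply: (le_trans h3).
have alg e1 e2 e3 : my1^-1 * (C_st c * (sigma / my1 * e2)
      + sigma * (1 + theta) * Lyx * (tau / mx1 * e3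
        + tau / mx1 * Lxy * (sigma / my1) * e2))
    = sigma / my1 * e1 + F_cst c * (sigma / my1) * e2
      + sigma * (1 + theta) * Lyx * (tau / mx1) / my1 * e3
      - my1^-1 * (sigma * e1).
  by rewrite /F_cst; move: (C_st c) => C; field; rewrite !gt_eqF.
by rewrite (alg (enorm (noise_y k.+1 w))).
Qed.

(** * The Lyapunov recursion *)

(** The vectors paired with the noise of time [k] in the recursion: [av] and [cv] at
    time [k], [bv] one step later. *)
Definition av k w := (1 + th k) *: (yh k w - ys).
Definition bv k w := theta *: (yhh k w - ys).
Definition cv k w := xh k w - xs.
Definition pending k w := if k is j.+1 then dot (Dy j w) (bv j w) else 0.

Lemma av_sq k w : enorm (av k w) ^+ 2 <=
  enorm (A2 c) ^+ 2 / (32 * (1 + rho)) * (D k w + D k.-1 w).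
Proof.
apply: le_trans (yh_sq k w).
have /andP[t0 tt] := th01 k.
rewrite /av enormZ ger0_norm ?addr_ge0//.
rewrite lerXn2r ?nnegrE ?mulr_ge0 ?addr_ge0 ?enorm_ge0//.
by rewrite ler_wpM2r ?enorm_ge0// lerD2l.
Qed.

Lemma bv_sq k w : enorm (bv k w) ^+ 2 <=
  rho ^+ 2 * enorm (A3 c) ^+ 2 / (32 * (1 + rho)) * (D k w + D k.-1 w).
Proof.
by apply: le_trans (yhh_sq k w); rewrite /bv enormZ ger0_norm.
Qed.

(** Each pairing with an iterate is a pairing with the noise-free point plus an
    error bounded by the [_dev] lemmas; the errors are collected by
    [noise_quadratic]. *)
Lemma noise_le k w :
  dot (noise_y k w) (y k.+1 w - ys) - dot (Dx k w) (x k.+1 w - xs)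
  <= dot (Dy k w) (av k w) - pending k w - dot (Dx k w) (cv k w)
   + (C_x c * nx w k ^+ 2 + rho * C_x1 c * prev (nx w) k ^+ 2
     + C_y c * ny w k ^+ 2 + rho * C_y1 c * prev (ny w) k ^+ 2
     + rho ^+ 2 * C_y2 c * prev (prev (ny w)) k ^+ 2).
Proof.
have th1 : 0 <= 1 + theta by rewrite addr_ge0.
have sm : 0 <= sigma / my1 by nonneg.
have prev0 (u : nat -> R) j : (forall i, 0 <= u i) -> 0 <= prev u j.
  by move=> u0; case: j => [|j] /=.
have ny0 j : 0 <= ny w j by exact: enorm_ge0.
have nx0 j : 0 <= nx w j by exact: enorm_ge0.
have F0 : 0 <= F_cst c by rewrite /F_cst; nonneg.
have Lm : 0 <= tau / mx1 * Lxy * (sigma / my1) by nonneg.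
have := @noise_quadratic _ c tau0 sigma0 theta0 rho01 Lxy0 Lyx0 Lyy0 mux0 muy0
  (ny w k) (prev (ny w) k) (prev (prev (ny w)) k) (nx w k) (prev (nx w) k)
  (ny0 k) (prev0 _ k ny0) (prev0 _ k (fun j => prev0 _ j ny0)) (nx0 k) (prev0 _ k nx0).
set quad := (X in _ <= X -> _) => hq.
set T1 := (1 + theta) * _ * _ in hq.
have P1 : dot (Dy k w) ((1 + th k) *: (y k.+1 w - yh k w)) <= T1.
  apply: le_trans (dot_le_enorm _ _) _.
  have /andP[t0 tt] := th01 k.
  rewrite enormZ ger0_norm ?addr_ge0// /T1 mulrCA -mulrA.
  apply: ler_pM; rewrite ?addr_ge0 ?mulr_ge0 ?enorm_ge0 ?lerD2l//.
  rewrite ler_wpM2l// ; apply: le_trans (yh_dev k w) _.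
  by rewrite ler_wpM2l// noise_y_le.
set T2 := theta * _ * _ in hq.
have P2 : th k * dot (Dy k.-1 w) (y k.+1 w - ys) >= pending k w - T2.
  rewrite /T2 /pending; case: (k) => [|j] /=.
    by rewrite mul0r mulr0 mul0r subr0.
  rewrite /bv dotZr -mulrA -mulrBr ler_wpM2l// lerBlDr -lerBlDl -dotBr.
  rewrite (_ : yhh j w - ys - (y j.+2 w - ys) = yhh j w - y j.+2 w); last first.
    by rewrite opprB addrA subrK.
  apply: le_trans (dot_le_enorm _ _) _; rewrite ler_wpM2l ?enorm_ge0//.
  rewrite enormC; apply: le_trans (yhh_dev j w) _.
  rewrite lerD2r; apply: lerD; rewrite ler_wpM2l ?noise_y_le// ?mulr_ge0//.
    exact: ltW.
  by rewrite invr_ge0 ltW.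
set T3 := nx w k * _ in hq.
have P3 : - dot (Dx k w) (x k.+1 w - xh k w) <= T3.
  rewrite -dotNr; apply: le_trans (dot_le_enorm _ _) _.
  rewrite enormN ler_wpM2l ?enorm_ge0//.
  apply: le_trans (xh_dev k w) _.
  by rewrite lerD2l ler_wpM2l// noise_y_le.
have E1 : dot (noise_y k w) (y k.+1 w - ys) = dot (Dy k w) (av k w)
    + dot (Dy k w) ((1 + th k) *: (y k.+1 w - yh k w))
    - th k * dot (Dy k.-1 w) (y k.+1 w - ys).
  rewrite noise_yE /av.
  move: (Dy k w) (Dy k.-1 w) (y k.+1 w) (yh k w) => a b u v.
  by rewrite !dotE; ring.
have E2 : dot (Dx k w) (x k.+1 w - xs) = dot (Dx k w) (cv k w)
    + dot (Dx k w) (x k.+1 w - xh k w).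
  rewrite /cv; move: (Dx k w) (x k.+1 w) (xh k w) => a u v.
  by rewrite !dotE; ring.
rewrite {}E1 {}E2 -[X in _ <= _ + X]/quad.
move: hq P1 P2 P3.
move: (dot (Dy k w) (av k w)) (dot (Dy k w) ((1 + th k) *: _)) => d1 d2.
move: (th k * _) (pending k w) (dot (Dx k w) (cv k w)) => d3 d4 d5.
move: (dot (Dx k w) _) => d6; move: T1 T2 T3 quad => t1 t2 t3 q hq P1 P2 P3.
lra.
Qed.

(** An upper bound of the potential in which every noise term belongs to the
    current step, apart from the pending one. *)
Fixpoint Wr k w : R := if k is j.+1 then
  rho * (Wr j w + dot (Dy j w) (av j w) - pending j w - dot (Dx j w) (cv j w)
    + (C_x c + C_x1 c) * nx w j ^+ 2 + (C_y c + C_y1 c + C_y2 c) * ny w j ^+ 2)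
  else D_init c xs ys x0 y0.

Let qv k w := grad_y Phi (x k w) (y k w) - grad_y Phi (x k.-1 w) (y k.-1 w).

(** The last three terms of the left-hand side are the squares of old noise
    norms that [noise_le] will produce in the following steps; storing them here
    makes [Wr] depend on the newest noise only. *)
Lemma potential_le k w z :
  (2 * tau)^-1 * enorm (x k w - xs) ^+ 2 + (2 * sigma)^-1 * enorm (y k w - ys) ^+ 2
  + th k * dot (qv k w) (y k w - ys + z) - alpha / 2 * enorm z ^+ 2
  + ((rho * C_y1 c + rho * C_y2 c) * prev (ny w) k ^+ 2
     + rho ^+ 2 * C_y2 c * prev (prev (ny w)) k ^+ 2
     + rho * C_x1 c * prev (nx w) k ^+ 2) <= Wr k w.
Proof.
elim: k z => [|k IH] z.
  rewrite /= (sapd_x0 Hsapd) (sapd_y0 Hsapd) mul0r addr0 !expr0n/= !mulr0 !addr0.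
  by rewrite /D_init gerBl mulr_ge0 ?sqr_ge0// divr_ge0.
have st : (1 + tau * p_mux c) / (2 * tau) * enorm (x k.+1 w - xs) ^+ 2
  + (1 + sigma * p_muy c) / (2 * sigma) * enorm (y k.+1 w - ys) ^+ 2
  + (dot (qv k.+1 w) (y k.+1 w - ys) - th k * dot (qv k w) (y k.+1 w - ys))
  + ((2 * tau)^-1 - p_Lxx c / 2) * enorm (x k.+1 w - x k w) ^+ 2
  + (2 * sigma)^-1 * enorm (y k.+1 w - y k w) ^+ 2
  <= (2 * tau)^-1 * enorm (x k w - xs) ^+ 2 + (2 * sigma)^-1 * enorm (y k w - ys) ^+ 2
     + dot (noise_y k w) (y k.+1 w - ys) - dot (Dx k w) (x k.+1 w - xs).
  have -> : dot (qv k.+1 w) (y k.+1 w - ys) - th k * dot (qv k w) (y k.+1 w - ys)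
    = dot (grad_y Phi (x k.+1 w) (y k.+1 w)
           - (grad_y Phi (x k w) (y k w) + th k *: qv k w)) (y k.+1 w - ys).
    rewrite /qv /=; move: (grad_y Phi (x k.+1 w) _) (grad_y Phi (x k w) (y k w)).
    move=> u v; move: (v - _) => q.
    by rewrite -dotZl -dotBl opprD addrA.
  apply: (one_step Hpb Hsaddle dx0 dy0 tau0 sigma0 (xdom k w) (ydom k w)).
    suff -> : y k w + sigma *: (grad_y Phi (x k w) (y k w) + th k *: qv k w + noise_y k w)
      = yarg c Phi (th k) (x k w) (y k w) (x k.-1 w) (y k.-1 w) + sigma *: noise_y k w.
      exact: y_prox.
    by rewrite /yarg scalerDr addrA.
  suff -> : x k w - tau *: (grad_x Phi (x k w) (y k.+1 w) + Dx k w)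
    = xarg c Phi (x k w) (y k.+1 w) - tau *: Dx k w.
    exact: x_prox.
  by rewrite /xarg scalerDr opprD addrA.
have mi := MI_potential HMI tau0 sigma0 theta0 rho01 (y k.+1 w - ys) z
  (sqr_ge0 (enorm (x k.+1 w - xs))) (enorm_ge0 (x k.+1 w - x k w))
  (enorm_ge0 (y k.+1 w - y k w))
  (pa_lip_y Hpb (xdom k.+1 w) (ydom k.+1 w) (xdom k w) (ydom k w)).
have ih := IH (y k.+1 w - y k w).
have nq := noise_le k w.
have ez : y k w - ys + (y k.+1 w - y k w) = y k.+1 w - ys.
  by rewrite addrC addrA subrK.
rewrite {}ez in ih.
rewrite -/(qv k.+1 w) in mi.
rewrite [th k.+1]/= [prev _ k.+1]/= [prev (nx w) k.+1]/= [prev (prev _) k.+1]/=.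
rewrite [Wr k.+1 w]/=.
move: st mi ih nq {IH}.
move: (dot (qv k.+1 w) (y k.+1 w - ys + z)) => v1.
move: (dot (qv k.+1 w) _) (th k * _) (dot (noise_y _ _) _) (dot _ (x k.+1 w - xs)).
move=> v2 v3 v4 v5.
move: (dot _ _) (pending _ _) (dot _ _) (enorm z ^+ 2) (Wr k w) => v6 v7 v8 v9 W.
move: (prev (nx w) k ^+ 2) (prev (prev (ny w)) k ^+ 2) (prev (ny w) k ^+ 2) => v10 v11 v12.
move: (enorm (Dx k w) ^+ 2) (enorm (Dy k w) ^+ 2) => v13 v14.
move: (enorm (x k w - xs) ^+ 2) (enorm (y k w - ys) ^+ 2) => v15 v16.
move: (enorm (x k.+1 w - xs) ^+ 2) (enorm (y k.+1 w - ys) ^+ 2) => v17 v18.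
move: (enorm (x k.+1 w - x k w) ^+ 2) (enorm (y k.+1 w - y k w) ^+ 2) => v19 v20.
move: (C_x c) (C_y c) (C_x1 c) (C_y1 c) (C_y2 c) => cx cy cx1 cy1 cy2.
move: (2 * tau)^-1 (2 * sigma)^-1 => it1 is1 st mi ih nq.
set M := (X in rho^-1 * X <= _) in mi.
suff h : rho^-1 * M <= W + v8 - v7 - v6 + cx * v13 + cy * v14
    - rho * cy2 * v12.
  rewrite ler_pdivrMl// in h.
  by move: h; rewrite /M; lra.
by move: st mi ih nq; lra.
Qed.

(** The potential at [z = ys - y k]. *)
Lemma D_le_W k w : D k w <= Wr k w.
Proof.
apply: le_trans (potential_le k w (- (y k w - ys))).
have Cx1 : 0 <= C_x1 c by rewrite /C_x1; nonneg.
have F0 : 0 <= F_cst c by rewrite /F_cst; nonneg.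
have Cy1 : 0 <= C_y1 c by rewrite /C_y1; nonneg.
have Cy2 : 0 <= C_y2 c by rewrite /C_y2; nonneg.
rewrite subrr dotC dot0l mulr0 addr0 enormN -[leLHS]addr0.
apply: lerD.
  rewrite /D_dist; apply: le_of_eq.
  by move: (enorm (y k w - ys)) => e; field; rewrite !gt_eqF.
have p0 (u : nat -> R) j : 0 <= prev u j ^+ 2 by exact: sqr_ge0.
by nonneg.
Qed.

#[local] Transparent Delta_y Delta_x xh yh yhh grad_x grad_y enorm noise_y.

(** * Measurability of the iterates *)

Context (P : probability Omega R).
Hypothesis Hnoise : noise_assumption c Phi P wx wy ox oy x y.

Let xd k w : dom f (x k w). Proof. exact: xdom. Qed.
Let yd k w : dom g (y k w). Proof. exact: ydom. Qed.
Let xhd k w : dom f (xh k w). Proof. exact: xh_dom. Qed.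
Let yhd k w : dom g (yh k w). Proof. exact: yh_dom. Qed.

(** [history b a] is the sigma-algebra generated by [hist_gen b a]. *)
Definition hist_gen (b a : nat) : set (set Omega) :=
  [set A | (exists2 j, (j < b)%N &
              exists2 B : set Sy, measurable B & A = wy j @^-1` B) \/
           (exists2 j, (j < a)%N &
              exists2 B : set Sx, measurable B & A = wx j @^-1` B)].

Lemma hist_gen_mono b a b' a' : (b <= b')%N -> (a <= a')%N ->
  hist_gen b a `<=` hist_gen b' a'.
Proof.
move=> bb aa A [[j jb [B mB ->]]|[j ja [B mB ->]]].
  by left; exists j; [exact: leq_trans bb|exists B].
by right; exists j; [exact: leq_trans aa|exists B].
Qed.

Lemma hist_gen_measurable b a : hist_gen b a `<=` @measurable _ Omega.
Proof.
move=> A [[j _ [B mB ->]]|[j _ [B mB ->]]].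
  by rewrite -[X in measurable X]setTI; exact: (na_wy Hnoise j).
by rewrite -[X in measurable X]setTI; exact: (na_wx Hnoise j).
Qed.

Let adap b a b' a' k (u : Omega -> 'rV[R]_k) : adapted (hist_gen b a) u ->
  (b <= b')%N -> (a <= a')%N -> adapted (hist_gen b' a') u.
Proof. by move=> mu bb aa; apply: adapted_mono mu; exact: hist_gen_mono. Qed.

Lemma adapted_Gy k : adapted (hist_gen k.+1 k) (Gy wy oy x y k).
Proof. by move=> i; exact: (na_Gy_adapted Hnoise). Qed.

Lemma adapted_Gx k : adapted (hist_gen k.+1 k.+1) (Gx wx ox x y k).
Proof. by move=> i; exact: (na_Gx_adapted Hnoise). Qed.

Section Prox.
Variable G : set (set Omega).

(** The proximal map is Lipschitz. *)
Lemma adapted_prox_x (z u : Omega -> 'rV[R]_m) :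
  (forall w, prox px (z w) (u w)) -> adapted G z -> adapted G u.
Proof.
move=> pu mz; apply: (@adapted_lipschitz _ _ _ _ _ _ _ _ _ _ mx1^-1 mz mz).
  by rewrite invr_ge0 ltW.
move=> w w'; apply: le_trans (lip_px (pu w) (pu w')) _.
by rewrite ler_pM2l ?invr_gt0// lerDl enorm_ge0.
Qed.

Lemma adapted_prox_y (z u : Omega -> 'rV[R]_n) :
  (forall w, prox py (z w) (u w)) -> adapted G z -> adapted G u.
Proof.
move=> pu mz; apply: (@adapted_lipschitz _ _ _ _ _ _ _ _ _ _ my1^-1 mz mz).
  by rewrite invr_ge0 ltW.
move=> w w'; apply: le_trans (lip_py (pu w) (pu w')) _.
by rewrite ler_pM2l ?invr_gt0// lerDl enorm_ge0.
Qed.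

Variables (u : Omega -> 'rV[R]_m) (v : Omega -> 'rV[R]_n).
Hypotheses (du : forall w, dom f (u w)) (dv : forall w, dom g (v w)).
Hypotheses (mu : adapted G u) (mv : adapted G v).

Lemma adapted_grad_x : adapted G (fun w => grad_x Phi (u w) (v w)).
Proof.
apply: (@adapted_lipschitz _ _ _ _ _ _ _ _ _ _ (Lxx + Lxy) mu mv).
  by rewrite addr_ge0// ltW.
move=> w w'; apply: le_trans (pa_lip_x Hpb (du w) (dv w) (du w') (dv w')) _.
by rewrite mulrDr; apply: lerD; rewrite ler_wpM2r ?enorm_ge0 ?lerDl ?lerDr// ltW.
Qed.

Lemma adapted_grad_y : adapted G (fun w => grad_y Phi (u w) (v w)).
Proof.
apply: (@adapted_lipschitz _ _ _ _ _ _ _ _ _ _ (Lyx + Lyy) mu mv).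
  by rewrite addr_ge0// ltW.
move=> w w'; apply: le_trans (pa_lip_y Hpb (du w) (dv w) (du w') (dv w')) _.
by rewrite mulrDr; apply: lerD; rewrite ler_wpM2r ?enorm_ge0 ?lerDl ?lerDr// ltW.
Qed.

End Prox.

Let adapted_s_til k : adapted (hist_gen k.+1 k) (s_til c wy oy x y k).
Proof.
apply: adaptedD; first exact: adapted_Gy.
apply: adaptedZ; case: k => [|k]; first exact: adapted_cst.
apply: adaptedB; first exact: adapted_Gy.
by apply: (adap (@adapted_Gy k)).
Qed.

Let adapted_y_next_of k :
  adapted (hist_gen k k) (y k) -> adapted (hist_gen k.+1 k) (y k.+1).
Proof.
move=> my; apply: (adapted_prox_y (sapd_y Hsapd k)); apply: adaptedD.
  by apply: (adap my).
by apply: adaptedZ; exact: adapted_s_til.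
Qed.

Let adapted_iterates k : adapted (hist_gen k k) (x k) /\ adapted (hist_gen k k) (y k).
Proof.
elim: k => [|k [IHx IHy]].
  split; [rewrite (_ : x 0 = fun _ => x0)|rewrite (_ : y 0 = fun _ => y0)];
    try exact: adapted_cst; apply/funext => w.
    exact: (sapd_x0 Hsapd).
  exact: (sapd_y0 Hsapd).
split; last by apply: (adap (@adapted_y_next_of k IHy)).
apply: (adapted_prox_x (sapd_x Hsapd k)); apply: adaptedB; first by apply: (adap IHx).
by apply: adaptedZ; exact: adapted_Gx.
Qed.

Lemma adapted_x k : adapted (hist_gen k k) (x k).
Proof. by case: (adapted_iterates k). Qed.

Lemma adapted_y k : adapted (hist_gen k k) (y k).
Proof. by case: (adapted_iterates k). Qed.

Lemma adapted_Dy k : adapted (hist_gen k.+1 k) (Dy k).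
Proof.
apply: adaptedB; first exact: adapted_Gy.
by apply: adapted_grad_y => //; [exact: (adap (@adapted_x k))|exact: (adap (@adapted_y k))].
Qed.

Lemma adapted_Dx k : adapted (hist_gen k.+1 k.+1) (Dx k).
Proof.
apply: adaptedB; first exact: adapted_Gx.
by apply: adapted_grad_x => //; [exact: (adap (@adapted_x k))|exact: adapted_y].
Qed.

Let adapted_yarg G t (u u' : Omega -> 'rV[R]_m) (v v' : Omega -> 'rV[R]_n) :
  (forall w, dom f (u w)) -> (forall w, dom g (v w)) ->
  (forall w, dom f (u' w)) -> (forall w, dom g (v' w)) ->
  adapted G u -> adapted G v -> adapted G u' -> adapted G v' ->
  adapted G (fun w => yarg c Phi t (u w) (v w) (u' w) (v' w)).
Proof.
move=> du dv du' dv' mu mv mu' mv'; rewrite /yarg.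
apply: adaptedD => //; apply: adaptedZ; apply: adaptedD; first exact: adapted_grad_y.
by apply: adaptedZ; apply: adaptedB; exact: adapted_grad_y.
Qed.

Let pred_adap k l (u : Omega -> 'rV[R]_l) :
  adapted (hist_gen k.-1 k.-1) u -> adapted (hist_gen k k) u.
Proof. by move=> mu; apply: adap mu _ _; exact: leq_pred. Qed.

Lemma adapted_yh k : adapted (hist_gen k k) (yh k).
Proof.
apply: adapted_prox_y => [w|]; first exact: prox_pty.
apply: adapted_yarg => //; first exact: adapted_x.
- exact: adapted_y.
- by apply: pred_adap; exact: adapted_x.
- by apply: pred_adap; exact: adapted_y.
Qed.


Lemma adapted_xh k : adapted (hist_gen k k) (xh k).
Proof.
apply: adapted_prox_x => [w|]; first exact: prox_ptx.
apply: adaptedB; first exact: adapted_x.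
by apply: adaptedZ; apply: adapted_grad_x => //; [exact: adapted_x|exact: adapted_yh].
Qed.

Lemma adapted_yhh k : adapted (hist_gen k k) (yhh k).
Proof.
apply: adapted_prox_y => [w|]; first exact: prox_pty.
apply: adapted_yarg => //.
- exact: adapted_xh.
- exact: adapted_yh.
- exact: adapted_x.
- exact: adapted_y.
Qed.

Lemma adapted_av k : adapted (hist_gen k k) (av k).
Proof.
by apply: adaptedZ; apply: adaptedB; [exact: adapted_yh|exact: adapted_cst].
Qed.

Lemma adapted_bv k : adapted (hist_gen k k) (bv k).
Proof.
by apply: adaptedZ; apply: adaptedB; [exact: adapted_yhh|exact: adapted_cst].
Qed.

Lemma adapted_cv k : adapted (hist_gen k k) (cv k).
Proof. by apply: adaptedB; [exact: adapted_xh|exact: adapted_cst]. Qed.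

Lemma sub_measurable_D k : sub_measurable <<s hist_gen k k >> (D k).
Proof.
apply: sub_measurableD; apply: sub_measurableZ; apply: sub_measurable_normsq;
  apply: adaptedB; try exact: adapted_cst.
  exact: adapted_x.
exact: adapted_y.
Qed.

Lemma sub_measurable_Dp k : sub_measurable <<s hist_gen k k >> (D k.-1).
Proof.
apply: sub_measurable_mono (@sub_measurable_D _).
by apply: hist_gen_mono; exact: leq_pred.
Qed.

Lemma sub_measurable_pending k : sub_measurable <<s hist_gen k k >> (pending k).
Proof.
case: k => [|k]; first exact: sub_measurable_cst.
apply: adapted_dot; first exact: (adap (@adapted_Dy k)).
exact: (adap (@adapted_bv k)).
Qed.

Lemma sub_measurable_W k : sub_measurable <<s hist_gen k k >> (Wr k).
Proof.
elim: k => [|k IH]; first exact: sub_measurable_cst.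
have up : hist_gen k k `<=` hist_gen k.+1 k.+1 by exact: hist_gen_mono.
have mDy : adapted (hist_gen k.+1 k.+1) (Dy k) by exact: (adap (@adapted_Dy k)).
have mDx := @adapted_Dx k.
apply: sub_measurableZ; apply: sub_measurableD; last first.
  by apply: sub_measurableZ; exact: sub_measurable_normsq.
apply: sub_measurableD; last first.
  by apply: sub_measurableZ; apply: sub_measurable_normsq; exact: mDx.
apply: sub_measurableB; last first.
  by apply: adapted_dot => //; apply: (adapted_mono up); exact: adapted_cv.
apply: sub_measurableB; last first.
  by apply: (sub_measurable_mono up); exact: sub_measurable_pending.
apply: sub_measurableD; first exact: (sub_measurable_mono up).
by apply: adapted_dot => //; apply: (adapted_mono up); exact: adapted_av.
Qed.

Lemma measurable_D k : measurable_fun setT (D k).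
Proof. exact: (sub_measurable_fun (@hist_gen_measurable k k) (@sub_measurable_D k)). Qed.

(** [mgf_bound] with [lam = 1 / Xi3]. *)
Lemma mgf_D k : (\int[P]_w (expR (D k.+1 w / Xi3 c))%:E <=
  (expR ((((1 + rho) / 2) `^ (k%:R / 2) * (C_tst c * D_init c xs ys x0 y0 + Xi1 c)
          + Xi2 c) / Xi3 c))%:E)%E.
Proof.
have dX0 := na_deltax Hnoise; have dY0 := na_deltay Hnoise.
have D00 : 0 <= D_init c xs ys x0 y0 by rewrite /D_init; nonneg.
have X0 : 0 < Xi3 c by exact: Xi3_gt0.
have r1 : 0 <= 1 + rho by nonneg.
under eq_integral do rewrite mulrC.
apply: (@le_trans _ _ (expR ((Xi3 c)^-1 * (2 * ((1 + rho) / 2) ^+ k.+1 * D_init c xs ys x0 y0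
    + 12 * ((C_x c + C_x1 c) * p_deltax c ^+ 2
           + (C_y c + C_y1 c + C_y2 c) * p_deltay c ^+ 2) / (1 - (1 + rho) / 2))))%:E); last first.
  rewrite lee_fin ler_expR mulrC ler_pM2r ?invr_gt0//.
  exact: bias_ge.
apply: (@mgf_bound _ Omega R P m n (fun k => hist_gen k.+1 k) (fun k => hist_gen k k)
  D Wr pending Dy av bv Dx cv rho (Xi3 c)^-1 (C_x c + C_x1 c) (C_y c + C_y1 c + C_y2 c)
  (p_deltax c) (p_deltay c) (enorm (A1 c) ^+ 2 / (16 * (1 + rho)))
  (enorm (A2 c) ^+ 2 / (32 * (1 + rho)))
  (rho ^+ 2 * enorm (A3 c) ^+ 2 / (32 * (1 + rho)))).
- by move=> k'; exact: hist_gen_measurable.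
- by move=> k'; exact: hist_gen_mono.
- exact: sub_measurable_D.
- exact: sub_measurable_Dp.
- exact: sub_measurable_W.
- exact: sub_measurable_pending.
- exact: adapted_av.
- exact: adapted_bv.
- exact: adapted_cv.
- exact: adapted_Dy.
- exact: D_ge0.
- exact: D_le_W.
- by [].
- by [].
- by [].
- by [].
- by move=> k' w; exact: av_sq.
- by move=> k' w; exact: bv_sq.
- by move=> k' w; exact: xh_sq.
- exact: rho01.
- by rewrite invr_gt0.
- exact: dX0.
- exact: dY0.
- exact: KX_ge0.
- exact: KY_ge0.
- by nonneg.
- by nonneg.
- by nonneg.
- exact: KX_small.
- exact: KY_small.
- exact: A_small.
- by move=> k' i; exact: (na_mean_y Hnoise).
- by move=> k' i; exact: (na_mean_x Hnoise).
- by move=> k' t; exact: (na_tail_y Hnoise).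
- by move=> k' t; exact: (na_tail_x Hnoise).
Qed.

End Process.

(** * The risk bounds *)

Theorem theorem10 (R : realType) (m n : nat) (c : params R)
    (f : 'rV[R]_m -> \bar R) (g : 'rV[R]_n -> \bar R)
    (Phi : 'rV[R]_m -> 'rV[R]_n -> R)
    (d dx dy : measure_display) (Omega : measurableType d)
    (Sx : measurableType dx) (Sy : measurableType dy)
    (P : probability Omega R)
    (wx : nat -> Omega -> Sx) (wy : nat -> Omega -> Sy)
    (ox : 'rV[R]_m -> 'rV[R]_n -> Sx -> 'rV[R]_m)
    (oy : 'rV[R]_m -> 'rV[R]_n -> Sy -> 'rV[R]_n)
    (x : nat -> Omega -> 'rV[R]_m) (y : nat -> Omega -> 'rV[R]_n)
    (x0 xs : 'rV[R]_m) (y0 ys : 'rV[R]_n)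
    (Hpb : problem_assumption c f g Phi)
    (Htau : 0 < p_tau c) (Hsigma : 0 < p_sigma c) (Htheta : 0 <= p_theta c)
    (Hrho : 0 < p_rho c < 1) (Halpha : 0 <= p_alpha c < (p_sigma c)^-1)
    (HMI : MI c)
    (Hsaddle : saddle_point f g Phi xs ys)
    (Hx0 : dom f x0) (Hy0 : dom g y0)
    (Hsapd : SAPD c f g wx wy ox oy x y x0 y0)
    (Hnoise : noise_assumption c Phi P wx wy ox oy x y) :
  let D0 := D_init c xs ys x0 y0 in
  let sqrtD := fun k w => Num.sqrt (D_dist c x y xs ys k w) in
  (forall (k : nat) (p : R), 0 <= p < 1 ->
     (CVaR P (sqrtD k.+1) p <= (CVaR_bound c D0 k p)%:E)%E /\
     (EVaR P (sqrtD k.+1) p <= (EVaR_bound c D0 k p)%:E)%E) /\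
  (forall (k : nat) (r : R), 0 < r ->
     (chi2_risk P (sqrtD k.+1) r
        <= (EVaR_bound c D0 k (1 - 1 / (1 + r)))%:E)%E).
Proof.
move=> D0 sqrtD.
have D00 : 0 <= D0 by rewrite /D0 /D_init; nonneg.
pose b k := ((1 + p_rho c) / 2) `^ (k%:R / 2) * (C_tst c * D0 + Xi1 c) + Xi2 c.
have mux0 := pa_mux Hpb; have muy0 := pa_muy Hpb.
have Lxx0 := pa_Lxx Hpb; have Lyy0 := pa_Lyy Hpb.
have Lxy0 := pa_Lxy Hpb; have Lyx0 := pa_Lyx Hpb.
have dX0 := na_deltax Hnoise; have dY0 := na_deltay Hnoise.
have b0 k : 0 < b k by exact: bias_gt0.
have X0 : 0 < Xi3 c by exact: Xi3_gt0.
have Dge0 k w : 0 <= D_dist c x y xs ys k w by exact: (D_ge0 _ _ _ _ Htau Hsigma Halpha).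
have mD k := measurable_D Hpb Htau Hsigma Hsaddle Hx0 Hy0 Hsapd Hnoise k.
have mgf k := mgf_D Hpb Htau Hsigma Htheta Hrho Halpha HMI Hsaddle Hx0 Hy0 Hsapd Hnoise k.
have sqrtD_le (u v : R) : 0 <= u -> 0 <= v -> Num.sqrt (u + v) <= Num.sqrt u + Num.sqrt v.
  move=> u0 v0; rewrite -(ler_pXn2r (n := 2)) ?nnegrE ?addr_ge0 ?sqrtr_ge0//.
  rewrite sqrrD !sqr_sqrtr ?addr_ge0// -addrA lerD2l lerDr.
  by rewrite mulrn_wge0// mulr_ge0 ?sqrtr_ge0.
(* The bound at [l] covers arguments up to [l + pi]: the summand [sqrt pi] is
   what the chi-square case uses. *)
have EVaR_le k (u l : R) : 0 <= l -> u <= l + pi ->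
    0 <= u -> Num.sqrt (b k + Xi3 c * u) <=
      bias_term c D0 k + Num.sqrt (Xi3 c) * (Num.sqrt l + Num.sqrt pi).
  move=> l0 ul u0; apply: le_trans (sqrtD_le _ _ (ltW (b0 k)) _) _.
    by rewrite mulr_ge0// ltW.
  rewrite /bias_term -/(b k) lerD2l sqrtrM; last exact: ltW.
  rewrite ler_wpM2l ?sqrtr_ge0//.
  apply: le_trans (sqrtD_le _ _ l0 (pi_ge0 _)).
  by rewrite ler_wsqrtr.
have lnp_ge0 (p : R) : 0 <= p < 1 -> 0 <= ln (1 / (1 - p)).
  move=> /andP[p0 p1]; rewrite ln_ge0// div1r invf_ge1 ?subr_gt0//.
  by rewrite lerBlDr lerDl.
split=> [k p p01|k r r0].
  have l0 := lnp_ge0 _ p01; split.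
    have h := CVaR_sqrt_le (mD k.+1) (b0 k) X0 (mgf k) p01.
    apply: le_trans h _.
    rewrite lee_fin; apply: le_trans (sqrtD_le _ _ (ltW (b0 k)) _) _ => //.
    by rewrite mulr_ge0 ?addr_ge0// ltW.
  apply: le_trans (EVaR_sqrt_le (mD k.+1) (Dge0 k.+1) (b0 k) X0 (mgf k) p01) _.
  by rewrite lee_fin; apply: EVaR_le => //; rewrite lerDl pi_ge0.
have r1 : 0 < 1 + r by rewrite addr_gt0.
apply: le_trans (chi2_risk_sqrt_le (mD k.+1) (Dge0 k.+1) (b0 k) X0 (mgf k) r0) _.
rewrite lee_fin /EVaR_bound.
have -> : 1 / (1 - (1 - 1 / (1 + r))) = 1 + r by rewrite subKr !div1r invrK.
apply: EVaR_le; first by rewrite ln_ge0// lerDl ltW.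
  apply: (@le_trans _ _ (ln ((1 + r) * 2))).
    rewrite ler_ln ?posrE; first lra.
      by lra.
    by lra.
  rewrite lnM ?posrE// lerD2l.
  apply: (@le_trans _ _ 1); last by apply: le_trans (pi_ge2 _); lra.
  have := le_ln1Dx (x := 1 : R); rewrite (_ : 1 + 1 = 2); last by ring.
  by apply; lra.
by rewrite ln_ge0//; lra.
Qed.
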